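(* \begin{align*} \mu_2(1+x+y) &= \frac{24}{5\pi}\,\mathrm{Ti}_3\!\left(\frac{1}{\sqrt3}\right) + \frac{2\log 3}{\pi}\,\mathrm{Cl}_2\!\left(\frac{\pi}{3}\right) - \frac{\log^2 3}{10} - \frac{19\pi^2}{180}\\ &= \frac{\pi^2}{4} + \frac{3}{\pi}\,\mathrm{Ls}_3\!\left(\frac{2\pi}{3}\right). \end{align*}
   Context: For a Laurent polynomial $P$ in $n$ variables and a positive integer $k$, the higher Mahler measure is $\mu_k(P) := \int_0^1\cdots\int_0^1 \log^k\left|P\left(e^{2\pi i t_1},\ldots,e^{2\pi i t_n}\right)\right|\mathrm{d}t_1\cdots\mathrm{d}t_n$; here $P=1+x+y$ in two variables. $\mathrm{Ti}_3(x) := \sum_{n=0}^\infty (-1)^n\frac{x^{2n+1}}{(2n+1)^3}$, $\mathrm{Cl}_2(\theta) := \sum_{n=1}^\infty\frac{\sin(n\theta)}{n^2}$, and $\mathrm{Ls}_3(\sigma) := -\int_0^\sigma \log^2\left|2\sin\frac{\theta}{2}\right|\mathrm{d}\theta$. *)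

(* Defs.v *)
From mathcomp Require Import all_boot all_order all_algebra.
From mathcomp Require Import all_classical all_reals all_analysis.
From mathcomp Require Import complex.
Import Order.TTheory GRing.Theory Num.Theory.
Import numFieldNormedType.Exports.

Set Implicit Arguments.
Unset Strict Implicit.
Unset Printing Implicit Defensive.

Local Open Scope ring_scope.
Local Open Scope classical_set_scope.

Definition expi2pi (R : realType) (t : R) : R[i] :=
  (cos (2 * pi * t) +i* sin (2 * pi * t))%C.

Definition cabs (R : realType) (z : R[i]) : R := ComplexField.Normc.normc z.

Definition higher_mahler2 (R : realType) (k : nat) (P : R[i] -> R[i] -> R[i])
  : \bar R :=
  (\int[(@lebesgue_measure R \x @lebesgue_measure R)%E]_(z in `[0%R, 1%R] `*` `[0%R, 1%R])
      ((ln (cabs (P (expi2pi z.1) (expi2pi z.2)))) ^+ k)%:E)%E.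

Definition Ti3 (R : realType) (x : R) : R :=
  \big[+%R/0%R]_(0 <= n <oo) ((-1) ^+ n * x ^+ (2 * n + 1) / (2 * n + 1)%:R ^+ 3).

Definition Cl2 (R : realType) (theta : R) : R :=
  \big[+%R/0%R]_(1 <= n <oo) (sin (n%:R * theta) / n%:R ^+ 2).

(* Ls_3(sigma) = - int_0^sigma log^2 |2 sin(theta/2)| dtheta  (for sigma >= 0) *)
Definition Ls3 (R : realType) (sigma : R) : R :=
  - (\int[@lebesgue_measure R]_(theta in `[0, sigma]) (ln `|2 * sin (theta / 2)| ^+ 2))%R.

(* Main.v *)
Require Import Defs.
From mathcomp Require Import all_boot all_order all_algebra.
From mathcomp Require Import all_classical all_reals all_analysis.
From mathcomp Require Import complex.
From mathcomp Require Import measurable_realfun ring lra zify.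
Import Order.TTheory GRing.Theory Num.Theory.
Import numFieldNormedType.Exports.
Local Open Scope ring_scope.

(* Write G(x) for -Ls3(x), the integral over [0, x] of ln^2 |2 sin(t/2)|, and
   A = |1 + e(x)|^2 with e(x) = e^(2 pi i x).

   For fixed x, the logarithm of |1 + e(x) + e(y)| has an explicit Fourier series
   in y, and Parseval gives the mean of its square: ln^2 max(1, sqrt A) +
   Li2(min(A, 1/A)) / 2. With t = 2 sin(s/2), the dilogarithm is an integral over
   0 < s < pi/3 of cot(s/2)/2 times -ln(1 - t^2/A) for A > 1; for A < 1 it is the
   difference of that integral and the one with A/t^2. By Tonelli one can
   integrate over x first, which gives the Clausen values Cl2(pi - s) and Cl2(s);
   times the cotangent these have elementary primitives in terms of G, and the
   total is (3/pi) (G(pi) - G(2 pi/3)).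

   The special values of G come from integrating dLi3 = Li2 dlog z along two
   curves on which Li1 is elementary. On the arc where 1 - z = e^(-is), one gets
   G(pi/3) = 7 pi^3/108. On the imaginary segment z = i tan s, s = pi/4 gives
   G(pi) = pi^3/12, and s = pi/6 expresses Ti3(1/sqrt 3) by Cl2(pi/3) and
   G(2 pi/3), which is the equality of the two closed forms. *)

(** The mean over [x] of [Li2(min(A, 1/A))] has no evident primitive. The parameter [s] repairs
    this: once the integrals are exchanged, [ln |A - t^2|] splits into two log-sines at shifted
    angles, so its mean over [x] is made of Clausen values. The bound [pi/3] is where [t = 1]. All
    integrands are nonnegative, so Tonelli applies without an integrability proof. For the same
    reason the difference that occurs for [A < 1] is kept as an equation between sums in the
    extended reals, and the finiteness of the measure comes out only at the end.

    Two obstacles shape the rest. The integrands have logarithmic singularities at endpoints, so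
    closed forms are proved by comparing two functions with the same derivative on an open interval
    through their one-sided limits. And the series of [Li1] converges only conditionally on the unit
    circle, so it is given an explicit error of order [1/N], locally uniform away from [z = 1]; this
    makes termwise differentiation of [Li2] legitimate up to the boundary. *)

Set Implicit Arguments.
Unset Strict Implicit.
Unset Printing Implicit Defensive.

Local Open Scope classical_set_scope.

(* A wrapper around [is_derive] whose arguments mention no inferred normed
   module structure, so that matching against it stays cheap. *)
Definition der (R : realType) (f : R -> R) (x d : R) : Prop := is_derive x 1 f d.

(** * Differentiation rules in a form suited to automation *)

Section DeriveRules.
Context {R : realType}.
Implicit Types (f g : R -> R) (x df dg : R).

Lemma der_eq f x df dg : der f x df -> df = dg -> der f x dg.
Proof. by move=> hf <-. Qed.

Lemma derD f g x df dg : der f x df -> der g x dg ->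
  der (fun y => f y + g y) x (df + dg).
Proof. by move=> hf hg; exact: is_deriveD. Qed.

Lemma derN f x df : der f x df -> der (fun y => - f y) x (- df).
Proof. by move=> hf; exact: is_deriveN. Qed.

Lemma derB f g x df dg : der f x df -> der g x dg ->
  der (fun y => f y - g y) x (df - dg).
Proof. by move=> hf hg; exact: is_deriveB. Qed.

Lemma derM f g x df dg : der f x df -> der g x dg ->
  der (fun y => f y * g y) x (df * g x + f x * dg).
Proof.
move=> hf hg; apply: (der_eq (is_deriveM hf hg)).
by rewrite /GRing.scale/= addrC [g x * df]mulrC.
Qed.

Lemma derV f x df : f x != 0 -> der f x df ->
  der (fun y => (f y)^-1) x (- df / f x ^+ 2).
Proof.
move=> f0 hf; apply: (der_eq (is_deriveV f0 hf)).
by rewrite /GRing.scale/= mulrC mulrN mulNr.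
Qed.

Lemma derX f x df n : der f x df ->
  der (fun y => f y ^+ n.+1) x (n.+1%:R * f x ^+ n * df).
Proof.
move=> hf; have <- : f ^+ n.+1 = (fun y => f y ^+ n.+1).
  by apply/funext => y; elim: n => [//|n IH]; rewrite exprS fctE IH -exprS.
apply: (der_eq (is_deriveX n.+1 hf)).
by rewrite /GRing.scale/= -mulr_natl.
Qed.

Lemma der_cst c x : der (fun _ => c : R) x 0.
Proof. exact: is_derive_cst. Qed.

Lemma der_id x : der (fun y : R => y) x 1.
Proof. exact: is_derive_id. Qed.

Lemma der_comp f g x df dg : der f (g x) df -> der g x dg ->
  der (fun y => f (g y)) x (df * dg).
Proof. by move=> hf hg; exact: is_derive1_comp. Qed.

Lemma der_sin f x df : der f x df ->
  der (fun y => sin (f y)) x (cos (f x) * df).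
Proof. by move=> hf; apply: der_comp hf; exact: is_derive_sin. Qed.

Lemma der_cos f x df : der f x df ->
  der (fun y => cos (f y)) x (- sin (f x) * df).
Proof. by move=> hf; apply: der_comp hf; exact: is_derive_cos. Qed.

Lemma der_ln f x df : 0 < f x -> der f x df ->
  der (fun y => ln (f y)) x (df / f x).
Proof.
by move=> f0 hf; apply: (der_eq (der_comp (is_derive1_ln f0) hf)); rewrite mulrC.
Qed.

Lemma der_atan f x df : der f x df ->
  der (fun y => atan (f y)) x (df / (1 + f x ^+ 2)).
Proof.
by move=> hf; apply: (der_eq (der_comp (is_derive1_atan (f x)) hf)); rewrite mulrC.
Qed.

Lemma der_continuous f x df : der f x df -> {for x, continuous f}.
Proof. by case=> /derivable1_diffP/differentiable_continuous. Qed.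

End DeriveRules.

(* Redefined below, once the log-sine and Clausen functions are available. *)
Ltac der_hook := fail.

Ltac deriv :=
  lazymatch goal with
  | |- der (fun _ => ?c) _ _ => eapply der_cst
  | |- der (fun y => y) _ _ => eapply der_id
  | |- der ( *%R ?c) _ _ => eapply (@derM _ (fun _ => c) (fun y => y)); deriv
  | |- der (+%R ?c) _ _ => eapply (@derD _ (fun _ => c) (fun y => y)); deriv
  | |- der -%R _ _ => eapply (@derN _ (fun y => y)); deriv
  | |- der (fun y => @?f y - @?g y) _ _ => eapply (@derB _ f g); deriv
  | |- der (fun y => @?f y + @?g y) _ _ => eapply (@derD _ f g); deriv
  | |- der (fun y => - @?f y) _ _ => eapply (@derN _ f); deriv
  | |- der (fun y => @?f y * @?g y) _ _ => eapply (@derM _ f g); deriv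
  | |- der (fun y => @?f y ^+ ?n) _ _ => eapply (@derX _ f); deriv
  | |- der (fun y => (@?f y)^-1) _ _ => eapply (@derV _ f); [|deriv]
  | |- der (fun y => sin (@?f y)) _ _ => eapply (@der_sin _ f); deriv
  | |- der (fun y => cos (@?f y)) _ _ => eapply (@der_cos _ f); deriv
  | |- der (fun y => ln (@?f y)) _ _ => eapply (@der_ln _ f); [|deriv]
  | |- der (fun y => atan (@?f y)) _ _ => eapply (@der_atan _ f); deriv
  | |- _ => first [eassumption | der_hook | idtac]
  end.

(** * Primitives with endpoint limits, limits of derivatives, improper integrals *)

Section Calculus.
Context {R : realType}.
Implicit Types (f g F G : R -> R) (a b x y la lb : R).

Lemma derive_itv_continuous F f a b x y :
  (forall z, a < z < b -> der F z (f z)) -> a < x -> y < b ->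
  {within `[x, y], continuous F}.
Proof.
move=> dF ax yb; apply: derivable_within_continuous => z.
rewrite in_itv/= => /andP[xz zy].
by have [] := dF z; rewrite ?(lt_le_trans ax xz)// (le_lt_trans zy yb).
Qed.

Lemma derive_itv_MVT F f a b x y :
  (forall z, a < z < b -> der F z (f z)) -> a < x -> x <= y -> y < b ->
  exists2 z, x <= z <= y & F y - F x = f z * (y - x).
Proof.
move=> dF ax xy yb.
have dF' z : z \in `]x, y[%R -> der F z (f z).
  rewrite in_itv/= => /andP[xz zy].
  by apply: dF; rewrite (lt_trans ax xz) (lt_trans zy yb).
have [z] := MVT_segment xy dF' (derive_itv_continuous dF ax yb).
by rewrite in_itv/= => zxy E; exists z.
Qed.

Lemma derive0_itv_cst F a b x y : (forall z, a < z < b -> der F z 0) ->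
  a < x < b -> a < y < b -> F x = F y.
Proof.
move=> dF; wlog xy : x y / x <= y.
  by move=> H xab yab; have [xy|/ltW yx] := leP x y; [exact: H|apply/esym/H].
move=> /andP[ax _] /andP[_ yb].
have [z _ /eqP] := derive_itv_MVT dF ax xy yb.
by rewrite mul0r subr_eq0 => /eqP.
Qed.

Lemma derive0_cvg_eq F a b la lb : a < b ->
  (forall z, a < z < b -> der F z 0) ->
  F x @[x --> a^'+] --> la -> F x @[x --> b^'-] --> lb -> la = lb.
Proof.
move=> ab dF Fa Fb; pose m := (a + b) / 2.
have mab : a < m < b by rewrite /m midf_lt// [_ / 2 < _]midf_lt.
have near_m (H : set_system R) : Filter H ->
    (\forall x \near H, a < x < b) -> F x @[x --> H] --> F m.
  move=> FH Hab; apply: cvg_near_cst.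
  by apply: filterS Hab => x xab; exact: derive0_itv_cst dF xab mab.
have -> : la = F m.
  apply: (cvg_unique _ Fa) => //; apply: (near_m a^'+) ; near=> x; apply/andP; split; near: x.
    exact: nbhs_right_gt.
  exact: nbhs_right_lt.
apply/esym; apply: (cvg_unique _ Fb) => //.
apply: (near_m b^'-); near=> x; apply/andP; split; near: x.
  exact: nbhs_left_gt.
exact: nbhs_left_lt.
Unshelve. all: by end_near. Qed.

(** The common scheme behind the closed forms below: only one-sided limits are asked for at [a] and
    [b], where the functions usually contain a logarithm that is singular there. *)
Lemma primitive_cvg_eq F G f a b la lb la' lb' : a < b ->
  (forall z, a < z < b -> der F z (f z)) ->
  (forall z, a < z < b -> der G z (f z)) ->
  F x @[x --> a^'+] --> la -> F x @[x --> b^'-] --> lb ->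
  G x @[x --> a^'+] --> la' -> G x @[x --> b^'-] --> lb' ->
  lb - la = lb' - la'.
Proof.
move=> ab dF dG Fa Fb Ga Gb.
have : la - la' = lb - lb'.
  apply: (@derive0_cvg_eq (fun z => F z - G z) a b) => //; last 2 first.
  - exact: cvgB.
  - exact: cvgB.
  move=> z zab.
  by apply: der_eq; [exact: derB (dF z zab) (dG z zab)|rewrite subrr].
lra.
Qed.

Lemma cvg_der F x l :
  (forall e, 0 < e -> \forall y \near x, `|F y - F x - l * (y - x)| <= e * `|y - x|) ->
  der F x l.
Proof.
move=> H.
have cF : h^-1 *: ((F \o shift x) (h *: (1:R)) - F x) @[h --> 0^'] --> l.
  apply/cvgrPdist_le => e e0.
  have Hx : \forall h \near 0, `|F (h + x) - F x - l * h| <= e * `|h|.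
    move: H => /(_ e e0) /nbhs_ballP[d /= d0 Hd].
    apply/nbhs_ballP; exists d => //= h; rewrite /ball/= sub0r normrN => hd.
    have := Hd (h + x); rewrite addrK; apply.
    by rewrite /ball/= opprD addrCA subrr addr0 normrN.
  near=> h.
  have h0 : h != 0 by near: h; exact: nbhs_dnbhs_neq.
  rewrite /GRing.scale/= mulr1.
  have -> : l - h^-1 * (F (h + x) - F x) = - (F (h + x) - F x - l * h) / h.
    by field.
  rewrite normrM normrN normfV ler_pdivrMr ?normr_gt0//.
  by near: h; exact: nbhs_dnbhs Hx.
split; first by apply/cvg_ex; exists l.
exact: cvg_lim cF.
Unshelve. all: by end_near. Qed.

(** Termwise differentiation without integrals: the mean value theorem bounds the first-order
    remainder of each [f_ N] uniformly in [N], and the bound survives the pointwise limit. *)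
Lemma der_lim (f_ g_ : nat -> R -> R) F g (e_ : nat -> R) a b x :
  a < x < b -> (forall N y, a < y < b -> der (f_ N) y (g_ N y)) ->
  (forall y, a < y < b -> f_ N y @[N --> \oo] --> F y) ->
  (forall N y, a < y < b -> `|g_ N y - g y| <= e_ N) ->
  e_ N @[N --> \oo] --> 0 -> {for x, continuous g} -> der F x (g x).
Proof.
move=> xab df fF ge e0 cg; apply: cvg_der => d d0.
have /cvgrPdist_le /(_ d d0) gd := cg.
have : \forall y \near x, a < y < b.
  near=> y; apply/andP; split; near: y.
    by apply: lt_nbhsr; case/andP: xab.
  by apply: lt_nbhsl; case/andP: xab.
have /nbhs_ballP[r /= r0 Hr] := gd.
move=> /nbhs_ballP[s /= s0 Hs].
apply/nbhs_ballP; exists (Num.min r s); first by rewrite /= lt_min r0.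
move=> y; rewrite /ball/= lt_min => /andP[yr ys].
have yab := Hs _ ys.
(* At the intermediate point [z], [g_ N z] is within [e_ N] of [g z], which is within [d] of [g x]
   because [z] is no farther from [x] than [y] is. *)
have key N : `|f_ N y - f_ N x - g x * (y - x)| <= (e_ N + d) * `|y - x|.
  have [z zxy E] : exists2 z, `|x - z| <= `|x - y| & f_ N y - f_ N x = g_ N z * (y - x).
    have [xy|/ltW yx] := leP x y.
      case/andP: (xab) => ax _; case/andP: (yab) => _ yb.
      have [z /andP[xz zy] E] := derive_itv_MVT (df N) ax xy yb.
      by exists z => //; rewrite !ler0_norm ?subr_le0 //; lra.
    case/andP: (xab) => _ xb; case/andP: (yab) => ay _.
    have [z /andP[yz zx] E] := derive_itv_MVT (df N) ay yx xb.
    exists z; first by rewrite !ger0_norm ?subr_ge0 //; lra.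
    by rewrite -opprB E; ring.
  have zr : `|x - z| < r by exact: le_lt_trans zxy yr.
  have zab : a < z < b by apply: Hs; exact: le_lt_trans zxy ys.
  rewrite E -mulrBl normrM ler_wpM2r//.
  have -> : g_ N z - g x = (g_ N z - g z) - (g x - g z) by ring.
  by rewrite (le_trans (ler_normB _ _))// lerD ?ge//; exact: Hr.
have lhs : `|f_ N y - f_ N x - g x * (y - x)| @[N --> \oo] -->
    `|F y - F x - g x * (y - x)|.
  apply: cvg_norm; apply: cvgB; last exact: cvg_cst.
  by apply: cvgB; apply: fF.
have rhs : (e_ N + d) * `|y - x| @[N --> \oo] --> d * `|y - x|.
  have : (e_ N + d) * `|y - x| @[N --> \oo] --> (0 + d) * `|y - x|.
    by apply: cvgM; [apply: cvgD => //; exact: cvg_cst|exact: cvg_cst].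
  by rewrite add0r.
apply: (ler_cvg_to lhs rhs); near=> N; exact: key.
Unshelve. all: by end_near. Qed.

Local Notation mu := (@lebesgue_measure R).

Lemma derive_itv_measurable f a b : (forall x, a < x < b -> {for x, continuous f}) ->
  measurable_fun `]a, b[ f.
Proof.
move=> cf; apply: open_continuous_measurable_fun; first exact: interval_open.
by move=> x /set_mem; rewrite /= in_itv/=; exact: cf.
Qed.

(* The primitive need only have limits at the endpoints, so that integrable
   singularities there are allowed. *)
Lemma ge0_FTC f F a b la lb : a < b ->
  (forall x, a < x < b -> 0 <= f x) ->
  (forall x, a < x < b -> {for x, continuous f}) ->
  (forall x, a < x < b -> der F x (f x)) ->
  F x @[x --> a^'+] --> la -> F x @[x --> b^'-] --> lb ->
  (\int[mu]_(x in `]a, b[) (f x)%:E = (lb - la)%:E)%E.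
Proof.
move=> ab f0 cf dF Fa Fb.
(* Starting the denominators at 3 keeps [2 * e n < b - a], so the nested segments
   [[a + e n, b - e n]] are never degenerate; they exhaust the open interval, and monotone
   convergence passes to the limit. *)
pose e n : R := (b - a) / n.+3%:R.
have e_gt0 n : 0 < e n by rewrite divr_gt0 ?subr_gt0.
have e_half n : e n *+ 2 < b - a.
  rewrite /e -mulrnAl -[X in _ < X]mulr1 -mulr_natr -mulrA ltr_pM2l ?subr_gt0//.
  by rewrite ltr_pdivrMr// mul1r ltr_nat.
have e_dec n m : (n <= m)%N -> e m <= e n.
  by move=> nm; rewrite ler_pM2l ?subr_gt0// lef_pV2 ?posrE// ler_nat.
have e0 : e n @[n --> \oo] --> 0.
  rewrite -(mulr0 (b - a)); apply: cvgM; first exact: cvg_cst.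
  have := @cvg_harmonic R; rewrite -(cvg_shiftn 2) /=.
  by apply: cvg_trans; apply: near_eq_cvg; near=> n; rewrite addn2.
pose S n := `[a + e n, b - e n]%classic.
have SU : \bigcup_n S n = `]a, b[%classic.
  apply/seteqP; split => x /=.
    move=> [n _]; rewrite /S/= !in_itv/= => /andP[h1 h2].
    by have en := e_gt0 n; apply/andP; split; lra.
  rewrite in_itv/= => /andP[ax xb].
  have /cvgrPdist_le /(_ (Num.min (x - a) (b - x))) := e0.
  rewrite lt_min !subr_gt0 ax xb => /(_ isT) [n _ /(_ n (leqnn n))]/=.
  rewrite sub0r normrN (ger0_norm (ltW (e_gt0 n))) le_min => /andP[h1 h2].
  by exists n => //; rewrite /S/= in_itv/=; apply/andP; split; lra.
have Sab n x : S n x -> a < x < b.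
  by rewrite /S/= in_itv/= => /andP[h1 h2]; have en := e_gt0 n; apply/andP; split; lra.
have I n : (\int[mu]_(x in S n) (f x)%:E = (F (b - e n) - F (a + e n))%:E)%E.
  have abn : a + e n < b - e n by have := e_half n; rewrite mulr2n; lra.
  rewrite (@continuous_FTC2 _ f F)//.
  - apply/continuous_in_subspaceT => x /set_mem; rewrite -/(S n) => /Sab; exact: cf.
  - have Sab' x : a + e n <= x <= b - e n -> a < x < b.
      by move=> h; apply: (Sab n); rewrite /S/= in_itv/=.
    have dc x : a + e n <= x <= b - e n -> {for x, continuous F}.
      move=> /Sab' xab; have [+ _] := dF _ xab.
      by move=> /derivable1_diffP/differentiable_continuous.
    split.
    + by move=> x; rewrite in_itv/= => /andP[h1 h2]; apply: ex_derive; apply: dF;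
        apply: Sab'; rewrite !ltW.
    + by apply: cvg_at_right_filter; apply: dc; rewrite lexx ltW.
    + by apply: cvg_at_left_filter; apply: dc; rewrite lexx ltW.
  - move=> x; rewrite in_itv/= => /andP[h1 h2]; rewrite derive1E.
    apply: derive_val; apply: dF; apply: (Sab n).
    by rewrite /S/= in_itv/= !ltW.
have mS n : measurable (S n) by exact: measurable_itv.
have mf n : measurable_fun (S n) (EFin \o f).
  apply/measurable_EFinP; apply: measurable_funS (derive_itv_measurable cf) => //.
  by move=> x /Sab; rewrite /= in_itv.
have Snd : nondecreasing_seq S.
  move=> n m nm; apply/subsetPset => x; rewrite /S/= !in_itv/= => /andP[h1 h2].
  by have en := e_dec _ _ nm; apply/andP; split; lra.
have cvg1 : (\int[mu]_(x in S n) (f x)%:E @[n --> \oo] -->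
    \int[mu]_(x in \bigcup_n S n) (f x)%:E)%E.
  apply: ge0_nondecreasing_set_cvg_integral => //.
  by move=> n x /Sab/f0; rewrite lee_fin.
rewrite SU in cvg1.
apply: (cvg_unique _ cvg1) => //; rewrite (funext I).
apply: cvg_EFin; first by near=> n.
apply: cvgB.
- move/cvg_at_leftP : Fb; apply; split; first by move=> n; rewrite ltrBlDr ltrDl.
  by rewrite -[X in _ --> X]subr0; apply: cvgB => //; exact: cvg_cst.
- move/cvg_at_rightP : Fa; apply; split; first by move=> n; rewrite ltrDl.
  by rewrite -[X in _ --> X]addr0; apply: cvgD => //; exact: cvg_cst.
Unshelve. all: by end_near. Qed.

End Calculus.

(** * Polylogarithms *)

Section Polylog.
Context {R : realType}.
Implicit Types (r b u v x y : R) (k N : nat).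

(** Both [H - F] and [H + F] have a nonnegative derivative. This replaces the estimate of an
    integral by the integral of a majorant. *)
Lemma derive_norm_le (F H f h : R -> R) x y : x <= y ->
  (forall z, x <= z <= y -> der F z (f z)) ->
  (forall z, x <= z <= y -> der H z (h z)) ->
  (forall z, x <= z <= y -> `|f z| <= h z) ->
  `|F y - F x| <= H y - H x.
Proof.
move=> xy dF dH fh.
suff key (G g : R -> R) : (forall z, x <= z <= y -> der G z (g z)) ->
    (forall z, x <= z <= y -> g z <= h z) -> G y - G x <= H y - H x.
  rewrite ler_norml; apply/andP; split.
    rewrite lerNl opprB addrC -[F x]opprK.
    apply: (key (fun z => - F z) (fun z => - f z)) => z zxy.
      by have dFz := dF z zxy; exact: derN.
    by rewrite (le_trans _ (fh z zxy))// -normrN ler_norm.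
  by apply: key dF _ => z zxy; rewrite (le_trans _ (fh z zxy))// ler_norm.
move=> dG gh.
have dHG z : x <= z <= y -> der (fun z => H z - G z) z (h z - g z).
  by move=> zxy; have dHz := dH z zxy; have dGz := dG z zxy; exact: derB.
have dHG' z : z \in `]x, y[%R -> der (fun z => H z - G z) z (h z - g z).
  by rewrite in_itv/= => /andP[xz zy]; apply: dHG; rewrite !ltW.
have cHG : {within `[x, y], continuous (fun z => H z - G z)}.
  apply: derivable_within_continuous => z; rewrite in_itv/= => zxy.
  by have [] := dHG z zxy.
have [z] := MVT_segment xy dHG' cHG.
rewrite in_itv/= => zxy E.
have : 0 <= (H y - G y) - (H x - G x).
  by rewrite E mulr_ge0 ?subr_ge0// gh.
lra.
Qed.

(** Real part of [(u - i v) e^(i x)]. Carrying the pair keeps the family closed under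
    differentiation in the angle, which sends [(u, v)] to [(v, - u)], so cosine and sine series are
    treated at once. *)
Definition trig u v x : R := u * cos x + v * sin x.

Definition pterm k r b u v (i : nat) : R :=
  r ^+ i.+1 * trig u v (i.+1%:R * b) / i.+1%:R ^+ k.

Definition psum k r b u v N : R := \sum_(0 <= i < N) pterm k r b u v i.

(* The real part of [(u - i v) Li_k(r e^(i b))]; thus [u, v = 1, 0] gives the
   real part of the polylogarithm and [u, v = 0, 1] its imaginary part. *)
Definition polylog k r b u v : R := limn (psum k r b u v).

Lemma psumS k r b u v N :
  psum k r b u v N.+1 = psum k r b u v N + pterm k r b u v N.
Proof. by rewrite /psum big_nat_recr. Qed.

Lemma psum0 k r b u v : psum k r b u v 0 = 0.
Proof. by rewrite /psum big_geq. Qed.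

Lemma norm_trig u v x : `|trig u v x| <= `|u| + `|v|.
Proof.
rewrite (le_trans (ler_normD _ _))// !normrM.
by rewrite lerD// ler_piMr// ?cos_max ?sin_max.
Qed.

Lemma trig_rec u v b N :
  trig u v (N.+2%:R * b) = 2 * cos b * trig u v (N.+1%:R * b) - trig u v (N%:R * b).
Proof.
have -> : N.+2%:R * b = N.+1%:R * b + b by rewrite -[N.+2%:R]natr1; ring.
have -> : N%:R * b = N.+1%:R * b - b by rewrite -natr1; ring.
by rewrite /trig !cosD !sinD cosN sinN; ring.
Qed.

(** [|1 - z|^2] for [z = r e^(i b)]. *)
Definition cdist2 r b : R := 1 - 2 * r * cos b + r ^+ 2.

(** The geometric sum of [e^(i b) z^i], multiplied by [|1 - z|^2] rather than divided by it; the
    induction uses only the three-term recurrence [trig_rec]. The last two terms are the remainder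
    estimated in [psum1_error]. *)
Lemma geometric_trig r b u v N :
  cdist2 r b * \sum_(0 <= i < N) r ^+ i * trig u v (i.+1%:R * b) =
  u * (cos b - r) + v * sin b
  - r ^+ N * trig u v (N.+1%:R * b) + r ^+ N.+1 * trig u v (N%:R * b).
Proof.
elim: N => [|N IH].
  by rewrite big_geq// mulr0 expr0 expr1 mul1r mul0r /trig cos0 sin0 mul1r; ring.
rewrite big_nat_recr//= mulrDr IH trig_rec !exprS /cdist2; ring.
Qed.

(** A lower bound free of [r], hence usable along the whole radius up to the unit circle. The
    difference of the two sides is a combination, with weights [(1 - c) / 2] and [(1 + c) / 2], of
    nonnegative terms. *)
Lemma cdist2_ge r b : 0 <= r -> (1 - cos b) / 2 <= cdist2 r b.
Proof.
move=> r0; have h1 := cos_le1 b; have h2 := cos_geN1 b; rewrite /cdist2.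
set c := cos b in h1 h2 *.
have : 0 <= (1 - c) / 2 * (r ^+ 2 + 2 * r) + (1 + c) / 2 * (1 - r) ^+ 2.
  by apply: addr_ge0; apply: mulr_ge0; rewrite ?sqr_ge0 ?addr_ge0 ?mulr_ge0 ?sqr_ge0//; lra.
lra.
Qed.

Lemma cdist2_ge_sqr r b : 0 <= r -> (1 - r) ^+ 2 <= cdist2 r b.
Proof.
move=> r0; have h1 := cos_le1 b; rewrite /cdist2 -subr_ge0.
have -> : 1 - 2 * r * cos b + r ^+ 2 - (1 - r) ^+ 2 = 2 * r * (1 - cos b) by ring.
by rewrite !mulr_ge0// subr_ge0.
Qed.

(** Real part of [(u - i v) Li1(z)], where [Li1(z) = - log (1 - z)] on the principal branch: the
    arctangent is minus the argument of [1 - z], correct as long as [r cos b < 1]. *)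
Definition polylog1 r b u v : R :=
  v * atan (r * sin b / (1 - r * cos b)) - u / 2 * ln (cdist2 r b).

Lemma der_polylog1 r b u v : 0 < cdist2 r b -> 1 - r * cos b != 0 ->
  der (fun r => polylog1 r b u v) r
    ((u * (cos b - r) + v * sin b) / cdist2 r b).
Proof.
move=> D0 c0; rewrite /polylog1.
have S0 : cdist2 r b != 0 by rewrite gt_eqF.
have E : cdist2 r b = (1 - r * cos b) ^+ 2 + (r * sin b) ^+ 2.
  by rewrite /cdist2 exprMn sin2cos2; ring.
apply: der_eq; first by rewrite /cdist2; deriv.
rewrite -/(cdist2 r b).
have q : 1 + (r * sin b / (1 - r * cos b)) ^+ 2 = cdist2 r b / (1 - r * cos b) ^+ 2.
  by rewrite E; field.
by rewrite q; field; rewrite ?c0 ?S0.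
Qed.

Lemma der_psum1 r b u v N : der (fun r => psum 1 r b u v N) r
  (\sum_(0 <= i < N) r ^+ i * trig u v (i.+1%:R * b)).
Proof.
elim: N => [|N IH].
  have -> : (fun r => psum 1 r b u v 0) = (fun _ => 0).
    by apply/funext => y; rewrite psum0.
  by rewrite big_geq//; exact: der_cst.
have -> : (fun r => psum 1 r b u v N.+1) =
    (fun r => psum 1 r b u v N + pterm 1 r b u v N).
  by apply/funext => y; rewrite psumS.
rewrite big_nat_recr//=; apply: derD => //.
apply: der_eq; first by rewrite /pterm; deriv.
by rewrite expr1; field; rewrite nat1r pnatr_eq0.
Qed.

(* The derivative of the difference in [r] is a geometric remainder, of size at
   most [2 (|u| + |v|) r^N / m]. *)
Lemma psum1_error r b u v (m : R) N : 0 <= r <= 1 -> r * cos b < 1 -> 0 < m ->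
  (forall s, 0 <= s <= r -> m <= cdist2 s b) ->
  `|psum 1 r b u v N - polylog1 r b u v| <= 2 * (`|u| + `|v|) / m / N.+1%:R.
Proof.
move=> /andP[r0 r1] rc m0 mD; set K : R := `|u| + `|v|.
have K0 : 0 <= K by rewrite addr_ge0.
pose F s : R := psum 1 s b u v N - polylog1 s b u v.
pose H (s : R) : R := 2 * K / m / N.+1%:R * s ^+ N.+1.
pose c n := trig u v (n%:R * b).
pose f (s : R) : R := (- s ^+ N * c N.+1 + s ^+ N.+1 * c N) / cdist2 s b.
pose h (s : R) : R := 2 * K / m * s ^+ N.
have D0 s : 0 <= s <= r -> 0 < cdist2 s b by move=> /mD; exact: lt_le_trans.
have F0 : F 0 = 0.
  rewrite /F /polylog1 /cdist2 !mul0r atan0 mulr0 !mulr0 mul0r expr0n subr0 addr0 ln1.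
  rewrite mulr0 subr0 subr0 /psum big1// => i _.
  by rewrite /pterm expr0n mul0r mul0r.
have H0 : H 0 = 0 by rewrite /H expr0n mulr0.
have dF s : 0 <= s <= r -> der F s (f s).
  move=> s0r; have Ds := D0 s s0r; have /andP[s0 sr] := s0r.
  have sc : 1 - s * cos b != 0.
    rewrite gt_eqF// subr_gt0; have [c0|c0] := leP 0 (cos b).
      by rewrite (le_lt_trans _ rc)// ler_wpM2r.
    by rewrite (le_lt_trans _ ltr01)// mulr_ge0_le0// ltW.
  apply: der_eq.
    by apply: derD; [exact: der_psum1|apply: derN; exact: der_polylog1].
  have E := geometric_trig s b u v N.
  apply: (mulfI (lt0r_neq0 Ds)); rewrite mulrBr E /f /c.
  by field; rewrite lt0r_neq0.
have dH s : 0 <= s <= r -> der H s (h s).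
  move=> _; apply: der_eq; first by rewrite /H; deriv.
  by rewrite /h; field; rewrite nat1r pnatr_eq0 lt0r_neq0.
have fh s : 0 <= s <= r -> `|f s| <= h s.
  move=> s0r; have Ds := D0 s s0r; have /andP[s0 sr] := s0r.
  rewrite /f normrM normfV (gtr0_norm Ds) ler_pdivrMr//.
  have cK n : `|c n| <= K by exact: norm_trig.
  have sN : 0 <= s ^+ N by exact: exprn_ge0.
  have h1 : `|- s ^+ N * c N.+1 + s ^+ N.+1 * c N| <= s ^+ N * K + s ^+ N * K.
    rewrite (le_trans (ler_normD _ _))// !normrM normrN.
    rewrite (ger0_norm sN) [`|s ^+ N.+1|]ger0_norm ?exprn_ge0//.
    apply: lerD; first by rewrite ler_wpM2l.
    apply: ler_pM => //; first exact: exprn_ge0.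
    by rewrite exprS ler_piMl// (le_trans sr).
  apply: (le_trans h1); rewrite /h.
  have -> : s ^+ N * K + s ^+ N * K = 2 * K / m * s ^+ N * m.
    by field; rewrite lt0r_neq0.
  by rewrite ler_wpM2l ?mD// !mulr_ge0// invr_ge0 ltW.
have := derive_norm_le r0 dF dH fh; rewrite F0 H0 !subr0 /F => /le_trans; apply.
rewrite /H ler_piMr ?exprn_ile1//.
by rewrite !mulr_ge0 ?invr_ge0// ltW.
Qed.

(** The majorant telescopes, so convergence and the tail bound [2 K / (N + 1)] come out of the same
    computation. *)
Lemma telescope_cvg (a : nat -> R) (K : R) :
  (forall i, `|a i| <= K * (2 / i.+1%:R - 2 / i.+2%:R)) ->
  cvgn (fun N => \sum_(0 <= i < N) a i) /\
  forall N, `|limn (fun N => \sum_(0 <= i < N) a i) - \sum_(0 <= i < N) a i|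
    <= 2 * K / N.+1%:R.
Proof.
move=> aK; pose d i : R := K * (2 / i.+1%:R - 2 / i.+2%:R).
pose S := series a.
have d_sum N M : (N <= M)%N ->
    \sum_(N <= i < M) d i = K * (2 / N.+1%:R - 2 / M.+1%:R).
  move=> NM; rewrite -mulr_sumr; congr (K * _).
  have := telescope_sumr (fun i => - (2 / i.+1%:R) : R) NM.
  rewrite opprK addrC => <-; apply: eq_bigr => i _; by rewrite opprK addrC.
have K0 : 0 <= K.
  have := le_trans (normr_ge0 _) (aK 0).
  have -> : (2 / 1 - 2 / 2 : R) = 1 by field.
  by rewrite mulr1.
have S_dist N M : (N <= M)%N -> `|S M - S N| <= 2 * K / N.+1%:R.
  move=> NM; rewrite /S sub_series_geq//.
  rewrite (le_trans (ler_norm_sum _ _ _))//.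
  rewrite (@le_trans _ _ (\sum_(N <= i < M) d i))//; first exact: ler_sum.
  rewrite d_sum// mulrBr -[X in _ <= X]subr0.
  have -> : 2 * K / N.+1%:R = K * (2 / N.+1%:R) by ring.
  by rewrite lerD2l lerN2 mulr_ge0// divr_ge0.
have d0 i : 0 <= d i by exact: le_trans (normr_ge0 _) (aK i).
have cS : cvgn S.
  apply: normed_cvg; apply: (@series_le_cvg _ _ d) => [i|i|i|].
  - exact: normr_ge0.
  - exact: d0.
  - exact: aK.
  apply: nondecreasing_is_cvgn; first by apply: nondecreasing_series => i _ _.
  exists (2 * K) => _ [N _ <-]; rewrite /series/= d_sum//.
  have : 0 <= 2 / N.+1%:R :> R by rewrite divr_ge0.
  set t := 2 / N.+1%:R => t0; rewrite divr1.
  by have := mulr_ge0 K0 t0; lra.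
split => // N.
have /cvg_norm h : S M - S N @[M --> \oo] --> limn S - S N.
  by apply: cvgB => //; exact: cvg_cst.
apply: (cvgr_to_le h); near=> M; apply: S_dist; near: M; exact: nbhs_infty_ge.
Unshelve. all: by end_near. Qed.

(** With [n = i + 1]: [1 / n^k <= 1 / n^2 <= 2 / (n (n + 1))], and the last fraction telescopes. *)
Lemma norm_pterm_le k r b u v i : `|r| <= 1 -> (1 < k)%N ->
  `|pterm k r b u v i| <= (`|u| + `|v|) * (2 / i.+1%:R - 2 / i.+2%:R).
Proof.
move=> r1 k1; rewrite /pterm normrM normrM normfV normrX.
have -> : (2 / i.+1%:R - 2 / i.+2%:R : R) = 2 / (i.+1%:R * i.+2%:R).
  have : i.+1%:R != 0 :> R by rewrite pnatr_eq0.
  have : i.+2%:R != 0 :> R by rewrite pnatr_eq0.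
  rewrite -[i.+2%:R]natr1; set a : R := i.+1%:R => a1 a0.
  by field; apply/andP; split => //; rewrite addrC.
apply: (@le_trans _ _ (1 * (`|u| + `|v|) / i.+1%:R ^+ k)).
  rewrite [`|_ ^+ k|]ger0_norm ?exprn_ge0//; apply: ler_wpM2r.
    by rewrite invr_ge0 exprn_ge0.
  by apply: ler_pM => //; [exact: exprn_ile1|exact: norm_trig].
rewrite mul1r; apply: ler_wpM2l; first exact: addr_ge0.
rewrite ler_pdivlMr ?mulr_gt0// mulrC ler_pdivrMr ?exprn_gt0//.
case: k k1 => [//|[//|k]] _; rewrite !exprS mulrA.
have h1 : 1 <= i.+1%:R ^+ k :> R by rewrite exprn_ege1// ler1n.
have h2 : i.+2%:R <= 2 * i.+1%:R :> R by rewrite -natrM ler_nat; lia.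
apply: (@le_trans _ _ (i.+1%:R * (2 * i.+1%:R))); first by rewrite ler_wpM2l.
rewrite mulrCA -[X in X <= _]mulr1 -!mulrA; apply: ler_wpM2l => //.
by rewrite !mulrA; apply: ler_wpM2l => //; exact: mulr_ge0.
Qed.

Lemma polylog_cvg k r b u v : `|r| <= 1 -> (1 < k)%N ->
  psum k r b u v N @[N --> \oo] --> polylog k r b u v.
Proof.
by move=> r1 k1; have [] := telescope_cvg (fun i => norm_pterm_le b u v i r1 k1).
Qed.

Lemma polylog_error k r b u v N : `|r| <= 1 -> (1 < k)%N ->
  `|psum k r b u v N - polylog k r b u v| <= 2 * (`|u| + `|v|) / N.+1%:R.
Proof.
move=> r1 k1; rewrite distrC.
by have [_ ->] := telescope_cvg (fun i => norm_pterm_le b u v i r1 k1).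
Qed.

End Polylog.

(** * Polylogarithms along a curve given in polar coordinates *)

Section PolylogCurve.
Context {R : realType}.
Implicit Types (u v s : R) (k N : nat).

Lemma der_lim_near (f_ g_ : nat -> R -> R) (F g : R -> R) (e_ : nat -> R) (x : R) :
  (\forall y \near x, forall N, der (f_ N) y (g_ N y)) ->
  (\forall y \near x, f_ N y @[N --> \oo] --> F y) ->
  (\forall y \near x, forall N, `|g_ N y - g y| <= e_ N) ->
  e_ N @[N --> \oo] --> 0 -> {for x, continuous g} -> der F x (g x).
Proof.
move=> df fF ge e0 cg.
have : \forall y \near x, [/\ forall N, der (f_ N) y (g_ N y),
    f_ N y @[N --> \oo] --> F y & forall N, `|g_ N y - g y| <= e_ N].
  by near=> y; split; near: y.
move=> /nbhs_ballP[r /= r0 H].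
have {}H y : x - r < y < x + r -> [/\ forall N, der (f_ N) y (g_ N y),
    f_ N y @[N --> \oo] --> F y & forall N, `|g_ N y - g y| <= e_ N].
  by move=> /andP[h1 h2]; apply: H; rewrite /ball/= ltr_norml; apply/andP; split; lra.
apply: (@der_lim _ f_ g_ F g e_ (x - r) (x + r) x) => //.
- by rewrite ltrBlDr !ltrDl r0.
- by move=> N y /H[].
- by move=> y /H[].
- by move=> N y /H[].
Unshelve. all: by end_near. Qed.

(** This is [d Li_(k+1) = Li_k d log z] with [log z = ln rho + i beta]: the radial part contributes
    [rho' / rho], and the factor [i] of the angular part turns [(u, v)] into [(v, - u)]. *)
Lemma der_psum k (rho beta : R -> R) u v N s (rho' beta' : R) :
  der rho s rho' -> der beta s beta' -> rho s != 0 ->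
  der (fun y => psum k.+1 (rho y) (beta y) u v N) s
    (rho' / rho s * psum k (rho s) (beta s) u v N +
     beta' * psum k (rho s) (beta s) v (- u) N).
Proof.
move=> drho dbeta rho0; elim: N => [|N IH].
  have -> : (fun y => psum k.+1 (rho y) (beta y) u v 0) = (fun _ => 0).
    by apply/funext => y; rewrite psum0.
  by rewrite !psum0 !mulr0 addr0; exact: der_cst.
have -> : (fun y => psum k.+1 (rho y) (beta y) u v N.+1) =
    (fun y => psum k.+1 (rho y) (beta y) u v N + pterm k.+1 (rho y) (beta y) u v N).
  by apply/funext => y; rewrite psumS.
rewrite !psumS.
have n0 : N.+1%:R != 0 :> R by rewrite pnatr_eq0.
apply: der_eq; first apply: derD IH _.
  by rewrite /pterm /trig; deriv.
rewrite /= /pterm /trig !exprS; set n : R := N.+1%:R in n0 *; clearbody n.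
have : n ^+ k != 0 by rewrite expf_neq0.
set nk := n ^+ k => nk0; set rN := rho s ^+ N.
by field; rewrite rho0 n0 nk0.
Qed.

Lemma harmonic_cvg0 (C : R) : C / N.+1%:R @[N --> \oo] --> 0.
Proof.
rewrite -(mulr0 C); apply: cvgM; first exact: cvg_cst.
exact: (@cvg_harmonic R).
Qed.

(** The level-[k] functions enter as arbitrary [p] and [q] with a common error [e]. This covers
    [k = 1], where the error comes from [psum1_error], together with [k >= 2], where it comes from
    the absolutely convergent series. *)
Lemma der_polylog k (rho beta rho' beta' p q : R -> R) (e : nat -> R) u v s :
  (0 < k)%N ->
  (\forall y \near s, der rho y (rho' y)) ->
  (\forall y \near s, der beta y (beta' y)) ->
  (\forall y \near s, rho y != 0 /\ `|rho y| <= 1) ->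
  (\forall y \near s, forall N, `|psum k (rho y) (beta y) u v N - p y| <= e N) ->
  (\forall y \near s,
    forall N, `|psum k (rho y) (beta y) v (- u) N - q y| <= e N) ->
  e N @[N --> \oo] --> 0 ->
  {for s, continuous rho'} -> {for s, continuous beta'} ->
  {for s, continuous p} -> {for s, continuous q} ->
  der (fun y => polylog k.+1 (rho y) (beta y) u v) s
    (rho' s / rho s * p s + beta' s * q s).
Proof.
move=> k0 drho dbeta rho1 ep eq e0 crho' cbeta' cp cq.
have crho : {for s, continuous rho} by exact: der_continuous (nbhs_singleton drho).
have [rho0 _] := nbhs_singleton rho1.
have cl : {for s, continuous (fun y => rho' y / rho y)}.
  by apply: continuousM => //; exact: continuousV.
pose g y := rho' y / rho y * p y + beta' y * q y.
pose C := `|rho' s / rho s| + 1 + (`|beta' s| + 1).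
apply: (@der_lim_near
  (fun N y => psum k.+1 (rho y) (beta y) u v N)
  (fun N y => rho' y / rho y * psum k (rho y) (beta y) u v N +
     beta' y * psum k (rho y) (beta y) v (- u) N)
  _ g (fun N => C * e N)).
- near=> y => N; apply: der_psum; near: y => //.
  by apply: filterS rho1 => y [].
- near=> y; apply: polylog_cvg => //; near: y.
  by apply: filterS rho1 => y [].
- have bnd (h : R -> R) : {for s, continuous h} -> \forall y \near s, `|h y| <= `|h s| + 1.
    move=> ch; have := cvgr_norm_le _ ch; apply; rewrite ltrDl//.
  near=> y => N; rewrite /g.
  have -> : rho' y / rho y * psum k (rho y) (beta y) u v N +
      beta' y * psum k (rho y) (beta y) v (- u) N -
      (rho' y / rho y * p y + beta' y * q y) =
    rho' y / rho y * (psum k (rho y) (beta y) u v N - p y) +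
    beta' y * (psum k (rho y) (beta y) v (- u) N - q y) by ring.
  rewrite (le_trans (ler_normD _ _))// mulrDl normrM [`|beta' y * _|]normrM.
  apply: lerD; apply: ler_pM => //.
  + by near: y; exact: (bnd (fun y => rho' y / rho y)).
  + by move: N; near: y.
  + by near: y; exact: bnd.
  + by move: N; near: y.
- by rewrite -(mulr0 C); apply: cvgM => //; exact: cvg_cst.
- by apply: continuousD; apply: continuousM.
Unshelve. all: by end_near. Qed.

(** The truncation error is the same on the whole closed disc, so the usual three-epsilon argument
    applies. An arbitrary filter allows one-sided limits along curves that end on the unit
    circle. *)
Lemma cvg_polylog k (T : Type) (F : set_system T) (FF : ProperFilter F)
    (rho beta : T -> R) (r b u v : R) : (1 < k)%N ->
  rho t @[t --> F] --> r -> beta t @[t --> F] --> b ->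
  (\forall t \near F, `|rho t| <= 1) ->
  polylog k (rho t) (beta t) u v @[t --> F] --> polylog k r b u v.
Proof.
move=> k1 rhor betab rho1.
have r1 : `|r| <= 1 by apply: (cvgr_to_le (cvg_norm rhor)).
have cpsum N : psum k (rho t) (beta t) u v N @[t --> F] --> psum k r b u v N.
  elim: N => [|N IH].
    by under eq_fun do rewrite psum0; rewrite psum0; exact: cvg_cst.
  under eq_fun do rewrite psumS; rewrite psumS; apply: cvgD => //.
  rewrite /pterm /trig; apply: cvgM; last exact: cvg_cst.
  have cn : N.+1%:R * beta t @[t --> F] --> N.+1%:R * b.
    by apply: cvgM => //; exact: cvg_cst.
  apply: cvgM.
    exact: (continuous_cvg _ (@exprn_continuous R N.+1 r) rhor).
  apply: cvgD; (apply: cvgM; first exact: cvg_cst).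
    exact: (continuous_cvg _ (@continuous_cos R _) cn).
  exact: (continuous_cvg _ (@continuous_sin R _) cn).
apply/cvgrPdist_le => e e0.
have e3 : 0 < e / 3 by rewrite divr_gt0.
have /cvgrPdist_le/(_ _ e3)[N _ /(_ N (leqnn N))] :=
  harmonic_cvg0 (2 * (`|u| + `|v|)).
rewrite /= sub0r normrN ger0_norm; last first.
  by rewrite divr_ge0// mulr_ge0// addr_ge0.
move=> Ne.
near=> t.
have t1 : `|rho t| <= 1 by near: t.
have h1 := le_trans (polylog_error b u v N r1 k1) Ne.
have h2 := le_trans (polylog_error (beta t) u v N t1 k1) Ne.
have h3 : `|psum k r b u v N - psum k (rho t) (beta t) u v N| <= e / 3.
  by near: t; move/cvgrPdist_le: (cpsum N); apply.
move: h1 h2 h3; set A := polylog k r b u v; set B := polylog k _ _ _ _.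
set a := psum k r b u v N; set c := psum _ _ _ _ _ _ => h1 h2 h3.
have -> : A - B = - (a - A) + (a - c) + (c - B) by ring.
rewrite (le_trans (ler_normD _ _))// (le_trans (lerD (ler_normD _ _) (lexx _)))//.
rewrite normrN; lra.
Unshelve. all: by end_near. Qed.

(** One factor [r] comes out of every term. The linear vanishing at [z = 0] is what absorbs powers
    of [ln |z|] in the boundary limits. *)
Lemma polylog_norm_le k (r b u v : R) : `|r| <= 1 -> (1 < k)%N ->
  `|polylog k r b u v| <= 2 * (`|u| + `|v|) * `|r|.
Proof.
move=> r1 k1; have [r0|r0] := eqVneq r 0.
  rewrite /polylog (_ : psum k r b u v = fun _ => 0) ?lim_cst// ?r0 ?normr0 ?mulr0//.
  apply/funext => N; rewrite /psum big1// => i _.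
  by rewrite /pterm expr0n mul0r mul0r.
have h i : `|pterm k r b u v i| <=
    (`|r| * (`|u| + `|v|)) * (2 / i.+1%:R - 2 / i.+2%:R).
  have E : pterm k r b u v i = r * (r ^+ i * trig u v (i.+1%:R * b) / i.+1%:R ^+ k).
    by rewrite /pterm exprS !mulrA.
  have := @norm_pterm_le R k 1 (i.+1%:R * b / i.+1%:R) u v i.
  rewrite E /pterm normr1 lexx => /(_ isT k1).
  have n0 : i.+1%:R != 0 :> R by rewrite pnatr_eq0.
  rewrite expr1n mul1r mulrCA divff// mulr1 => H.
  rewrite -[X in _ <= X]mulrA normrM; apply: ler_wpM2l => //.
  apply: le_trans H; rewrite -mulrA normrM ler_piMl// normrX.
  exact: exprn_ile1.
have [_ /(_ 0)] := telescope_cvg h.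
rewrite big_geq// subr0 divr1 => /le_trans; apply.
by rewrite -mulrA [`|r| * _]mulrC mulrA.
Qed.

End PolylogCurve.

(** * The unit circle and the Clausen function *)

Section PolylogValues.
Context {R : realType}.
Implicit Types (u v s x y : R) (k N : nat).

Lemma der_polylog_ge2 k (rho beta rho' beta' : R -> R) u v s : (1 < k)%N ->
  (\forall y \near s, der rho y (rho' y)) ->
  (\forall y \near s, der beta y (beta' y)) ->
  (\forall y \near s, rho y != 0 /\ `|rho y| <= 1) ->
  {for s, continuous rho'} -> {for s, continuous beta'} ->
  der (fun y => polylog k.+1 (rho y) (beta y) u v) s
    (rho' s / rho s * polylog k (rho s) (beta s) u v +
     beta' s * polylog k (rho s) (beta s) v (- u)).
Proof.
move=> k1 drho dbeta rho1 crho' cbeta'.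
have crho : {for s, continuous rho} by exact: der_continuous (nbhs_singleton drho).
have cbeta : {for s, continuous beta} by exact: der_continuous (nbhs_singleton dbeta).
have rho1' : \forall y \near s, `|rho y| <= 1 by apply: filterS rho1 => y [].
apply: (@der_polylog R k rho beta rho' beta'
  (fun y => polylog k (rho y) (beta y) u v)
  (fun y => polylog k (rho y) (beta y) v (- u))
  (fun N => 2 * (`|u| + `|v|) / N.+1%:R)) => //.
- exact: ltnW.
- by near=> y => N; apply: polylog_error => //; near: y.
- near=> y => N; rewrite [`|u| + _]addrC -[`|u|]normrN.
  by apply: polylog_error => //; near: y.
- exact: harmonic_cvg0.
- exact: (@cvg_polylog R k R (nbhs s) _ rho beta).
- exact: (@cvg_polylog R k R (nbhs s) _ rho beta).
Unshelve. all: by end_near. Qed.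

Lemma cos_half x : cos x = 1 - 2 * sin (x / 2) ^+ 2.
Proof.
have {1}-> : x = x / 2 + x / 2 by field.
by rewrite cosD -!expr2 cos2sin2; ring.
Qed.

Lemma sin_half x : sin x = 2 * sin (x / 2) * cos (x / 2).
Proof.
have {1}-> : x = x / 2 + x / 2 by field.
by rewrite sinD; ring.
Qed.

Lemma cos_lt1 x : 0 < x < 2 * pi -> cos x < 1.
Proof.
move=> /andP[x0 xpi]; rewrite cos_half ltrBlDr ltrDl mulr_gt0// exprn_gt0//.
by apply: sin_gt0_pi; apply/andP; split; lra.
Qed.

(** [ln |2 sin (x / 2)| = ln |1 - e^(i x)|], written through the squared modulus so that symmetries
    and products reduce to identities between cosines. *)
Definition lsin x : R := ln (2 - 2 * cos x) / 2.

Lemma der_lsin x : cos x < 1 -> der lsin x (sin x / (2 - 2 * cos x)).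
Proof.
move=> c1; have h : 0 < 2 - 2 * cos x by lra.
apply: der_eq; first by rewrite /lsin; deriv.
by field; rewrite lt0r_neq0.
Qed.

Lemma polylog1_circle x u v :
  polylog1 1 x u v = v * atan (sin x / (1 - cos x)) - u * lsin x.
Proof.
rewrite /polylog1 /lsin /cdist2 !mul1r mulr1 expr1n.
have -> : 1 - 2 * cos x + 1 = 2 - 2 * cos x :> R by ring.
by congr (_ - _); field.
Qed.

(** Half-angle formulas turn the quotient into the cotangent of [x / 2]. An argument linear in [x]
    is what makes the real part of [Li2] quadratic on the circle. *)
Lemma arg_circle x : 0 < x < 2 * pi -> atan (sin x / (1 - cos x)) = (pi - x) / 2.
Proof.
move=> x0; have s0 : sin (x / 2) != 0.
  by rewrite gt_eqF// sin_gt0_pi//; apply/andP; split; lra.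
have -> : sin x / (1 - cos x) = tan ((pi - x) / 2).
  rewrite (sin_half x) (cos_half x) /tan.
  have -> : (pi - x) / 2 = pi / 2 - x / 2 by ring.
  rewrite sinB cosB sin_pihalf cos_pihalf.
  field; rewrite s0 /=.
  by rewrite opprB addrC subrK mulf_neq0// expf_neq0.
rewrite tanK// in_itv/=; apply/andP; split; lra.
Qed.

(** Near [s] the cosine stays below [(1 + cos s) / 2], and [cdist2_ge] then bounds [|1 - z|^2] below
    by [(1 - cos s) / 4] along every radius involved. *)
Lemma circle_error s u v : cos s < 1 ->
  \forall y \near s, forall N, `|psum 1 1 y u v N - polylog1 1 y u v| <=
    2 * (`|u| + `|v|) / ((1 - cos s) / 4) / N.+1%:R.
Proof.
move=> s1.
have : \forall y \near s, cos y <= (1 + cos s) / 2.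
  by apply: (cvgr_le _ (@continuous_cos R s)); lra.
apply: filterS => y cy N; apply: psum1_error.
- by rewrite ler01 lexx.
- by rewrite mul1r; lra.
- by rewrite divr_gt0// subr_gt0.
- by move=> t /andP[t0 _]; apply: le_trans (cdist2_ge y t0); lra.
Qed.

Lemma continuous_polylog1_circle s u v : cos s < 1 ->
  {for s, continuous (fun y => polylog1 1 y u v)}.
Proof.
move=> s1.
have -> : (fun y => polylog1 1 y u v) =
    (fun y => v * atan (sin y / (1 - cos y)) - u * (ln (2 - 2 * cos y) / 2)).
  by apply/funext => y; rewrite polylog1_circle.
have h : 0 < 2 - 2 * cos s by lra.
have h' : 1 - cos s != 0 by rewrite gt_eqF// subr_gt0.
by eapply der_continuous; deriv.
Qed.

Lemma der_polylog_circle s u v : cos s < 1 ->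
  der (fun y => polylog 2 1 y u v) s (polylog1 1 s v (- u)).
Proof.
move=> s1; apply: der_eq.
  apply: (@der_polylog R 1 (fun _ => 1) (fun y => y) (fun _ => 0) (fun _ => 1)
    (fun y => polylog1 1 y u v) (fun y => polylog1 1 y v (- u))
    (fun N => 2 * (`|u| + `|v|) / ((1 - cos s) / 4) / N.+1%:R)) => //.
  - by near=> y; exact: der_cst.
  - by near=> y; exact: der_id.
  - by near=> y; rewrite oner_eq0 normr1.
  - exact: circle_error.
  - by rewrite [`|u| + _]addrC -[`|u|]normrN; exact: circle_error.
  - exact: harmonic_cvg0.
  - exact: cst_continuous.
  - exact: cst_continuous.
  - exact: continuous_polylog1_circle.
  - exact: continuous_polylog1_circle.
by rewrite mul0r mul0r add0r mul1r.
Unshelve. all: by end_near. Qed.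

Definition clausen x : R := polylog 2 1 x 0 1.

Lemma der_clausen x : cos x < 1 -> der clausen x (- lsin x).
Proof.
move=> x1; apply: der_eq; first exact: der_polylog_circle.
by rewrite polylog1_circle oppr0 mul0r mul1r sub0r.
Qed.

Lemma der_clausen_comp (g : R -> R) x d : cos (g x) < 1 -> der g x d ->
  der (fun y => clausen (g y)) x (- lsin (g x) * d).
Proof. by move=> c1; apply: der_comp; exact: der_clausen. Qed.

Lemma der_lsin_comp (g : R -> R) x d : cos (g x) < 1 -> der g x d ->
  der (fun y => lsin (g y)) x (sin (g x) / (2 - 2 * cos (g x)) * d).
Proof. by move=> c1; apply: der_comp; exact: der_lsin. Qed.

Lemma continuous_polylog_circle k u v : (1 < k)%N ->
  continuous (fun y => polylog k 1 y u v).
Proof.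
move=> k1 x.
apply: (@cvg_polylog R k R (nbhs x) _ (fun _ => 1) (fun y => y)) => //.
  exact: cvg_cst.
by near=> y; rewrite normr1.
Unshelve. all: by end_near. Qed.

Lemma continuous_clausen : continuous clausen.
Proof. exact: continuous_polylog_circle. Qed.

Lemma polylog_eq0 k r x u v : (forall i, trig u v (i.+1%:R * x) = 0) ->
  polylog k r x u v = 0.
Proof.
move=> h; rewrite /polylog (_ : psum _ _ _ _ _ = fun _ => 0) ?lim_cst//.
apply/funext => N; rewrite /psum big1// => i _.
by rewrite /pterm h mulr0 mul0r.
Qed.

Lemma sin_natpi n : sin (n%:R * pi) = 0 :> R.
Proof.
elim: n => [|n IH]; first by rewrite mul0r sin0.
by rewrite -natr1 mulrDl mul1r sinDpi IH oppr0.
Qed.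

Lemma clausen_natpi n : clausen (n%:R * pi) = 0.
Proof.
apply: polylog_eq0 => i.
by rewrite /trig mulrA -natrM sin_natpi mul0r mulr0 addr0.
Qed.

Lemma clausen0 : clausen 0 = 0.
Proof. by have := clausen_natpi 0; rewrite mul0r. Qed.

Lemma clausen_pi : clausen pi = 0.
Proof. by have := clausen_natpi 1; rewrite mul1r. Qed.

Lemma polylog_eq k r x y u v u' v' :
  (forall i, trig u v (i.+1%:R * x) = trig u' v' (i.+1%:R * y)) ->
  polylog k r x u v = polylog k r y u' v'.
Proof.
move=> h; rewrite /polylog (_ : psum k r x u v = psum k r y u' v')//.
by apply/funext => N; rewrite /psum; apply: eq_bigr => i _; rewrite /pterm h.
Qed.

Lemma clausenN x : clausen (- x) = - clausen x.
Proof.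
have -> : clausen (- x) = polylog 2 1 x 0 (- 1).
  by apply: polylog_eq => i; rewrite /trig !mul0r !add0r mulrN sinN mul1r mulN1r.
have n1 : `|1 : R| <= 1 by rewrite normr1.
have h1 := @polylog_cvg R 2 1 x 0 (- 1) n1 isT.
have h2 := @polylog_cvg R 2 1 x 0 1 n1 isT.
apply: (cvg_unique (@Rhausdorff R) h1).
have -> : psum 2 1 x 0 (- 1) = (fun N => - psum 2 1 x 0 1 N).
  apply/funext => N; rewrite /psum -sumrN; apply: eq_bigr => i _.
  by rewrite /pterm /trig !mul0r !add0r mul1r mulN1r mulrN mulNr.
exact: cvgN h2.
Qed.

Lemma sin_periodn n x : sin (x + n%:R * (2 * pi)) = sin x :> R.
Proof.
elim: n => [|n IH]; first by rewrite mul0r addr0.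
rewrite -natr1 mulrDl mul1r addrA.
have := @sinD2pi R (x + n%:R * (2 * pi)).
by rewrite -[pi *+ 2]mulr_natl IH.
Qed.

Lemma clausenD2pi x : clausen (x + 2 * pi) = clausen x.
Proof.
by apply: polylog_eq => i; rewrite /trig !mul0r !add0r mulrDr sin_periodn.
Qed.

(** The duplication formula. The derivatives agree because [2 - 2 cos 2z] is the product of
    [2 - 2 cos z] and [2 + 2 cos z], and both sides vanish at 0. *)
Lemma clausen_double x : 0 <= x <= pi ->
  clausen (2 * x) = 2 * clausen x - 2 * clausen (pi - x).
Proof.
move=> /andP[x0 xpi].
pose F y := clausen (2 * y) - 2 * clausen y + 2 * clausen (pi - y).
suff : F x = 0 by rewrite /F; lra.
have cF : continuous F.
  move=> y; have c (h : R -> R) : {for y, continuous h} ->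
      {for y, continuous (fun y => clausen (h y))}.
    by move=> ch; apply: continuous_comp ch _; exact: continuous_clausen.
  apply: cvgD; first apply: cvgB.
  - by apply: c; apply: cvgM; [exact: cvg_cst|exact: cvg_id].
  - by apply: cvgM; [exact: cvg_cst|exact: continuous_clausen].
  - apply: cvgM; first exact: cvg_cst.
    by apply: c; apply: cvgB; [exact: cvg_cst|exact: cvg_id].
have F0 : F 0 = 0 by rewrite /F mulr0 subr0 clausen0 clausen_pi; ring.
move: x0; rewrite le_eqVlt => /predU1P[<-//|x0].
rewrite -F0; apply/esym; apply: (@derive0_cvg_eq R F 0 x) => //; last 2 first.
- by apply: cvg_at_right_filter; exact: cF.
- by apply: cvg_at_left_filter; exact: cF.
move=> z /andP[z0 zx].
have h1 : cos (2 * z) < 1 by apply: cos_lt1; apply/andP; split; lra.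
have h2 : cos z < 1 by apply: cos_lt1; apply/andP; split; lra.
have h3 : cos (pi - z) < 1 by apply: cos_lt1; apply/andP; split; lra.
apply: der_eq.
  rewrite /F; apply: derD; first apply: derB.
  - by apply: der_clausen_comp; [exact: h1|deriv].
  - by apply: derM; [exact: der_cst|exact: der_clausen].
  - apply: derM; first exact: der_cst.
    by apply: der_clausen_comp; [exact: h3|deriv].
rewrite !mul0r !add0r /lsin.
have -> : cos (pi - z) = - cos z by rewrite cosB cospi sinpi mul0r addr0 mulN1r.
have -> : 2 - 2 * cos (2 * z) = (2 - 2 * cos z) * (2 - 2 * - cos z).
  rewrite (cos_half (2 * z)); have -> : 2 * z / 2 = z by field.
  by rewrite sin2cos2; ring.
rewrite lnM ?posrE; first by field.
  by lra.
have := cosB pi z.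
rewrite cospi sinpi mul0r addr0 => h; lra.
Qed.

End PolylogValues.

Ltac der_hook ::=
  lazymatch goal with
  | |- der (fun y => clausen (@?f y)) _ _ => eapply (@der_clausen_comp _ f); [|deriv]
  | |- der (fun y => lsin (@?f y)) _ _ => eapply (@der_lsin_comp _ f); [|deriv]
  end.

(** * The arc on which 1 - z is a unit *)

Section Chord.
Context {R : realType}.
Implicit Types (u v s x y : R) (k N : nat).

Lemma primitive_eq_from (F H f : R -> R) a b x la la' : a < x < b ->
  (forall z, a < z < b -> der F z (f z)) ->
  (forall z, a < z < b -> der H z (f z)) ->
  F y @[y --> a^'+] --> la -> H y @[y --> a^'+] --> la' ->
  F x - la = H x - la'.
Proof.
move=> /andP[ax xb] dF dH Fa Ha.
have sub z : a < z < x -> a < z < b.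
  by move=> /andP[-> zx]; rewrite (lt_trans zx).
have xab : a < x < b by rewrite ax.
apply: (@primitive_cvg_eq R F H f a x) => //.
- by move=> z /sub; exact: dF.
- by move=> z /sub; exact: dH.
- by apply: cvg_at_left_filter; exact: der_continuous (dF x xab).
- by apply: cvg_at_left_filter; exact: der_continuous (dH x xab).
Qed.

(** With [y = x^(1/4)], the bound [ln t < t] at [t = 1 / y] gives [|ln x| <= 4 / y]. The fourth root
    is taken so that even the square of the logarithm leaves a factor [y^2 = sqrt x]. *)
Lemma ler_mul_ln x : 0 < x <= 1 ->
  x * `|ln x| <= 16 * Num.sqrt x /\ x * ln x ^+ 2 <= 16 * Num.sqrt x.
Proof.
move=> /andP[x0 x1]; pose y := Num.sqrt (Num.sqrt x).
have sx0 : 0 < Num.sqrt x by rewrite sqrtr_gt0.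
have y0 : 0 < y by rewrite sqrtr_gt0.
have y2 : y ^+ 2 = Num.sqrt x by rewrite sqr_sqrtr// ltW.
have y4 : x = y ^+ 4 by rewrite (exprM y 2 2) y2 sqr_sqrtr// ltW.
have y1 : y <= 1.
  by rewrite -(@expr_le1 R 4 y isT (ltW y0)) -y4.
have lny : `|ln x| <= 4 / y.
  rewrite ler0_norm ?ln_le0// y4 lnXn// -[ln y *+ 4]mulr_natl -mulrN ler_pM2l//.
  rewrite -lnV ?posrE// (le_trans (ltW (ln_sublinear _)))// invr_gt0//.
have y3 : y ^+ 3 <= y ^+ 2 by rewrite exprSr ler_piMr// exprn_ge0// ltW.
have y20 : 0 <= y ^+ 2 by exact: sqr_ge0.
split; rewrite -y2.
  apply: (@le_trans _ _ (x * (4 / y))); first by rewrite ler_wpM2l ?(ltW x0).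
  have -> : x * (4 / y) = 4 * y ^+ 3 by rewrite y4; field; rewrite lt0r_neq0.
  lra.
apply: (@le_trans _ _ (x * (4 / y) ^+ 2)).
  rewrite ler_wpM2l ?(ltW x0)// -[ln x ^+ 2]real_normK ?num_real//.
  by rewrite ler_pXn2r// nnegrE// divr_ge0// ltW.
have -> : x * (4 / y) ^+ 2 = 16 * y ^+ 2 by rewrite y4; field; rewrite lt0r_neq0.
by [].
Qed.

(** Disposes of the boundary terms left by integration by parts: a factor of order [rho] beats both
    [ln rho] and its square. *)
Lemma cvg0_mul_ln (T : Type) (F : set_system T) (FF : Filter F)
    (rho h : T -> R) (C : R) :
  rho t @[t --> F] --> 0 -> (\forall t \near F, 0 < rho t) ->
  (\forall t \near F, `|h t| <= C * rho t) ->
  h t * ln (rho t) @[t --> F] --> 0 /\ h t * ln (rho t) ^+ 2 @[t --> F] --> 0.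
Proof.
move=> rho0 rho_gt0 hC.
have srho0 : Num.sqrt (rho t) @[t --> F] --> 0.
  rewrite -sqrtr0; apply: continuous_cvg rho0; exact: sqrt_continuous.
have bnd : C * (16 * Num.sqrt (rho t)) @[t --> F] --> 0.
  rewrite -(mulr0 C); apply: cvgM; first exact: cvg_cst.
  by rewrite -(mulr0 16); apply: cvgM => //; exact: cvg_cst.
have rho1 : \forall t \near F, rho t <= 1 by apply: (cvgr_le _ rho0).
have key (g : T -> R) :
    (\forall t \near F, rho t * `|g t| <= 16 * Num.sqrt (rho t)) ->
    h t * g t @[t --> F] --> 0.
  move=> Hg; apply/norm_cvg0P; apply: (squeeze_cvgr _ (cvg_cst 0) bnd).
  near=> t; rewrite normr_ge0 normrM /=.
  have ht : `|h t| <= C * rho t by near: t.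
  have rt : 0 < rho t by near: t.
  have C0 : 0 <= C by rewrite -(pmulr_lge0 C rt) (le_trans _ ht).
  apply: (@le_trans _ _ (C * rho t * `|g t|)); first by rewrite ler_wpM2r.
  by rewrite -mulrA ler_wpM2l//; near: t.
split; apply: key; near=> t.
  by have [|//] := @ler_mul_ln (rho t); apply/andP; split; near: t.
rewrite ger0_norm ?sqr_ge0//.
by have [|//] := @ler_mul_ln (rho t); apply/andP; split; near: t.
Unshelve. all: by end_near. Qed.

(** The triple-angle formula and [cos pi = -1] give [(c + 1) (2 c - 1)^2 = 0], and [c > 0] excludes
    the first root. *)
Lemma cos_pi3 : cos (pi / 3) = 1 / 2 :> R.
Proof.
set c := cos (pi / 3).
have c0 : 0 < c.
  by apply: cos_gt0_pihalf; have := @pi_gt0 R => h; apply/andP; split; lra.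
have E : pi = pi / 3 + (pi / 3 + pi / 3) :> R by field.
have : cos pi = 4 * c ^+ 3 - 3 * c.
  rewrite {1}E cosD cosD sinD -/c.
  have -> : c * (c * c - sin (pi / 3) * sin (pi / 3)) -
    sin (pi / 3) * (sin (pi / 3) * c + c * sin (pi / 3)) =
    c ^+ 3 - 3 * c * sin (pi / 3) ^+ 2 by ring.
  by rewrite sin2cos2 -/c; ring.
rewrite cospi => H.
have /eqP : (c + 1) * (2 * c - 1) ^+ 2 = 0.
  have -> : (c + 1) * (2 * c - 1) ^+ 2 = 4 * c ^+ 3 - 3 * c + 1 by ring.
  by rewrite -H addNr.
rewrite mulf_eq0 sqrf_eq0 => /orP[/eqP h|/eqP h]; lra.
Qed.

Lemma sin_pi6 : sin (pi / 6) = 1 / 2 :> R.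
Proof.
have s0 : 0 < sin (pi / 6) :> R.
  by apply: sin_gt0_pi; have := @pi_gt0 R => h; apply/andP; split; lra.
have := cos_half (pi / 3 : R); rewrite cos_pi3.
have -> : pi / 3 / 2 = pi / 6 :> R by field.
by move=> h; nra.
Qed.

(** Together with [chord_angle], the polar coordinates of [1 - e^(-i x)]. The modulus reaches 1 at
    [x = pi / 3], hence the range []0, pi / 3[] from here on. *)
Definition chord x : R := 2 * sin (x / 2).
Definition chord_angle x : R := (pi - x) / 2.

Lemma lsinE x : 0 < x < 2 * pi -> lsin x = ln (chord x).
Proof.
move=> x0; rewrite /lsin /chord.
have s0 : 0 < sin (x / 2) by apply: sin_gt0_pi; apply/andP; split; lra.
have -> : 2 - 2 * cos x = (2 * sin (x / 2)) ^+ 2 by rewrite cos_half; ring.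
by rewrite lnXn ?mulr_gt0// -[ln _ *+ 2]mulr_natr mulfK.
Qed.

Lemma chord_bounds x : 0 < x < pi / 3 -> 0 < sin (x / 2) < 1 / 2.
Proof.
move=> /andP[x0 x3]; have h := @pi_gt0 R.
rewrite sin_gt0_pi; last by apply/andP; split; lra.
rewrite -sin_pi6 ltr_sin ?in_itv/=; first by lra.
  by apply/andP; split; lra.
by apply/andP; split; lra.
Qed.

Lemma cos_chord_angle x : cos (chord_angle x) = sin (x / 2).
Proof.
rewrite /chord_angle (_ : (pi - x) / 2 = pi / 2 - x / 2); last by field.
by rewrite cosB cos_pihalf sin_pihalf mul0r add0r mul1r.
Qed.

Lemma sin_chord_angle x : sin (chord_angle x) = cos (x / 2).
Proof.
rewrite /chord_angle (_ : (pi - x) / 2 = pi / 2 - x / 2); last by field.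
by rewrite sinB cos_pihalf sin_pihalf mul0r subr0 mul1r.
Qed.

(* [1 - chord x * e^(i chord_angle x) = e^(-i x)]: the point runs along the unit
   circle centred at 1, where log(1 - z) is simply [-i x]. *)
Lemma chord_error x u v N : 0 < x < pi / 3 ->
  `|psum 1 (chord x) (chord_angle x) u v N - v * x| <=
    2 * (`|u| + `|v|) / (1 / 4) / N.+1%:R.
Proof.
move=> x0; have /andP[s0 s1] := chord_bounds x0.
have -> : v * x = polylog1 (chord x) (chord_angle x) u v.
  rewrite /polylog1 /cdist2 cos_chord_angle sin_chord_angle /chord.
  have -> : 1 - 2 * (2 * sin (x / 2)) * sin (x / 2) + (2 * sin (x / 2)) ^+ 2 = 1.
    by ring.
  rewrite ln1 mulr0 subr0 -sin_half.
  have -> : 1 - 2 * sin (x / 2) * sin (x / 2) = cos x by rewrite (cos_half x); ring.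
  rewrite -/(tan x) tanK// in_itv/=; have h := @pi_gt0 R.
  by move: x0 => /andP[x0 x3]; apply/andP; split; lra.
apply: psum1_error; rewrite /chord ?cos_chord_angle.
- by apply/andP; split; lra.
- by nra.
- lra.
- move=> t /andP[t0 _]; apply: le_trans (cdist2_ge _ t0).
  by rewrite cos_chord_angle; lra.
Qed.

Lemma near_itv a b x : a < x < b -> \forall y \near x, a < y < b.
Proof.
move=> /andP[ax xb]; near=> y; apply/andP; split; near: y.
  exact: lt_nbhsr.
exact: lt_nbhsl.
Unshelve. all: by end_near. Qed.

(** Logarithmic derivative of [chord], that is, the derivative of [lsin]. *)
Definition cot_half x : R := cos (x / 2) / (2 * sin (x / 2)).

Let dchord y : der chord y (cos (y / 2)).
Proof. by apply: der_eq; [rewrite /chord; deriv|field]. Qed.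

Let dangle y : der chord_angle y (- (1 / 2)).
Proof. by apply: der_eq; [rewrite /chord_angle; deriv|field]. Qed.

Let chord_ok s : 0 < s < pi / 3 ->
  \forall y \near s, chord y != 0 /\ `|chord y| <= 1.
Proof.
move=> s3; apply: filterS (near_itv s3) => y /chord_bounds/andP[h1 h2].
by rewrite /chord gtr0_norm; [split; [apply/lt0r_neq0|]|]; lra.
Qed.

Let cos2_continuous s : {for s, continuous (fun y => cos (y / 2))}.
Proof. by eapply der_continuous; deriv. Qed.

(** On the arc [Li1(z) = i s] and [d log z = (cot_half s - i / 2) ds]. *)
Lemma der_chord2 s u v : 0 < s < pi / 3 ->
  der (fun y => polylog 2 (chord y) (chord_angle y) u v) s
    (v * (cot_half s * s) + u * (s / 2)).
Proof.
move=> s3; have /andP[h1 h2] := chord_bounds s3.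
apply: der_eq.
  apply: (@der_polylog R 1 chord chord_angle (fun y => cos (y / 2))
    (fun _ => - (1 / 2)) (fun y => v * y) (fun y => - u * y)
    (fun N => 2 * (`|u| + `|v|) / (1 / 4) / N.+1%:R)) => //.
  - by near=> y; exact: dchord.
  - by near=> y; exact: dangle.
  - exact: chord_ok.
  - by apply: filterS (near_itv s3) => y y3 N; exact: chord_error.
  - rewrite [`|u| + _]addrC -[`|u|]normrN.
    by apply: filterS (near_itv s3) => y y3 N; exact: chord_error.
  - exact: harmonic_cvg0.
  - exact: cst_continuous.
  - by eapply der_continuous; deriv.
  - by eapply der_continuous; deriv.
by rewrite /= /cot_half /chord; field; apply: lt0r_neq0.
Unshelve. all: by end_near. Qed.

Lemma der_chord3 s u v : 0 < s < pi / 3 ->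
  der (fun y => polylog 3 (chord y) (chord_angle y) u v) s
    (cot_half s * polylog 2 (chord s) (chord_angle s) u v -
     polylog 2 (chord s) (chord_angle s) v (- u) / 2).
Proof.
move=> s3; have /andP[h1 h2] := chord_bounds s3.
apply: der_eq.
  apply: (@der_polylog_ge2 R 2 chord chord_angle (fun y => cos (y / 2))
    (fun _ => - (1 / 2))) => //.
  - by near=> y; exact: dchord.
  - by near=> y; exact: dangle.
  - exact: chord_ok.
  - exact: cst_continuous.
by rewrite /= /cot_half /chord; field; apply: lt0r_neq0.
Unshelve. all: by end_near. Qed.

End Chord.

(** * Dilogarithm and trilogarithm on the arc, and their values at its end *)

Section ChordValues.
Context {R : realType}.
Implicit Types (a b u v s x y : R) (k N : nat).

Local Notation pi := (@pi R).

Let pi0 : 0 < pi. Proof. exact: pi_gt0. Qed.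

Lemma near_right_itv a b : a < b -> \forall y \near a^'+, a < y < b.
Proof.
move=> ab; near=> y; apply/andP; split; near: y.
  exact: nbhs_right_gt.
exact: nbhs_right_lt.
Unshelve. all: by end_near. Qed.

Lemma near_left_itv a b : a < b -> \forall y \near b^'-, a < y < b.
Proof.
move=> ab; near=> y; apply/andP; split; near: y.
  exact: nbhs_left_gt.
exact: nbhs_left_lt.
Unshelve. all: by end_near. Qed.

Lemma chord_cvg0 : @chord R y @[y --> (0 : R)^'+] --> (0 : R).
Proof.
have : @chord R y @[y --> (0 : R)^'+] --> chord (0 : R).
  apply: cvg_at_right_filter.
  have : exists d, der chord (0 : R) d by eexists; rewrite /chord; deriv.
  by move=> [d /der_continuous].
by rewrite {2}/chord mul0r sin0 mulr0.
Qed.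

(** [chord] has derivative [cos (z / 2)], at least [1 / 2] on the range, so the variable itself is
    of order [chord] and may serve as the factor that kills [lsin] at 0. *)
Lemma near_chord : \forall y \near (0 : R)^'+, [/\ 0 < y, y <= 2 * chord y, 0 < chord y & `|chord y| <= 1].
Proof.
have h : (0 : R) < pi / 3 by rewrite divr_gt0.
apply: filterS (near_right_itv h) => y /andP[y0 y3].
have /andP[s0 s1] : 0 < sin (y / 2) < 1 / 2 by apply: chord_bounds; rewrite y0.
have c0 : 0 < chord y by rewrite /chord mulr_gt0.
split => //; last by rewrite gtr0_norm// /chord; lra.
have d (z : R) : -1 < z < pi -> der chord z (cos (z / 2)).
  by move=> _; apply: der_eq; [rewrite /chord; deriv|field].
have ypi : y < pi by lra.
have [z /andP[z0 zy]] := derive_itv_MVT d (ltrN10 R) (ltW y0) ypi.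
rewrite /chord !mul0r sin0 mulr0 !subr0 => ->; rewrite mulrA ler_peMl ?(ltW y0)//.
have : cos (pi / 3) <= cos (z / 2).
  by rewrite leNgt ltr_cos ?in_itv/= -?leNgt; [|apply/andP; split|apply/andP; split]; lra.
by rewrite cos_pi3; lra.
Qed.

Lemma polylog_chord_cvg0 k u v : (1 < k)%N ->
  polylog k (chord y) (chord_angle y) u v @[y --> (0 : R)^'+] --> (0 : R).
Proof.
move=> k1; apply/norm_cvg0P.
have bnd : 2 * (`|u| + `|v|) * chord y @[y --> (0 : R)^'+] --> (0 : R).
  rewrite -[X in _ --> X](mulr0 (2 * (`|u| + `|v|))); apply: cvgM; first exact: cvg_cst.
  exact: chord_cvg0.
apply: (squeeze_cvgr _ (cvg_cst 0) bnd); near=> y; rewrite normr_ge0 /=.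
have [y0 _ c0 c1] : [/\ 0 < y, y <= 2 * chord y, 0 < chord y & `|chord y| <= 1].
  by near: y; exact: near_chord.
by rewrite -[X in _ <= _ * X](gtr0_norm c0); apply: polylog_norm_le.
Unshelve. all: by end_near. Qed.

Lemma sin_half_neq0 x : 0 < x < 2 * pi -> sin (x / 2) != 0.
Proof.
by move=> /andP[x0 x2]; rewrite gt_eqF// sin_gt0_pi//; apply/andP; split; lra.
Qed.

Lemma der_lsin_itv x : 0 < x < 2 * pi -> der lsin x (cot_half x).
Proof.
move=> x0; have s0 := sin_half_neq0 x0.
apply: der_eq; first exact: der_lsin (cos_lt1 x0).
rewrite /cot_half (sin_half x) (cos_half x).
have -> : 2 - 2 * (1 - 2 * sin (x / 2) ^+ 2) = 4 * sin (x / 2) ^+ 2 by ring.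
by field.
Qed.

Lemma der_clausen_itv x : 0 < x < 2 * pi -> der clausen x (- lsin x).
Proof. by move=> /cos_lt1; exact: der_clausen. Qed.

Lemma lsin_mul_cvg0 (h : R -> R) C : (\forall y \near (0 : R)^'+, `|h y| <= C * chord y) ->
  h y * lsin y @[y --> (0 : R)^'+] --> 0 /\ h y * lsin y ^+ 2 @[y --> (0 : R)^'+] --> 0.
Proof.
move=> hC.
have near0 : \forall y \near (0 : R)^'+, 0 < chord y.
  by apply: filterS near_chord => y [].
have [h1 h2] := cvg0_mul_ln _ chord_cvg0 near0 hC.
have E : \forall y \near (0 : R)^'+, ln (chord y) = lsin y.
  have pi2 : (0 : R) < 2 * pi by rewrite mulr_gt0.
  by apply: filterS (near_right_itv pi2) => y /lsinE.
split.
  apply: cvg_trans h1; apply: near_eq_cvg.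
  by apply: filterS E => y ->.
apply: cvg_trans h2; apply: near_eq_cvg.
by apply: filterS E => y ->.
Qed.

Let pi3_2pi x : 0 < x < pi / 3 -> 0 < x < 2 * pi.
Proof. by move=> /andP[x0 x3]; apply/andP; split; lra. Qed.

(** The real part of [i x (cot_half x - i / 2)] is just [x / 2], free of logarithms; it supplies the
    polynomial term in the derivative of [trilog_chord]. *)
Lemma dilog_chord_re x : 0 < x < pi / 3 ->
  polylog 2 (chord x) (chord_angle x) 1 0 = x ^+ 2 / 4.
Proof.
move=> x3.
have := @primitive_eq_from R
  (fun y => polylog 2 (chord y) (chord_angle y) 1 0) (fun y => y ^+ 2 / 4)
  (fun y => y / 2) 0 (pi / 3) x 0 0 x3.
rewrite !subr0; apply => [z z3|z z3||].
- by apply: der_eq; [exact: der_chord2|ring].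
- by apply: der_eq; [deriv|field].
- exact: polylog_chord_cvg0.
- have {2}-> : (0 : R) = 0 ^+ 2 / 4 by rewrite expr0n mul0r.
  apply: cvg_at_right_filter.
  suff : {for 0, continuous (fun y : R => y ^+ 2 / 4)} by [].
  by eapply der_continuous; deriv.
Qed.

Definition dilog_chord x : R := polylog 2 (chord x) (chord_angle x) 0 1.

Lemma der_dilog_chord x : 0 < x < pi / 3 -> der dilog_chord x (cot_half x * x).
Proof. by move=> x3; apply: der_eq; [exact: der_chord2|ring]. Qed.

Lemma dilog_chord_le x : 0 < chord x -> `|chord x| <= 1 ->
  `|dilog_chord x| <= 2 * chord x.
Proof.
move=> c0 c1; have := polylog_norm_le (chord_angle x) 0 1 c1 (isT : (1 < 2)%N).
by rewrite normr0 add0r normr1 mulr1 (gtr0_norm c0).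
Qed.

(** Integration by parts of [cot_half x * x], where [cot_half] is the derivative of [lsin] and
    [- lsin] that of [clausen]. *)
Lemma dilog_chordE x : 0 < x < pi / 3 -> dilog_chord x = x * lsin x + clausen x.
Proof.
move=> x3.
have := @primitive_eq_from R dilog_chord (fun y => y * lsin y + clausen y)
  (fun y => cot_half y * y) 0 (pi / 3) x 0 0 x3.
rewrite !subr0; apply => [z z3|z z3||].
- exact: der_dilog_chord.
- have dl := der_lsin_itv (pi3_2pi z3).
  have dc := der_clausen_itv (pi3_2pi z3).
  by apply: der_eq; [deriv|ring].
- exact: polylog_chord_cvg0.
- rewrite -[X in _ --> X]addr0; apply: cvgD.
    have [|//] := @lsin_mul_cvg0 (fun y => y) 2.
    by apply: filterS near_chord => y [y0 yc _ _]; rewrite gtr0_norm.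
  by rewrite -[X in _ --> X](@clausen0 R); apply: cvg_at_right_filter; exact: continuous_clausen.
Qed.

Definition trilog_chord x : R := polylog 3 (chord x) (chord_angle x) 0 1.

Lemma der_trilog_chord x : 0 < x < pi / 3 ->
  der trilog_chord x (cot_half x * dilog_chord x - x ^+ 2 / 8).
Proof.
move=> x3; apply: der_eq; first exact: der_chord3.
by rewrite oppr0 dilog_chord_re// /dilog_chord; field.
Qed.

(** Two integrations by parts of [cot_half * dilog_chord]: the products [cot_half * dilog_chord] and
    [x * lsin * cot_half] cancel, and [x^3 / 24] removes the [- x^2 / 8] of [der_trilog_chord]. *)
Definition lsin_sqr_primitive x : R :=
  2 * (trilog_chord x - lsin x * dilog_chord x + x * lsin x ^+ 2 / 2 + x ^+ 3 / 24).

Lemma der_lsin_sqr_primitive x : 0 < x < pi / 3 ->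
  der lsin_sqr_primitive x (lsin x ^+ 2).
Proof.
move=> x3.
have dl := der_lsin_itv (pi3_2pi x3).
have d2 := der_dilog_chord x3.
have d3 := der_trilog_chord x3.
have dl2 : der (fun y => lsin y ^+ 2) x (2 * lsin x * cot_half x).
  by apply: der_eq; [deriv|rewrite expr1].
rewrite /lsin_sqr_primitive; apply: der_eq.
  by deriv.
by field.
Qed.

Lemma lsin_sqr_primitive_cvg0 : lsin_sqr_primitive y @[y --> (0 : R)^'+] --> 0.
Proof.
have e : 0 = 2 * (0 - 0 + 0 + 0 ^+ 3 / 24) :> R by field.
rewrite /lsin_sqr_primitive [X in _ --> X]e.
apply: cvgM; first exact: cvg_cst.
apply: cvgD; first apply: cvgD; first apply: cvgB.
- exact: polylog_chord_cvg0.
- have [|h _] := @lsin_mul_cvg0 dilog_chord 2.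
    by apply: filterS near_chord => y [_ _ c0 c1]; exact: dilog_chord_le.
  by apply: cvg_trans h; apply: near_eq_cvg; near=> y; rewrite mulrC.
- rewrite -[X in _ --> X](mul0r (2^-1)); apply: cvgM; last exact: cvg_cst.
  have [|//] := @lsin_mul_cvg0 (fun y => y) 2.
  by apply: filterS near_chord => y [y0 yc _ _]; rewrite gtr0_norm.
- apply: cvg_at_right_filter.
  suff : {for 0, continuous (fun y : R => y ^+ 3 / 24)} by [].
  by eapply der_continuous; deriv.
Unshelve. all: by end_near. Qed.

Lemma polylog2_circle x : 0 < x < 2 * pi ->
  polylog 2 1 x 1 0 = polylog 2 1 pi 1 0 + (pi - x) ^+ 2 / 4.
Proof.
move=> x2.
suff : polylog 2 1 x 1 0 - (pi - x) ^+ 2 / 4 = polylog 2 1 pi 1 0 - (pi - pi) ^+ 2 / 4.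
  by rewrite subrr expr0n mul0r subr0 => <-; rewrite subrK.
apply: (@derive0_itv_cst R (fun x => polylog 2 1 x 1 0 - (pi - x) ^+ 2 / 4)
  0 (2 * pi)) => //; last by apply/andP; split; lra.
move=> z z2; apply: der_eq.
  by apply: derB; [apply: der_polylog_circle (cos_lt1 z2)|deriv].
by rewrite polylog1_circle arg_circle//; field.
Qed.

Lemma der_polylog3_circle x :
  der (fun y => polylog 3 1 y 0 1) x (polylog 2 1 x 1 0).
Proof.
apply: der_eq.
  apply: (@der_polylog_ge2 R 2 (fun _ => 1) (fun y => y) (fun _ => 0) (fun _ => 1)) => //.
  - by near=> y; exact: der_cst.
  - by near=> y; exact: der_id.
  - by near=> y; rewrite oner_eq0 normr1.
  - exact: cst_continuous.
  - exact: cst_continuous.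
by rewrite oppr0 !mul0r add0r mul1r.
Unshelve. all: by end_near. Qed.

(* Since polylog 3 1 . 0 1 vanishes at both [0] and [pi], the constant of
   integration (which amounts to zeta(2)) need not be known beforehand. *)
Lemma polylog3_circle x : 0 < x < pi ->
  polylog 3 1 x 0 1 = pi ^+ 3 / 12 - (pi - x) ^+ 3 / 12 - pi ^+ 2 / 12 * x.
Proof.
move=> /andP[x0 xpi]; set c := polylog 2 1 pi 1 0.
pose F y : R := polylog 3 1 y 0 1.
pose H y : R := c * y - (pi - y) ^+ 3 / 12.
have cF : continuous F by exact: continuous_polylog_circle.
have cH : continuous H.
  move=> y; suff [d /der_continuous//] : exists d, der H y d.
  by eexists; rewrite /H; deriv.
have dF z : 0 < z < pi -> der F z (c + (pi - z) ^+ 2 / 4).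
  move=> /andP[z0 zpi]; apply: der_eq; first exact: der_polylog3_circle.
  by rewrite polylog2_circle//; apply/andP; split; lra.
have dH z : 0 < z < pi -> der H z (c + (pi - z) ^+ 2 / 4).
  by move=> _; rewrite /H; apply: der_eq; [deriv|field].
have key y : 0 < y <= pi -> F y - F 0 = H y - H 0.
  move=> /andP[y0 ypi].
  apply: (@primitive_cvg_eq R F H (fun z => c + (pi - z) ^+ 2 / 4) 0 y) => //.
  - by move=> z /andP[z0 zy]; apply: dF; rewrite z0 (lt_le_trans zy).
  - by move=> z /andP[z0 zy]; apply: dH; rewrite z0 (lt_le_trans zy).
  - by apply: cvg_at_right_filter; exact: cF.
  - by apply: cvg_at_left_filter; exact: cF.
  - by apply: cvg_at_right_filter; exact: cH.
  - by apply: cvg_at_left_filter; exact: cH.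
have F0 : F 0 = 0.
  by apply: polylog_eq0 => i; rewrite /trig mulr0 sin0 mul0r mulr0 addr0.
have Fpi : F pi = 0.
  by apply: polylog_eq0 => i; rewrite /trig sin_natpi mul0r mulr0 addr0.
have := key pi; rewrite pi0 lexx F0 Fpi => /(_ isT) Hc.
have := key x; rewrite x0 (ltW xpi) F0 subr0 => /(_ isT) Ex.
rewrite -/(F x) Ex.
have cpi : c * pi = - (pi ^+ 2 / 12) * pi.
  move: Hc; rewrite /H !subrr subr0 mulr0 expr0n /= mul0r subr0 sub0r opprK => Hc.
  by rewrite mulNr -mulrAC -exprSr; lra.
have cE : c = - (pi ^+ 2 / 12) by apply: (mulIf _ cpi); rewrite gt_eqF.
by rewrite /H cE; field.
Qed.

Lemma polylog3_pi3 : polylog 3 1 (pi / 3) 0 1 = 5 * pi ^+ 3 / 162 :> R.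
Proof. by have h := pi0; rewrite polylog3_circle; [field|apply/andP; split; lra]. Qed.

Lemma polylog3_pi2 : polylog 3 1 (pi / 2) 0 1 = pi ^+ 3 / 32 :> R.
Proof. by have h := pi0; rewrite polylog3_circle; [field|apply/andP; split; lra]. Qed.

Lemma lsin_pi3 : lsin (pi / 3) = 0.
Proof.
rewrite /lsin cos_pi3 (_ : 2 - 2 * (1 / 2) = 1); last by field.
by rewrite ln1 mul0r.
Qed.

(** The arc meets the unit circle at [e^(i pi / 3)], so its end values are those found on the
    circle. *)
Lemma polylog_chord_pi3 k u v : (1 < k)%N ->
  polylog k (chord y) (chord_angle y) u v @[y --> (pi / 3)^'-] -->
    polylog k 1 (pi / 3) u v.
Proof.
move=> k1; apply: cvg_polylog => //.
- have E : chord (pi / 3) = 1.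
    rewrite /chord (_ : pi / 3 / 2 = pi / 6); last by field.
    by rewrite sin_pi6; field.
  rewrite -[X in _ --> X]E; apply: cvg_at_left_filter.
  suff [d /der_continuous//] : exists d, der chord (pi / 3) d.
  by eexists; rewrite /chord; deriv.
- have E : chord_angle (pi / 3) = pi / 3 by rewrite /chord_angle; field.
  rewrite -[X in _ --> X]E; apply: cvg_at_left_filter.
  suff [d /der_continuous//] : exists d, der chord_angle (pi / 3) d.
  by eexists; rewrite /chord_angle; deriv.
- have h : 0 < pi / 3 by rewrite divr_gt0.
  apply: filterS (near_left_itv h) => y /chord_bounds/andP[s0 s1].
  by rewrite /chord gtr0_norm; lra.
Qed.

Lemma lsin_sqr_primitive_pi3 :
  lsin_sqr_primitive y @[y --> (pi / 3)^'-] --> 7 * pi ^+ 3 / 108.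
Proof.
(* The logarithm vanishes at [pi / 3], so only the trilogarithm and the cubic remain:
   [2 (5 / 162 + 1 / 648) = 7 / 108]. *)
have e : 7 * pi ^+ 3 / 108 =
  2 * (5 * pi ^+ 3 / 162 - 0 * clausen (pi / 3) + pi / 3 * 0 ^+ 2 / 2 +
    (pi / 3) ^+ 3 / 24) by field.
have cl : lsin y @[y --> (pi / 3)^'-] --> 0.
  rewrite -lsin_pi3; apply: cvg_at_left_filter.
  apply: der_continuous (der_lsin_itv _).
  by have h := pi0; apply/andP; split; lra.
have ci : y @[y --> (pi / 3)^'-] --> pi / 3 by apply: cvg_at_left_filter; exact: cvg_id.
rewrite /lsin_sqr_primitive [X in _ --> X]e.
apply: cvgM; first exact: cvg_cst.
apply: cvgD; first apply: cvgD; first apply: cvgB.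
- by rewrite -polylog3_pi3; exact: polylog_chord_pi3.
- by apply: cvgM => //; exact: polylog_chord_pi3.
- apply: cvgM; last exact: cvg_cst.
  apply: cvgM => //.
  exact: (continuous_cvg _ (@exprn_continuous R 2 0) cl).
- apply: cvgM; last exact: cvg_cst.
  exact: (continuous_cvg _ (@exprn_continuous R 3 (pi / 3)) ci).
Qed.

End ChordValues.

(** * The log-sine integral *)

Section LogSineIntegral.
Context {R : realType}.
Implicit Types (a b la lb x y : R).

Local Notation pi := (@pi R).
Local Notation mu := (@lebesgue_measure R).

Lemma lsinE_abs x : ln `|2 * sin (x / 2)| = lsin x.
Proof.
rewrite /lsin; have -> : 2 - 2 * cos x = `|2 * sin (x / 2)| ^+ 2.
  by rewrite real_normK ?num_real// cos_half; ring.
have := normr_ge0 (2 * sin (x / 2)); rewrite le_eqVlt => /predU1P[<-|s0].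
  by rewrite expr0n /= ln0// mul0r.
by rewrite lnXn// -[ln _ *+ 2]mulr_natr mulfK.
Qed.

Lemma measurable_lsin : measurable_fun [set: R] (@lsin R).
Proof.
rewrite /lsin; apply: measurable_funM => //.
apply: (measurableT_comp (@measurable_ln R)).
apply: continuous_measurable_fun => x.
by eapply der_continuous; deriv.
Qed.

Lemma continuous_lsin x : cos x < 1 -> {for x, continuous (@lsin R)}.
Proof. by move=> /der_lsin/der_continuous. Qed.

Lemma continuous_lsin_sqr x : cos x < 1 -> {for x, continuous (fun y => lsin y ^+ 2)}.
Proof. by move=> /der_lsin dl; eapply der_continuous; deriv. Qed.

Lemma lsin_reflect x : lsin (2 * pi - x) = lsin x.
Proof.
rewrite /lsin (_ : cos (2 * pi - x) = cos x)//.
by rewrite cosB mulr_natl cos2pi sin2pi mul1r mul0r addr0.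
Qed.

Lemma cvg_to_right (T : Type) (F : set_system T) (FF : Filter F) (g : T -> R) a :
  g t @[t --> F] --> a -> (\forall t \near F, a < g t) -> g t @[t --> F] --> a^'+.
Proof.
move=> ga gt_a P; rewrite /at_right /within /= => /ga aP.
by apply: filterS2 gt_a aP => t h1 h2; exact: h2.
Qed.

Lemma cvg_to_left (T : Type) (F : set_system T) (FF : Filter F) (g : T -> R) a :
  g t @[t --> F] --> a -> (\forall t \near F, g t < a) -> g t @[t --> F] --> a^'-.
Proof.
move=> ga gt_a P; rewrite /at_left /within /= => /ga aP.
by apply: filterS2 gt_a aP => t h1 h2; exact: h2.
Qed.

Lemma reflect_at_right (d : R) a : d - x @[x --> a^'+] --> (d - a)^'-.
Proof.
apply: cvg_to_left.
  by apply: cvg_at_right_filter; apply: cvgB; [exact: cvg_cst|exact: cvg_id].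
by near=> x; rewrite ltrD2l ltrN2; near: x; exact: nbhs_right_gt.
Unshelve. all: by end_near. Qed.

Lemma reflect_at_left (d : R) a : d - x @[x --> a^'-] --> (d - a)^'+.
Proof.
apply: cvg_to_right.
  by apply: cvg_at_left_filter; apply: cvgB; [exact: cvg_cst|exact: cvg_id].
by near=> x; rewrite ltrD2l ltrN2; near: x; exact: nbhs_left_lt.
Unshelve. all: by end_near. Qed.

Lemma cvg_reflect_right (f : R -> R) (d : R) a (l : R) :
  f x @[x --> (d - a)^'-] --> l -> f (d - x) @[x --> a^'+] --> l.
Proof. by move=> h P Pl; exact: (@reflect_at_right d a _ (h P Pl)). Qed.

Lemma cvg_reflect_left (f : R -> R) (d : R) a (l : R) :
  f x @[x --> (d - a)^'+] --> l -> f (d - x) @[x --> a^'-] --> l.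
Proof. by move=> h P Pl; exact: (@reflect_at_left d a _ (h P Pl)). Qed.

Lemma ge0_integrable_setU (f : R -> R) (A B : set R) :
  measurable A -> measurable B -> measurable_fun [set: R] f -> (forall x, 0 <= f x) ->
  mu.-integrable A (EFin \o f) -> mu.-integrable B (EFin \o f) ->
  mu.-integrable (A `|` B) (EFin \o f).
Proof.
move=> mA mB mf f0 /integrableP[_ iA] /integrableP[_ iB].
have mF D : measurable_fun D (EFin \o f).
  by apply/measurable_EFinP; exact: measurable_funTS.
apply/integrableP; split; first exact: mF.
have mBA : measurable (B `\` A) by exact: measurableD.
have mN D : measurable_fun D (fun x => `|(EFin \o f) x|)%E by exact: measurableT_comp.
have -> : A `|` B = A `|` (B `\` A).
  apply/seteqP; split => x /=; last by case=> [|[]]; [left|right].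
  by case=> [|Bx]; [left|have [|] := pselect (A x); [left|right]].
have AB : [disjoint A & B `\` A] by apply/disj_setPS => x [/= Ax [_]].
rewrite (ge0_integral_setU mu mA mBA (mN _) (fun x _ => abse_ge0 _) AB).
apply: lte_add_pinfty; first exact: iA.
apply: le_lt_trans iB.
apply: (ge0_subset_integral mu mBA mB (mN B)) => x.
  by move=> _; exact: abse_ge0.
by case.
Qed.

Lemma ge0_FTC_integrable (f F : R -> R) a b la lb : a < b ->
  measurable_fun [set: R] f -> (forall x, 0 <= f x) ->
  (forall x, a < x < b -> {for x, continuous f}) ->
  (forall x, a < x < b -> der F x (f x)) ->
  F x @[x --> a^'+] --> la -> F x @[x --> b^'-] --> lb ->
  mu.-integrable `[a, b] (EFin \o f).
Proof.
move=> ab mf f0 cf dF Fa Fb.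
have mF D : measurable_fun D (EFin \o f).
  by apply/measurable_EFinP; exact: measurable_funTS.
apply/integrableP; split; first exact: mF.
under eq_integral do rewrite gee0_abs ?lee_fin//.
rewrite integral_itv_bndoo//.
by rewrite (ge0_FTC ab _ cf dF Fa Fb)// ltry.
Qed.

Let pi0 : 0 < pi. Proof. exact: pi_gt0. Qed.

Let lsin2 x : R := lsin x ^+ 2.

Let mlsin2 : measurable_fun [set: R] lsin2.
Proof. by apply: measurable_funX; exact: measurable_lsin. Qed.

Let lsin2_ge0 x : 0 <= lsin2 x. Proof. exact: sqr_ge0. Qed.

Let lsin2_continuous x : 0 < x < 2 * pi -> {for x, continuous lsin2}.
Proof. by move=> /cos_lt1; exact: continuous_lsin_sqr. Qed.

(** The singular ends are handled by the explicit primitive on [[0, pi / 3]] and by its mirror image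
    on [[5 pi / 3, 2 pi]]; continuity on a segment settles the middle. Integrability up to [2 pi]
    lets [logsine3] be differentiated on the whole open turn. *)
Lemma integrable_lsin_sqr :
  mu.-integrable `[0, 2 * pi] (EFin \o (fun x => lsin x ^+ 2)).
Proof.
have p0 := pi0.
have I1 : mu.-integrable `[0, pi / 3] (EFin \o lsin2).
  apply: (@ge0_FTC_integrable _ (@lsin_sqr_primitive R) 0 (pi / 3)) => //.
  - by rewrite divr_gt0.
  - by move=> x /andP[x0 x3]; apply: lsin2_continuous; apply/andP; split; lra.
  - by move=> x x3; exact: der_lsin_sqr_primitive.
  - exact: lsin_sqr_primitive_cvg0.
  - exact: lsin_sqr_primitive_pi3.
have I3 : mu.-integrable `[5 * pi / 3, 2 * pi] (EFin \o lsin2).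
  apply: (@ge0_FTC_integrable _ (fun x => - lsin_sqr_primitive (2 * pi - x))
    (5 * pi / 3) (2 * pi) (- (7 * pi ^+ 3 / 108)) (- 0)) => //.
  - lra.
  - by move=> x /andP[x0 x3]; apply: lsin2_continuous; apply/andP; split; lra.
  - move=> x /andP[x0 x3].
    have x3' : 0 < 2 * pi - x < pi / 3 by apply/andP; split; lra.
    have d := der_lsin_sqr_primitive x3'.
    have dr : der (fun y => 2 * pi - y) x (- 1) by apply: der_eq; [deriv|ring].
    apply: der_eq; first by apply: derN; apply: (@der_comp _ _ (fun y => 2 * pi - y)) d dr.
    by rewrite lsin_reflect /lsin2; ring.
  - apply: cvgN; apply: cvg_reflect_right.
    rewrite (_ : 2 * pi - 5 * pi / 3 = pi / 3); last by field.
    exact: lsin_sqr_primitive_pi3.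
  - apply: cvgN; apply: cvg_reflect_left.
    by rewrite subrr; exact: lsin_sqr_primitive_cvg0.
have I2 : mu.-integrable `[pi / 3, 5 * pi / 3] (EFin \o lsin2).
  apply: continuous_compact_integrable; first exact: segment_compact.
  apply: continuous_in_subspaceT => x /set_mem; rewrite /= in_itv/= => /andP[x0 x3].
  by apply: lsin2_continuous; apply/andP; split; lra.
have -> : `[0, 2 * pi]%classic =
    (`[0, pi / 3] `|` `[pi / 3, 5 * pi / 3]) `|` `[5 * pi / 3, 2 * pi].
  apply/seteqP; split => x /=; rewrite !in_itv/=.
    move=> /andP[x0 x2].
    have [x3|x3] := leP x (pi / 3); first by left; left; rewrite x0.
    have [x5|x5] := leP x (5 * pi / 3); first by left; right; rewrite ltW.
    by right; rewrite ltW.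
  by case=> [[|]|] /andP[x0 x2]; apply/andP; split; lra.
by apply: ge0_integrable_setU => //; [exact: measurableU|apply: ge0_integrable_setU].
Qed.

Definition logsine3 x : R := - Ls3 x.

Lemma logsine3E x : logsine3 x = \int[mu]_(t in `[0, x]) (lsin t ^+ 2).
Proof.
by rewrite /logsine3 /Ls3 opprK; apply: eq_Rintegral => t _; rewrite lsinE_abs.
Qed.

Lemma der_logsine3 x : 0 < x < 2 * pi -> der logsine3 x (lsin x ^+ 2).
Proof.
move=> /andP[x0 x2].
have c : {for x, continuous (fun t => lsin t ^+ 2)}.
  by apply: continuous_lsin_sqr; apply: cos_lt1; rewrite x0.
have [d1 d2] := continuous_FTC1_closed x2 integrable_lsin_sqr x0 c.
have -> : logsine3 = (fun x => \int[mu]_(t in `[0, x]) (lsin t ^+ 2))%R.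
  by apply/funext => y; rewrite logsine3E.
by split => //; rewrite -derive1E.
Qed.

Lemma logsine3_cvg0 : logsine3 x @[x --> 0^'+] --> 0.
Proof.
have -> : logsine3 = (fun x => \int[mu]_(t in `[0, x]) (lsin t ^+ 2))%R.
  by apply/funext => y; rewrite logsine3E.
have h : 0 < 2 * pi by rewrite mulr_gt0.
have := parameterized_integral_cvg_left h integrable_lsin_sqr.
exact: cvg_trans (cvg_app _ (cvg_within _)).
Qed.

Lemma logsine3_pi3 : logsine3 (pi / 3) = 7 * pi ^+ 3 / 108.
Proof.
have p0 := pi0.
have h3 : 0 < pi / 3 by rewrite divr_gt0.
have h3' : 0 < pi / 3 < 2 * pi by apply/andP; split; lra.
have := @primitive_cvg_eq R logsine3 (@lsin_sqr_primitive R)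
  (fun x => lsin x ^+ 2) 0 (pi / 3) 0 (logsine3 (pi / 3)) 0 (7 * pi ^+ 3 / 108) h3.
rewrite !subr0; apply.
- by move=> z /andP[z0 z3]; apply: der_logsine3; apply/andP; split; lra.
- exact: der_lsin_sqr_primitive.
- exact: logsine3_cvg0.
- by apply: cvg_at_left_filter; exact: der_continuous (der_logsine3 h3').
- exact: lsin_sqr_primitive_cvg0.
- exact: lsin_sqr_primitive_pi3.
Qed.

End LogSineIntegral.

(** * The imaginary axis and the closed forms *)

Section Tangent.
Context {R : realType}.
Implicit Types (a b u v x y : R).

Local Notation pi := (@pi R).

Let pi0 : 0 < pi. Proof. exact: pi_gt0. Qed.

Lemma pi4_bounds x : 0 < x < pi / 4 ->
  [/\ 0 < sin x, 0 < cos x, 0 < tan x & tan x < 1].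
Proof.
move=> /andP[x0 x4]; have p0 := pi0.
have s0 : 0 < sin x by apply: sin_gt0_pi; apply/andP; split; lra.
have c0 : 0 < cos x by apply: cos_gt0_pihalf; apply/andP; split; lra.
split => //; first by rewrite /tan divr_gt0.
by rewrite -(@tan_piquarter R) ltr_tan ?in_itv//=; apply/andP; split; lra.
Qed.

Let dtan x : 0 < x < pi / 4 -> der tan x (1 / cos x ^+ 2).
Proof.
move=> /pi4_bounds[_ c0 _ _].
by apply: der_eq; [exact: is_derive_tan (lt0r_neq0 c0)|rewrite div1r].
Qed.

Lemma tan_cvg0 : @tan R y @[y --> (0 : R)^'+] --> (0 : R).
Proof.
rewrite -[X in _ --> X](@tan0 R); apply: cvg_at_right_filter.
by apply: continuous_tan; rewrite cos0 oner_eq0.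
Qed.

Lemma le_tan x : 0 < x < pi / 4 -> x <= tan x.
Proof.
move=> x4; have p0 := pi0; have /andP[x0 _] := x4.
pose F y : R := tan y - y.
have F0 : F y @[y --> (0 : R)^'+] --> 0 - (0 : R).
  by apply: cvgB; [exact: tan_cvg0|exact: cvg_at_right_filter cvg_id].
have dF y : 0 < y < pi / 4 -> der F y (1 / cos y ^+ 2 - 1).
  by move=> y4; have d := dtan y4; rewrite /F; deriv.
rewrite -subr_ge0 -/(F x); rewrite subr0 in F0.
apply: (cvgr_to_le F0); near=> y.
have y0 : 0 < y by near: y; exact: nbhs_right_gt.
have yx : y <= x by near: y; exact: nbhs_right_le.
have [z /andP[yz zx] E] := derive_itv_MVT dF y0 yx (proj2 (andP x4)).
rewrite -subr_ge0 E mulr_ge0 ?subr_ge0//.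
have z4 : 0 < z < pi / 4 by rewrite (lt_le_trans y0 yz) (le_lt_trans zx)//; case/andP: x4.
have [_ c0 _ _] := pi4_bounds z4.
by rewrite ler_pdivlMr ?exprn_gt0// mul1r exprn_ile1 ?cos_le1// ltW.
Unshelve. all: by end_near. Qed.

Lemma near_tan : \forall y \near (0 : R)^'+,
  [/\ 0 < y, y <= tan y, 0 < tan y & `|tan y| <= 1].
Proof.
have h : (0 : R) < pi / 4 by rewrite divr_gt0.
apply: filterS (near_right_itv h) => y y4.
have [_ _ t0 t1] := pi4_bounds y4; have /andP[y0 _] := y4.
by split => //; [exact: le_tan|rewrite gtr0_norm// ltW].
Qed.

(** The inverse tangent integral [Ti_k(tan x)], as the imaginary part of [Li_k(i tan x)]. *)
Definition tilog k x : R := polylog k (tan x) (pi / 2) 0 1.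

Lemma tilog_cvg0 k : (1 < k)%N -> tilog k y @[y --> (0 : R)^'+] --> (0 : R).
Proof.
move=> k1; apply/norm_cvg0P.
have bnd : 2 * tan y @[y --> (0 : R)^'+] --> (0 : R).
  rewrite -[X in _ --> X](mulr0 (2 : R)); apply: cvgM; first exact: cvg_cst.
  exact: tan_cvg0.
apply: (squeeze_cvgr _ (cvg_cst 0) bnd); apply: filterS near_tan => y [_ _ t0 t1].
rewrite normr_ge0 /=; apply: le_trans (polylog_norm_le _ _ _ t1 k1) _.
by rewrite normr0 add0r normr1 mulr1 (gtr0_norm t0).
Qed.

Lemma der_logtan x : 0 < x < pi / 4 -> der (fun y => ln (tan y)) x (1 / (sin x * cos x)).
Proof.
move=> x4; have [s0 c0 t0 _] := pi4_bounds x4.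
have d := dtan x4.
apply: der_eq; first exact: (@der_ln _ tan _ _ t0 d).
by rewrite /tan; field; rewrite !lt0r_neq0.
Qed.

Let tan_error x u v N : 0 < x < pi / 4 ->
  `|psum 1 (tan x) (pi / 2) u v N - polylog1 (tan x) (pi / 2) u v| <=
    2 * (`|u| + `|v|) / 1 / N.+1%:R.
Proof.
move=> x4; have [_ _ t0 t1] := pi4_bounds x4.
apply: psum1_error => //.
- by rewrite !ltW.
- by rewrite cos_pihalf mulr0.
- by move=> t _; rewrite /cdist2 cos_pihalf mulr0 subr0 lerDl sqr_ge0.
Qed.

Let polylog1_tan x : 0 < x < pi / 4 -> polylog1 (tan x) (pi / 2) 0 1 = x.
Proof.
move=> x4; rewrite /polylog1 cos_pihalf sin_pihalf mulr0 subr0 !mulr1 divr1 mul1r.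
rewrite !mul0r subr0 tanK// in_itv/=.
by have p0 := pi0; case/andP: x4 => ? ?; apply/andP; split; lra.
Qed.

Let polylog1_tan_continuous u v x : 0 < x < pi / 4 ->
  {for x, continuous (fun y => polylog1 (tan y) (pi / 2) u v)}.
Proof.
move=> x4; have d := dtan x4.
have D0 : 0 < cdist2 (tan x) (pi / 2).
  by rewrite /cdist2 cos_pihalf mulr0 subr0 ltr_wpDr// sqr_ge0.
apply: der_continuous; apply: (@der_comp _ (fun r => polylog1 r (pi / 2) u v)) d.
by apply: der_polylog1 => //; rewrite cos_pihalf mulr0 subr0 oner_eq0.
Qed.

Let tan_ok x : 0 < x < pi / 4 -> \forall y \near x, tan y != 0 /\ `|tan y| <= 1.
Proof.
move=> x4; apply: filterS (near_itv x4) => y /pi4_bounds[_ _ t0 t1].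
by rewrite lt0r_neq0// gtr0_norm// ltW.
Qed.

Let dtan_continuous x : 0 < x < pi / 4 -> {for x, continuous (fun y => 1 / cos y ^+ 2)}.
Proof.
move=> /pi4_bounds[_ c0 _ _].
have c2 : cos x ^+ 2 != 0 by rewrite expf_neq0// lt0r_neq0.
by eapply der_continuous; deriv.
Qed.

Lemma der_tilog2 x : 0 < x < pi / 4 -> der (tilog 2) x (x / (sin x * cos x)).
Proof.
move=> x4; have [s0 c0 t0 _] := pi4_bounds x4.
apply: der_eq.
  apply: (@der_polylog R 1 tan (fun _ => pi / 2) (fun y => 1 / cos y ^+ 2)
    (fun _ => 0) (fun y => polylog1 (tan y) (pi / 2) 0 1)
    (fun y => polylog1 (tan y) (pi / 2) 1 (- 0))
    (fun N => 2 * (`|0| + `|1|) / 1 / N.+1%:R)).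
  - by [].
  - by apply: filterS (near_itv x4) => y /dtan.
  - by near=> y; exact: der_cst.
  - exact: tan_ok.
  - by apply: filterS (near_itv x4) => y y4 N; exact: tan_error.
  - rewrite [`|0| + _]addrC -[`|0|]normrN.
    by apply: filterS (near_itv x4) => y y4 N; exact: tan_error.
  - exact: harmonic_cvg0.
  - exact: dtan_continuous.
  - exact: cst_continuous.
  - exact: polylog1_tan_continuous.
  - exact: polylog1_tan_continuous.
by rewrite /= polylog1_tan// /tan mul0r addr0; field; rewrite !lt0r_neq0.
Unshelve. all: by end_near. Qed.

Lemma der_tilog3 x : 0 < x < pi / 4 -> der (tilog 3) x (tilog 2 x / (sin x * cos x)).
Proof.
move=> x4; have [s0 c0 t0 _] := pi4_bounds x4.
apply: der_eq.
  apply: (@der_polylog_ge2 R 2 tan (fun _ => pi / 2) (fun y => 1 / cos y ^+ 2)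
    (fun _ => 0)).
  - by [].
  - by apply: filterS (near_itv x4) => y /dtan.
  - by near=> y; exact: der_cst.
  - exact: tan_ok.
  - exact: dtan_continuous.
  - exact: cst_continuous.
by rewrite /= -/(tilog 2 x) /tan mul0r addr0; field; rewrite !lt0r_neq0.
Unshelve. all: by end_near. Qed.

Lemma logtan_mul_cvg0 (h : R -> R) (C : R) :
  (\forall y \near (0 : R)^'+, `|h y| <= C * tan y) ->
  h y * ln (tan y) @[y --> (0 : R)^'+] --> (0 : R) /\
  h y * ln (tan y) ^+ 2 @[y --> (0 : R)^'+] --> (0 : R).
Proof.
apply: cvg0_mul_ln; first exact: tan_cvg0.
by apply: filterS near_tan => y [].
Qed.

(** [tan x] is the quotient of the chords [2 sin x] and [2 cos x]. *)
Lemma lsin_tan x : 0 < x < pi / 4 -> ln (tan x) = lsin (2 * x) - lsin (pi - 2 * x).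
Proof.
move=> x4; have [s0 c0 t0 _] := pi4_bounds x4.
have p0 := pi0; have /andP[x0 x4'] := x4.
rewrite !lsinE; [|by apply/andP; split; lra|by apply/andP; split; lra].
rewrite /chord (_ : 2 * x / 2 = x); last by field.
rewrite (_ : (pi - 2 * x) / 2 = pi / 2 - x); last by field.
rewrite sinB sin_pihalf cos_pihalf mul1r mul0r subr0.
rewrite -ln_div ?posrE ?mulr_gt0//; congr ln.
by rewrite /tan; field; rewrite lt0r_neq0.
Qed.

Lemma lsin_double x : 0 < x < pi -> lsin (2 * x) = lsin x + lsin (pi - x).
Proof.
move=> /andP[x0 xpi]; rewrite /lsin.
have h1 : cos x < 1 by apply: cos_lt1; apply/andP; split; lra.
have h3 : cos (pi - x) < 1 by apply: cos_lt1; apply/andP; split; lra.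
have c3 : cos (pi - x) = - cos x by rewrite cosB cospi sinpi mul0r addr0 mulN1r.
have -> : 2 - 2 * cos (2 * x) = (2 - 2 * cos x) * (2 - 2 * cos (pi - x)).
  rewrite (cos_half (2 * x)); have -> : 2 * x / 2 = x by field.
  by rewrite sin2cos2 c3; ring.
by rewrite lnM ?posrE; [field| |]; lra.
Qed.

(** By parts, since [1 / (sin x cos x)] is the derivative of [ln (tan x)]; [lsin_tan] integrates the
    remaining logarithm to Clausen values. *)
Lemma tilog2E x : 0 < x < pi / 4 ->
  tilog 2 x = x * ln (tan x) + (clausen (2 * x) + clausen (pi - 2 * x)) / 2.
Proof.
move=> x4; have p0 := pi0.
have := @primitive_eq_from R (tilog 2)
  (fun x => x * ln (tan x) + (clausen (2 * x) + clausen (pi - 2 * x)) / 2)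
  (fun y => y / (sin y * cos y)) 0 (pi / 4) x 0 0 x4.
rewrite !subr0; apply.
- exact: der_tilog2.
- move=> z z4; have /andP[z0 z4'] := z4.
  have [s0 c0 _ _] := pi4_bounds z4.
  have dl := der_logtan z4.
  have c1 : cos (2 * z) < 1 by apply: cos_lt1; apply/andP; split; lra.
  have c2 : cos (pi - 2 * z) < 1 by apply: cos_lt1; apply/andP; split; lra.
  apply: der_eq.
    apply: derD; first by apply: derM; [exact: der_id|exact: dl].
    apply: derM; last exact: der_cst.
    apply: derD.
      by apply: der_clausen_comp; [exact: c1|deriv].
    by apply: der_clausen_comp; [exact: c2|deriv].
  by rewrite /= (lsin_tan z4); field; rewrite !lt0r_neq0.
- exact: tilog_cvg0.
- have e : 0 = 0 + (clausen 0 + clausen (pi - 0)) / 2 :> R.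
    by rewrite subr0 clausen0 clausen_pi; ring.
  rewrite [X in _ --> X]e; apply: cvgD.
    have [|//] := @logtan_mul_cvg0 (fun y => y) 1.
    by apply: filterS near_tan => y [y0 yt _ _]; rewrite gtr0_norm// mul1r.
  have c2 : 2 * y @[y --> (0 : R)^'+] --> (0 : R).
    rewrite -[X in _ --> X](mulr0 (2 : R)); apply: cvgM; first exact: cvg_cst.
    exact: cvg_at_right_filter cvg_id.
  have cp : pi - 2 * y @[y --> (0 : R)^'+] --> pi - 0 by apply: cvgB => //; exact: cvg_cst.
  apply: cvgM; last exact: cvg_cst.
  apply: cvgD.
    exact: (continuous_cvg _ (@continuous_clausen R _) c2).
  exact: (continuous_cvg _ (@continuous_clausen R _) cp).
Qed.

(* The integral of [ln (tan t) ^ 2] over [0, x], by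
   (ln sin - ln cos)^2 = 2 ln^2 sin + 2 ln^2 cos - (ln sin + ln cos)^2. *)
Definition logtan2_primitive x : R :=
  logsine3 (2 * x) + logsine3 pi - logsine3 (pi - 2 * x) - logsine3 (4 * x) / 4.

Lemma der_logtan2_primitive x : 0 < x < pi / 4 ->
  der logtan2_primitive x (ln (tan x) ^+ 2).
Proof.
move=> x4; have p0 := pi0; have /andP[x0 x4'] := x4.
have d1 : der (@logsine3 R) (2 * x) (lsin (2 * x) ^+ 2).
  by apply: der_logsine3; apply/andP; split; lra.
have d2 : der (@logsine3 R) (pi - 2 * x) (lsin (pi - 2 * x) ^+ 2).
  by apply: der_logsine3; apply/andP; split; lra.
have d3 : der (@logsine3 R) (4 * x) (lsin (4 * x) ^+ 2).
  by apply: der_logsine3; apply/andP; split; lra.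
have e1 : der (fun y => logsine3 (2 * y)) x (lsin (2 * x) ^+ 2 * 2).
  by apply: (@der_comp _ _ (fun y => 2 * y)) d1 _; apply: der_eq; [deriv|ring].
have e2 : der (fun y => logsine3 (pi - 2 * y)) x (lsin (pi - 2 * x) ^+ 2 * - 2).
  by apply: (@der_comp _ _ (fun y => pi - 2 * y)) d2 _; apply: der_eq; [deriv|ring].
have e3 : der (fun y => logsine3 (4 * y)) x (lsin (4 * x) ^+ 2 * 4).
  by apply: (@der_comp _ _ (fun y => 4 * y)) d3 _; apply: der_eq; [deriv|ring].
rewrite /logtan2_primitive; apply: der_eq; first by deriv.
have -> : lsin (4 * x) = lsin (2 * x) + lsin (pi - 2 * x).
  rewrite -lsin_double; first by congr lsin; ring.
  by apply/andP; split; lra.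
by rewrite (lsin_tan x4); field.
Qed.

Lemma scale_at_right (c : R) : 0 < c -> c * y @[y --> (0 : R)^'+] --> (0 : R)^'+.
Proof.
move=> c0; apply: cvg_to_right.
  rewrite -[X in _ --> X](mulr0 c); apply: cvgM; first exact: cvg_cst.
  exact: cvg_at_right_filter cvg_id.
near=> y; rewrite mulr_gt0//; near: y; exact: nbhs_right_gt.
Unshelve. all: by end_near. Qed.

Lemma logsine3_scale_cvg0 (c : R) : 0 < c ->
  logsine3 (c * y) @[y --> (0 : R)^'+] --> (0 : R).
Proof. by move=> c0 P Pl; exact: (scale_at_right c0 (@logsine3_cvg0 R P Pl)). Qed.

Lemma logsine3_continuous x : 0 < x < 2 * pi -> {for x, continuous (@logsine3 R)}.
Proof. by move=> /der_logsine3/der_continuous. Qed.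

Lemma logtan2_primitive_cvg0 : logtan2_primitive y @[y --> (0 : R)^'+] --> (0 : R).
Proof.
have p0 := pi0.
have e : 0 = 0 + logsine3 pi - logsine3 pi - 0 / 4 :> R by ring.
rewrite /logtan2_primitive [X in _ --> X]e.
apply: cvgB; first apply: cvgB; first apply: cvgD.
- exact: logsine3_scale_cvg0.
- exact: cvg_cst.
- have cpi : {for pi, continuous (@logsine3 R)}.
    by apply: logsine3_continuous; apply/andP; split; lra.
  apply: (continuous_cvg _ cpi).
  rewrite -[X in _ --> X]subr0; apply: cvgB; first exact: cvg_cst.
  rewrite -[X in _ --> X](mulr0 (2 : R)); apply: cvgM; first exact: cvg_cst.
  exact: cvg_at_right_filter cvg_id.
- by apply: cvgM; [exact: logsine3_scale_cvg0|exact: cvg_cst].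
Qed.

(** With [L = ln (tan x)], integrating [tilog 2 * L'] by parts leaves the integral of [x L L']; a
    second integration by parts reduces that to the integral of [L^2 / 2]. *)
Definition tilog3_closed x : R :=
  ln (tan x) * tilog 2 x - x * ln (tan x) ^+ 2 / 2 + logtan2_primitive x / 2.

Let der_tilog3_closed x : 0 < x < pi / 4 ->
  der tilog3_closed x (tilog 2 x / (sin x * cos x)).
Proof.
move=> x4; have [s0 c0 _ _] := pi4_bounds x4.
have dl := der_logtan x4.
have dl2 : der (fun y => ln (tan y) ^+ 2) x (2 * ln (tan x) * (1 / (sin x * cos x))).
  apply: der_eq; first by apply: (@derX _ (fun y => ln (tan y))) dl.
  by rewrite expr1.
have d2 := der_tilog2 x4; have dp := der_logtan2_primitive x4.
rewrite /tilog3_closed; apply: der_eq.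
  apply: derD; first apply: derB.
  - by apply: derM; [exact: dl|exact: d2].
  - by apply: derM; [apply: derM; [exact: der_id|exact: dl2]|exact: der_cst].
  - by apply: derM; [exact: dp|exact: der_cst].
by rewrite /=; field; rewrite !lt0r_neq0.
Qed.

Let tilog3_closed_cvg0 : tilog3_closed y @[y --> (0 : R)^'+] --> (0 : R).
Proof.
have e : 0 = 0 - 0 / 2 + 0 / 2 :> R by ring.
rewrite /tilog3_closed [X in _ --> X]e.
apply: cvgD; first apply: cvgB.
- have [|h _] := @logtan_mul_cvg0 (tilog 2) 2.
    apply: filterS near_tan => y [_ _ t0 t1].
    have := polylog_norm_le (pi / 2) 0 1 t1 (isT : (1 < 2)%N).
    by rewrite normr0 add0r normr1 mulr1 (gtr0_norm t0).
  by apply: cvg_trans h; apply: near_eq_cvg; near=> y; rewrite mulrC.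
- apply: cvgM; last exact: cvg_cst.
  have [|//] := @logtan_mul_cvg0 (fun y => y) 1.
  by apply: filterS near_tan => y [y0 yt _ _]; rewrite gtr0_norm// mul1r.
- by apply: cvgM; [exact: logtan2_primitive_cvg0|exact: cvg_cst].
Unshelve. all: by end_near. Qed.

Lemma tilog3E x : 0 < x < pi / 4 -> tilog 3 x = tilog3_closed x.
Proof.
move=> x4.
have := @primitive_eq_from R (tilog 3) tilog3_closed
  (fun y => tilog 2 y / (sin y * cos y)) 0 (pi / 4) x 0 0 x4.
rewrite !subr0; apply.
- exact: der_tilog3.
- exact: der_tilog3_closed.
- exact: tilog_cvg0.
- exact: tilog3_closed_cvg0.
Qed.

(* At [pi / 4] the logarithm vanishes and the trilogarithm is the value
   [pi^3 / 32] of the Dirichlet beta function at 3. *)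
Lemma logsine3_pi : logsine3 pi = pi ^+ 3 / 12.
Proof.
have p0 := pi0.
have q0 : 0 < pi / 4 by rewrite divr_gt0.
have ci : y @[y --> (pi / 4)^'-] --> pi / 4 by exact: cvg_at_left_filter cvg_id.
have ct : tan y @[y --> (pi / 4)^'-] --> (1 : R).
  rewrite -[X in _ --> X](@tan_piquarter R); apply: cvg_at_left_filter.
  apply: continuous_tan; rewrite gt_eqF// cos_gt0_pihalf//.
  by apply/andP; split; lra.
have cT k : (1 < k)%N -> tilog k y @[y --> (pi / 4)^'-] --> polylog k 1 (pi / 2) 0 1.
  move=> k1; apply: cvg_polylog => //; first exact: cvg_cst.
  apply: filterS (near_left_itv q0) => y /pi4_bounds[_ _ t0 t1].
  by rewrite gtr0_norm// ltW.
have cl : ln (tan y) @[y --> (pi / 4)^'-] --> (0 : R).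
  rewrite -[X in _ --> X](@ln1 R); apply: continuous_cvg ct.
  exact: continuous_ln.
have cls (c : R) : 0 < c * (pi / 4) < 2 * pi ->
    logsine3 (c * y) @[y --> (pi / 4)^'-] --> logsine3 (c * (pi / 4)).
  move=> h; apply: (continuous_cvg _ (logsine3_continuous h)).
  by apply: cvgM => //; exact: cvg_cst.
have cP : logtan2_primitive y @[y --> (pi / 4)^'-] --> logtan2_primitive (pi / 4).
  rewrite /logtan2_primitive; apply: cvgB; first apply: cvgB; first apply: cvgD.
  - by apply: cls; apply/andP; split; lra.
  - exact: cvg_cst.
  - have h : 0 < pi - 2 * (pi / 4) < 2 * pi by apply/andP; split; lra.
    apply: (continuous_cvg _ (logsine3_continuous h)).
    by apply: cvgB; [exact: cvg_cst|apply: cvgM => //; exact: cvg_cst].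
  - apply: cvgM; last exact: cvg_cst.
    by apply: cls; apply/andP; split; lra.
have c3 : tilog3_closed y @[y --> (pi / 4)^'-] -->
    0 * polylog 2 1 (pi / 2) 0 1 - pi / 4 * 0 ^+ 2 / 2 + logtan2_primitive (pi / 4) / 2.
  apply: cvgD; first apply: cvgB.
  - by apply: cvgM => //; exact: cT.
  - apply: cvgM; last exact: cvg_cst.
    apply: cvgM => //; exact: (continuous_cvg _ (@exprn_continuous R 2 0) cl).
  - by apply: cvgM => //; exact: cvg_cst.
have E : polylog 3 1 (pi / 2) 0 1 =
    0 * polylog 2 1 (pi / 2) 0 1 - pi / 4 * 0 ^+ 2 / 2 + logtan2_primitive (pi / 4) / 2.
  apply: (cvg_unique (@Rhausdorff R) (cT 3 isT)).
  apply: cvg_trans c3; apply: near_eq_cvg.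
  by apply: filterS (near_left_itv q0) => y /tilog3E.
(* The two values at [pi / 2] cancel, leaving [pi^3 / 32 = (3 / 8) G(pi)]. *)
move: E; rewrite polylog3_pi2 /logtan2_primitive.
have -> : 2 * (pi / 4) = pi / 2 by field.
have -> : pi - pi / 2 = pi / 2 by field.
have -> : 4 * (pi / 4) = pi by field.
lra.
Qed.

End Tangent.

(** * Identification of [Cl2] and [Ti3], equality of the closed forms, real dilogarithm *)

Section ClosedForms.
Context {R : realType}.
Implicit Types (a b u v x y : R).

Local Notation pi := (@pi R).

Let pi0 : 0 < pi. Proof. exact: pi_gt0. Qed.

Lemma Cl2E x : Cl2 x = clausen x.
Proof.
have h : psum 2 1 x 0 1 N @[N --> \oo] --> clausen x.
  by apply: polylog_cvg; rewrite ?normr1.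
apply: cvg_lim => //; rewrite -cvg_shiftS /=.
apply: cvg_trans h; apply: near_eq_cvg; near=> N.
rewrite /psum big_add1 /=; apply: eq_bigr => i _.
by rewrite /pterm /trig expr1n mul0r add0r !mul1r.
Unshelve. all: by end_near. Qed.

Lemma sin_odd_pihalf n : sin ((2 * n + 1)%:R * (pi / 2)) = (-1) ^+ n.
Proof.
elim: n => [|n IH]; first by rewrite mul1r sin_pihalf.
have -> : (2 * n.+1 + 1)%:R * (pi / 2) = (2 * n + 1)%:R * (pi / 2) + pi :> R.
  have -> : (2 * n.+1 + 1 = 2 * n + 1 + 2)%N by lia.
  by rewrite natrD; field.
by rewrite sinDpi IH exprS mulN1r.
Qed.

Lemma Ti3E x : `|x| <= 1 -> Ti3 x = polylog 3 x (pi / 2) 0 1.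
Proof.
move=> x1.
have h : psum 3 x (pi / 2) 0 1 N @[N --> \oo] --> polylog 3 x (pi / 2) 0 1.
  exact: polylog_cvg.
apply: cvg_lim => //.
(* At angle [pi / 2] every second sine vanishes, so [N] terms of [Ti3] are [2 N] terms of the
   polylogarithm. *)
have E N : \sum_(0 <= n < N) (-1) ^+ n * x ^+ (2 * n + 1) / (2 * n + 1)%:R ^+ 3 =
    psum 3 x (pi / 2) 0 1 (2 * N)%N.
  elim: N => [|N IH]; first by rewrite muln0 psum0 big_geq.
  have e : (2 * N.+1 = (2 * N).+2)%N by lia.
  rewrite big_nat_recr//= IH e !psumS -addrA; congr (_ + _).
  rewrite /pterm /trig !mul0r !add0r !mul1r.
  have -> : (2 * N).+2%:R * (pi / 2) = N.+1%:R * pi.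
    by rewrite -e natrM; field.
  rewrite sin_natpi mulr0 mul0r addr0.
  have -> : (2 * N).+1 = (2 * N + 1)%N by rewrite addn1.
  by rewrite sin_odd_pihalf [_ * x ^+ _]mulrC.
rewrite (funext E).
have c2 : (2 * N)%N @[N --> \oo] --> \oo.
  by apply/cvgnyPge => A; near=> N; rewrite (@leq_trans N)// ?leq_pmull//; near: N;
    exact: nbhs_infty_ge.
by move=> P Pl; exact: (c2 _ (h P Pl)).
Unshelve. all: by end_near. Qed.

Lemma tan_pi6 : tan (pi / 6) = 1 / Num.sqrt 3.
Proof.
have p0 := pi0.
have c0 : 0 < cos (pi / 6) by apply: cos_gt0_pihalf; apply/andP; split; lra.
have s3 : 0 < Num.sqrt 3 :> R by rewrite sqrtr_gt0.
have E : (2 * cos (pi / 6)) ^+ 2 = 3.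
  by rewrite exprMn cos2sin2 sin_pi6; field.
have {}E : 2 * cos (pi / 6) = Num.sqrt 3.
  by rewrite -E sqrtr_sqr gtr0_norm// mulr_gt0.
rewrite /tan sin_pi6 -E; field.
by rewrite lt0r_neq0.
Qed.

(** At [x = pi / 6] one has [ln (tan x) = - ln 3 / 2], and [G(2 pi / 3)] enters [Ti3] with
    coefficient [- 5 / 8]. The factor [24 / (5 pi)] rescales this to [- 3 / pi], the terms with
    [ln 3] cancel, and [16 pi^2 / 45 - 19 pi^2 / 180 = pi^2 / 4]. *)
Lemma closed_forms_eq :
  24 / (5 * pi) * Ti3 (1 / Num.sqrt 3) + 2 * ln 3 / pi * Cl2 (pi / 3)
    - ln 3 ^+ 2 / 10 - 19 * pi ^+ 2 / 180 =
  3 / pi * (logsine3 pi - logsine3 (2 * pi / 3)).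
Proof.
have p0 := pi0.
have p6 : 0 < pi / 6 < pi / 4 by apply/andP; split; lra.
have -> : Ti3 (1 / Num.sqrt 3) = tilog 3 (pi / 6).
  rewrite Ti3E -tan_pi6//.
  by have [_ _ t0 t1] := pi4_bounds p6; rewrite gtr0_norm// ltW.
rewrite Cl2E (tilog3E p6) /tilog3_closed (tilog2E p6).
have s3 : 0 < Num.sqrt 3 :> R by rewrite sqrtr_gt0.
have -> : ln (tan (pi / 6)) = - (ln 3 / 2).
  rewrite tan_pi6 div1r lnV ?posrE//; congr (- _).
  have {2}-> : 3 = Num.sqrt 3 ^+ 2 :> R by rewrite sqr_sqrtr.
  by rewrite lnXn// -[ln _ *+ 2]mulr_natr mulfK.
have -> : 2 * (pi / 6) = pi / 3 by field.
(* Duplication at [pi / 3] has [Cl2(2 pi / 3)] on both sides and can be solved for it. *)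
have -> : clausen (pi - pi / 3) = 2 / 3 * clausen (pi / 3).
  have := @clausen_double R (pi / 3).
  have -> : pi - pi / 3 = 2 * (pi / 3) by field.
  have h : 0 <= pi / 3 <= pi by apply/andP; split; lra.
  by move=> /(_ h); lra.
rewrite /logtan2_primitive.
have -> : 2 * (pi / 6) = pi / 3 by field.
have -> : pi - pi / 3 = 2 * pi / 3 by field.
have -> : 4 * (pi / 6) = 2 * pi / 3 by field.
rewrite logsine3_pi3 logsine3_pi.
set L := ln 3; set C := clausen _; set G := logsine3 _.
clearbody L C G; move: p0; clear; generalize pi => P P0.
by field; rewrite lt0r_neq0.
Qed.

Definition dilog x : R := polylog 2 x 0 1 0.

Lemma der_dilog x : 0 < x < 1 -> der dilog x (- ln (1 - x) / x).
Proof.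
(* Near [x] one has [y < (1 + x) / 2 = 1 - h], so [|1 - t|^2 >= h^2] for every [t] in [[0, y]]. *)
move=> /andP[x0 x1]; pose h := (1 - x) / 2.
have h0 : 0 < h by rewrite divr_gt0// subr_gt0.
have err u v : \forall y \near x, forall N,
    `|psum 1 y 0 u v N - (- u * ln (1 - y))| <= 2 * (`|u| + `|v|) / h ^+ 2 / N.+1%:R.
  have h01 : 0 < x < (1 + x) / 2 by rewrite x0; lra.
  apply: filterS (near_itv h01) => y /andP[y0 y1] N.
  have -> : - u * ln (1 - y) = polylog1 y 0 u v.
    rewrite /polylog1 sin0 mulr0 mul0r atan0 mulr0 sub0r /cdist2 cos0 mulr1.
    have -> : 1 - 2 * y + y ^+ 2 = (1 - y) ^+ 2 by ring.
    rewrite lnXn; last by rewrite /h in h0; lra.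
    by rewrite -[ln _ *+ 2]mulr_natr; field.
  apply: psum1_error.
  - by rewrite ltW//=; rewrite /h in h0; lra.
  - by rewrite cos0 mulr1; rewrite /h in h0; lra.
  - exact: exprn_gt0.
  - move=> t /andP[t0 ty]; apply: le_trans (cdist2_ge_sqr _ t0).
    rewrite ler_pXn2r ?nnegrE//; rewrite /h in h0 *; lra.
apply: der_eq.
  apply: (@der_polylog R 1 (fun y => y) (fun _ => 0) (fun _ => 1) (fun _ => 0)
    (fun y => - 1 * ln (1 - y)) (fun y => - 0 * ln (1 - y))
    (fun N => 2 * (`|1 : R| + `|0 : R|) / h ^+ 2 / N.+1%:R)).
  - by [].
  - by near=> y; exact: der_id.
  - by near=> y; exact: der_cst.
  - have h01 : 0 < x < 1 by rewrite x0.
    by apply: filterS (near_itv h01) => y /andP[y0 y1]; rewrite lt0r_neq0// gtr0_norm// ltW.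
  - exact: err.
  - have -> : `|1 : R| + `|0 : R| = `|0 : R| + `|- 1 : R| by rewrite normrN addrC.
    exact: err.
  - exact: harmonic_cvg0.
  - exact: cst_continuous.
  - exact: cst_continuous.
  - by eapply der_continuous; deriv; rewrite subr_gt0.
  - by eapply der_continuous; deriv; rewrite subr_gt0.
by rewrite /=; field; rewrite lt0r_neq0.
Unshelve. all: by end_near. Qed.

Lemma cvg_dilog (T : Type) (F : set_system T) (FF : ProperFilter F) (rho : T -> R) r :
  rho t @[t --> F] --> r -> (\forall t \near F, 0 <= rho t <= 1) ->
  dilog (rho t) @[t --> F] --> dilog r.
Proof.
move=> rhor rho1; apply: cvg_polylog => //; first exact: cvg_cst.
by apply: filterS rho1 => t /andP[t0 t1]; rewrite ger0_norm.
Qed.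

End ClosedForms.

(** * Fourier series and the mean over y *)

Section Parseval.
Context {R : realType}.
Implicit Types (a b u v x y r c psi kappa : R) (n m N : nat).

Local Notation pi := (@pi R).
Local Notation mu := (@lebesgue_measure R).

(** The mean over the unit interval, certified by a primitive: linear combinations then combine with
    no integrability side conditions, and [integral_has_mean] converts to the Lebesgue integral once
    at the end. *)
Definition has_mean (f : R -> R) c :=
  exists H : R -> R, (forall y, der H y (f y)) /\ H 1 - H 0 = c.

Lemma has_mean_ext (f g : R -> R) c : f =1 g -> has_mean f c -> has_mean g c.
Proof. by move=> fg [H [dH Hc]]; exists H; split => // y; rewrite -fg. Qed.

Lemma has_mean_cst c : has_mean (fun _ => c) c.
Proof.
exists (fun y => c * y); split; last by ring.
by move=> y; apply: der_eq; [deriv|ring].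
Qed.

Lemma has_meanD (f g : R -> R) c c' : has_mean f c -> has_mean g c' ->
  has_mean (fun y => f y + g y) (c + c').
Proof.
move=> [F [dF Fc]] [G [dG Gc]]; exists (fun y => F y + G y); split.
  by move=> y; exact: derD.
by rewrite -Fc -Gc; ring.
Qed.

Lemma has_meanZ k (f : R -> R) c : has_mean f c -> has_mean (fun y => k * f y) (k * c).
Proof.
move=> [F [dF Fc]]; exists (fun y => k * F y); split; last by rewrite -Fc; ring.
by move=> y; have d := dF y; apply: der_eq; [deriv|ring].
Qed.

Definition harmonic_cos psi n y : R := cos (n%:R * (2 * pi * y + psi)).

Lemma has_mean_cos psi n : (0 < n)%N -> has_mean (harmonic_cos psi n) 0.
Proof.
move=> n0; have n0' : n%:R != 0 :> R by rewrite pnatr_eq0 -lt0n.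
have p0 : pi != 0 by rewrite gt_eqF// pi_gt0.
exists (fun y => sin (n%:R * (2 * pi * y + psi)) / (n%:R * (2 * pi))); split.
  move=> y; apply: der_eq; first by deriv.
  rewrite /harmonic_cos; move: (cos _) (sin _) => C S.
  by move: p0; generalize pi => P P0; field; rewrite n0' P0.
have -> : n%:R * (2 * pi * 1 + psi) = n%:R * (2 * pi * 0 + psi) + n%:R * (2 * pi).
  by ring.
by rewrite sin_periodn subrr.
Qed.

Lemma harmonic_cosM psi n m y : (m <= n)%N ->
  harmonic_cos psi n y * harmonic_cos psi m y =
    1 / 2 * harmonic_cos psi (n - m) y + 1 / 2 * harmonic_cos psi (n + m) y.
Proof.
move=> mn; rewrite /harmonic_cos; set X := 2 * pi * y + psi.
have -> : (n - m)%:R * X = n%:R * X - m%:R * X by rewrite natrB// mulrBl.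
have -> : (n + m)%:R * X = n%:R * X + m%:R * X by rewrite natrD mulrDl.
by rewrite cosB cosD; field.
Qed.

Lemma has_mean_cosM psi n m : (0 < m < n)%N ->
  has_mean (fun y => harmonic_cos psi n y * harmonic_cos psi m y) 0.
Proof.
move=> /andP[m0 mn].
apply: (@has_mean_ext (fun y =>
    1 / 2 * harmonic_cos psi (n - m) y + 1 / 2 * harmonic_cos psi (n + m) y)).
  by move=> y; rewrite harmonic_cosM// ltnW.
have -> : 0 = 1 / 2 * 0 + 1 / 2 * 0 :> R by rewrite !mulr0 addr0.
apply: has_meanD; apply: has_meanZ; apply: has_mean_cos; first by rewrite subn_gt0.
by rewrite addn_gt0 m0 orbT.
Qed.

Lemma has_mean_cos_sqr psi n : (0 < n)%N ->
  has_mean (fun y => harmonic_cos psi n y * harmonic_cos psi n y) (1 / 2).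
Proof.
move=> n0.
apply: (@has_mean_ext (fun y => 1 / 2 + 1 / 2 * harmonic_cos psi (n + n) y)).
  by move=> y; rewrite harmonic_cosM// subnn {2}/harmonic_cos mul0r cos0 mulr1.
rewrite -[X in has_mean _ X]addr0 -[X in has_mean _ (_ + X)](mulr0 (1 / 2)).
apply: has_meanD; first exact: has_mean_cst.
by apply: has_meanZ; apply: has_mean_cos; rewrite addn_gt0 n0.
Qed.

(** Partial Fourier sum of [- ln |1 - r e^(i (2 pi y + psi))|]. *)
Definition cos_sum r psi N y : R := psum 1 r (2 * pi * y + psi) 1 0 N.

Lemma cos_sumS r psi N y : cos_sum r psi N.+1 y =
  cos_sum r psi N y + r ^+ N.+1 / N.+1%:R * harmonic_cos psi N.+1 y.
Proof.
rewrite /cos_sum psumS; congr (_ + _).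
by rewrite /pterm /trig /harmonic_cos expr1; ring.
Qed.

Lemma cos_sum0 r psi y : cos_sum r psi 0 y = 0.
Proof. exact: psum0. Qed.

Lemma has_mean_cos_sumM r psi N m : (N < m)%N ->
  has_mean (fun y => harmonic_cos psi m y * cos_sum r psi N y) 0.
Proof.
elim: N => [|N IH] Nm.
  apply: has_mean_ext (has_mean_cst 0) => y; by rewrite cos_sum0 mulr0.
apply: (@has_mean_ext (fun y => harmonic_cos psi m y * cos_sum r psi N y +
    r ^+ N.+1 / N.+1%:R * (harmonic_cos psi m y * harmonic_cos psi N.+1 y))).
  by move=> y; rewrite cos_sumS; ring.
rewrite -[X in has_mean _ X]addr0; apply: has_meanD; first by apply: IH; exact: ltnW.
rewrite -[X in has_mean _ X](mulr0 (r ^+ N.+1 / N.+1%:R)).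
by apply: has_meanZ; exact: has_mean_cosM.
Qed.

(** Parseval for a finite sum: by orthogonality the [n]-th harmonic adds only [(r^n / n)^2 / 2],
    which is half the [n]-th term of [Li2(r^2)]. *)
Lemma has_mean_cos_sum_sqr r psi kappa N :
  has_mean (fun y => (kappa - cos_sum r psi N y) ^+ 2)
    (kappa ^+ 2 + psum 2 (r ^+ 2) 0 1 0 N / 2).
Proof.
elim: N => [|N IH].
  rewrite psum0 mul0r addr0.
  by apply: has_mean_ext (has_mean_cst (kappa ^+ 2)) => y; rewrite cos_sum0 subr0.
set a := r ^+ N.+1 / N.+1%:R.
apply: (@has_mean_ext (fun y => (kappa - cos_sum r psi N y) ^+ 2 +
  ((- (2 * a * kappa)) * harmonic_cos psi N.+1 y +
   (2 * a * (harmonic_cos psi N.+1 y * cos_sum r psi N y) +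
    a ^+ 2 * (harmonic_cos psi N.+1 y * harmonic_cos psi N.+1 y))))).
  by move=> y; rewrite cos_sumS -/a; ring.
have -> : kappa ^+ 2 + psum 2 (r ^+ 2) 0 1 0 N.+1 / 2 =
    kappa ^+ 2 + psum 2 (r ^+ 2) 0 1 0 N / 2 +
    (- (2 * a * kappa) * 0 + (2 * a * 0 + a ^+ 2 * (1 / 2))).
  rewrite psumS /pterm /trig mulr0 cos0 sin0 /a.
  have : N.+1%:R != 0 :> R by rewrite pnatr_eq0.
  by move: (N.+1%:R : R) => n n0; rewrite -exprM mulnC exprM; field.
apply: has_meanD => //; apply: has_meanD; last apply: has_meanD.
- by apply: has_meanZ; exact: has_mean_cos.
- by apply: has_meanZ; exact: has_mean_cos_sumM.
- by apply: has_meanZ; exact: has_mean_cos_sqr.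
Qed.

Lemma integral_has_mean (f : R -> R) c : continuous f -> has_mean f c ->
  (\int[mu]_(y in `[0%R, 1%R]) (f y)%:E = c%:E)%E.
Proof.
move=> cf [H [dH <-]].
have cH y : {for y, continuous H} by exact: der_continuous (dH y).
rewrite (@continuous_FTC2 _ f H)//.
- exact: continuous_subspaceT.
- split => [y _||].
  + by have [] := dH y.
  + by apply: cvg_at_right_filter; exact: cH.
  + by apply: cvg_at_left_filter; exact: cH.
- by move=> y _; rewrite derive1E; have [_ ->] := dH y.
Qed.

Lemma continuous_cos_sum r psi N : continuous (cos_sum r psi N).
Proof.
elim: N => [|N IH].
  have -> : cos_sum r psi 0 = fun _ => 0 by apply/funext => y; rewrite cos_sum0.
  by move=> y; exact: cst_continuous.
have -> : cos_sum r psi N.+1 = (fun y => cos_sum r psi N y +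
    r ^+ N.+1 / N.+1%:R * harmonic_cos psi N.+1 y).
  by apply/funext => y; rewrite cos_sumS.
move=> y; apply: cvgD; first exact: IH.
apply: cvgM; first exact: cst_continuous.
suff [d /der_continuous//] : exists d, der (harmonic_cos psi N.+1) y d.
by eexists; rewrite /harmonic_cos; deriv.
Qed.

(** For [r < 1] the Fourier series converges uniformly, so the integral is squeezed between the
    finite Parseval values. The constant [kappa] makes room for the logarithm of a factor taken out
    of the modulus. *)
Lemma integral_log_sqr r psi kappa : 0 <= r < 1 ->
  (\int[mu]_(y in `[0%R, 1%R])
     ((kappa + ln (cdist2 r (2 * pi * y + psi)) / 2) ^+ 2)%:E =
   (kappa ^+ 2 + dilog (r ^+ 2) / 2)%:E)%E.
Proof.
move=> /andP[r0 r1].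
pose w y : R := ln (cdist2 r (2 * pi * y + psi)) / 2.
pose f y : R := (kappa + w y) ^+ 2.
pose g N y : R := (kappa - cos_sum r psi N y) ^+ 2.
pose m : R := (1 - r) ^+ 2.
have m0 : 0 < m by rewrite exprn_gt0// subr_gt0.
have D0 b : 0 < cdist2 r b by apply: lt_le_trans (cdist2_ge_sqr b r0).
pose e N : R := 2 / m / N.+1%:R.
have e_ge0 N : 0 <= e N by rewrite /e !divr_ge0// ltW.
have e_le N : e N <= e 0.
  rewrite /e ler_wpM2l ?divr_ge0// ?(ltW m0)// lef_pV2 ?posrE//.
  by rewrite ler_nat.
have we N y : `|w y + cos_sum r psi N y| <= e N.
  have -> : w y + cos_sum r psi N y =
      psum 1 r (2 * pi * y + psi) 1 0 N - polylog1 r (2 * pi * y + psi) 1 0.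
    by rewrite /polylog1 /w /cos_sum; field.
  have -> : e N = 2 * (`|1 : R| + `|0 : R|) / m / N.+1%:R.
    by rewrite normr1 normr0 addr0 mulr1.
  apply: psum1_error => //.
  - by rewrite r0 ltW.
  - by rewrite (le_lt_trans _ r1)// ler_piMr// cos_le1.
  - move=> t /andP[t0 tr]; apply: le_trans (cdist2_ge_sqr _ t0).
    by rewrite /m ler_pXn2r ?nnegrE//; lra.
have w_le y : `|w y| <= e 0 by have := we 0 y; rewrite cos_sum0 addr0.
(* The difference of squares factors as [(w + S) (2 kappa + 2 w - (w + S))] with [S] the partial
   sum; [|w + S| <= e N] and [|w| <= e 0] bound the factors. *)
pose d N : R := e N * (2 * `|kappa| + 3 * e 0).
have d_ge0 N : 0 <= d N by rewrite mulr_ge0// addr_ge0// mulr_ge0.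
have fg N y : `|f y - g N y| <= d N.
  have -> : f y - g N y = (w y + cos_sum r psi N y) *
      (2 * kappa + (2 * w y - (w y + cos_sum r psi N y))) by rewrite /f /g; ring.
  rewrite normrM ler_pM//.
  have h1 := we N y; have h2 := w_le y; have h3 := e_le N.
  apply: (le_trans (ler_normD _ _)); apply: lerD; first by rewrite normrM ger0_norm.
  apply: (le_trans (ler_normB _ _)); rewrite normrM (ger0_norm (_ : 0 <= 2))//.
  lra.
have cf : continuous f.
  move=> y; suff [d' /der_continuous//] : exists d, der f y d.
  eexists; rewrite /f /w /cdist2; deriv.
  exact: D0.
have cg N : continuous (g N).
  move=> y; rewrite /g.
  have h : {for y, continuous (fun y => kappa - cos_sum r psi N y)}.
    by apply: cvgB; [exact: cst_continuous|exact: continuous_cos_sum].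
  exact: (continuous_cvg _ (@exprn_continuous R 2 _) h).
pose c N : R := kappa ^+ 2 + psum 2 (r ^+ 2) 0 1 0 N / 2.
have Ig N : (\int[mu]_(y in `[0%R, 1%R]) (g N y)%:E = (c N)%:E)%E.
  by apply: integral_has_mean => //; exact: has_mean_cos_sum_sqr.
have Igd N : (\int[mu]_(y in `[0%R, 1%R]) (g N y + d N)%:E = (c N + d N)%:E)%E.
  apply: integral_has_mean.
    by move=> y; apply: cvgD; [exact: cg|exact: cst_continuous].
  by apply: has_meanD; [exact: has_mean_cos_sum_sqr|exact: has_mean_cst].
have mfun (h : R -> R) : continuous h -> measurable_fun (`[0%R, 1%R]%classic : set R) (EFin \o h).
  by move=> ch; apply/measurable_EFinP; apply: measurable_funTS;
    exact: continuous_measurable_fun.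
set I := (\int[mu]_(y in `[0%R, 1%R]) (f y)%:E)%E.
have I0 : (0 <= I)%E by apply: integral_ge0 => y _; rewrite lee_fin sqr_ge0.
have Ile N : (I <= (c N + d N)%:E)%E.
  rewrite -Igd; apply: ge0_le_integral => //.
  - by move=> y _; rewrite lee_fin sqr_ge0.
  - exact: mfun.
  - by apply: (mfun (fun y => g N y + d N)) => y; apply: cvgD; [exact: cg|exact: cst_continuous].
  - by move=> y _; rewrite lee_fin; have := fg N y; rewrite ler_norml => /andP[h1 h2]; lra.
(* The error is added to the larger side, so both integrands stay nonnegative. *)
have geI N : ((c N)%:E <= I + (d N)%:E)%E.
  have -> : (I + (d N)%:E = \int[mu]_(y in `[0%R, 1%R]) ((f y)%:E + (d N)%:E))%E.
    rewrite ge0_integralD//.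
    - rewrite integral_cst//= lebesgue_measure_itv /= lte_fin ltr01 oppr0 adde0.
      by rewrite mule1.
    - by move=> y _; rewrite lee_fin sqr_ge0.
    - exact: mfun.
    - by move=> y _; rewrite lee_fin.
  rewrite -Ig; apply: ge0_le_integral => //.
  - by move=> y _; rewrite lee_fin sqr_ge0.
  - exact: mfun.
  - apply: (mfun (fun y => f y + d N)) => y; apply: cvgD; [exact: cf|exact: cst_continuous].
  - by move=> y _; rewrite -EFinD lee_fin; have := fg N y; rewrite ler_norml => /andP[h1 h2]; lra.
have Ifin : I \is a fin_num.
  by rewrite ge0_fin_numE// (le_lt_trans (Ile 0))// ltry.
rewrite -/(I) -(fineK Ifin); congr (_%:E).
have key N : `|c N - fine I| <= d N.
  have h1 := Ile N; have h2 := geI N.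
  move: h1 h2; rewrite -(fineK Ifin) -EFinD !lee_fin => h1 h2.
  by rewrite ler_norml; apply/andP; split; lra.
have d0 : d N @[N --> \oo] --> 0.
  rewrite -(mul0r (2 * `|kappa| + 3 * e 0)); apply: cvgM; last exact: cvg_cst.
  exact: harmonic_cvg0.
have cI : c N @[N --> \oo] --> fine I.
  apply/cvgrPdist_le => eps eps0.
  move/cvgrPdist_le: d0 => /(_ _ eps0); apply: filterS => N.
  by rewrite sub0r normrN ger0_norm// distrC; exact: le_trans.
apply: (cvg_unique (@Rhausdorff R) cI).
apply: cvgD; first exact: cvg_cst.
apply: cvgM; last exact: cvg_cst.
by apply: polylog_cvg => //; rewrite ger0_norm ?sqr_ge0// exprn_ile1// ltW.
Unshelve. all: by end_near. Qed.

End Parseval.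

(** * The dilogarithm as an integral, and the mean over x *)

Section Kernels.
Context {R : realType}.
Implicit Types (A a b s x y : R).

Local Notation pi := (@pi R).
Local Notation mu := (@lebesgue_measure R).

Let pi0 : 0 < pi. Proof. exact: pi_gt0. Qed.

(* With [A = |1 + x|^2] and [t^2 = chord2 s], the kernels are the t-derivatives
   of the two halves of the dilogarithm of [t^2 / A] and [A / t^2]. Since
   [ln] vanishes on nonpositive numbers, [ker1] is supported on [t^2 < A] and
   [ker2] on [A < t^2]. *)
Definition chord2 s : R := 2 - 2 * cos s.
Definition ker1 A s : R := `|cot_half s| * - ln (1 - chord2 s / A).
Definition ker2 A s : R := `|cot_half s| * - ln (1 - A / chord2 s).

Lemma chord2_ge0 s : 0 <= chord2 s.
Proof. by rewrite /chord2; have := cos_le1 s; lra. Qed.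

Lemma oppr_ln1B_ge0 x : 0 <= x -> 0 <= - ln (1 - x).
Proof. by move=> x0; rewrite oppr_ge0 ln_le0// lerBlDr lerDl. Qed.

Lemma ker1_ge0 A s : 0 <= A -> 0 <= ker1 A s.
Proof. by move=> A0; rewrite mulr_ge0// oppr_ln1B_ge0// divr_ge0// chord2_ge0. Qed.

Lemma ker2_ge0 A s : 0 <= A -> 0 <= ker2 A s.
Proof. by move=> A0; rewrite mulr_ge0// oppr_ln1B_ge0// divr_ge0// chord2_ge0. Qed.

Lemma chord2_gt0 s : 0 < s < 2 * pi -> 0 < chord2 s.
Proof. by move=> /cos_lt1; rewrite /chord2; lra. Qed.

Lemma chord2_mono s x : 0 <= s <= pi -> 0 <= x <= pi -> (chord2 s < chord2 x) = (s < x).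
Proof.
move=> s0 x0; rewrite /chord2 ltrD2l ltrN2 ltr_pM2l//.
by rewrite ltr_cos ?in_itv.
Qed.

Lemma chord2_pi3 : chord2 (pi / 3) = 1.
Proof. by rewrite /chord2 cos_pi3; field. Qed.

Lemma chord2_0 : chord2 0 = 0.
Proof. by rewrite /chord2 cos0; ring. Qed.

Lemma der_chord2_fun s : 0 < s < 2 * pi -> der chord2 s (2 * cot_half s * chord2 s).
Proof.
move=> s2; apply: der_eq; first by rewrite /chord2; deriv.
have s0 := sin_half_neq0 s2.
rewrite /cot_half /chord2 (sin_half s) (cos_half s); field.
by rewrite s0.
Qed.

Lemma cot_half_gt0 s : 0 < s < pi -> 0 < cot_half s.
Proof.
move=> /andP[s0 spi]; rewrite /cot_half divr_gt0 ?mulr_gt0//.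
  by apply: cos_gt0_pihalf; apply/andP; split; lra.
by apply: sin_gt0_pi; apply/andP; split; lra.
Qed.

Lemma chord2_onto A : 0 < A < 1 -> exists2 s, 0 < s < pi / 3 & chord2 s = A.
Proof.
move=> /andP[A0 A1]; have p0 := pi0.
have cA : -1 <= 1 - A / 2 <= 1 by apply/andP; split; lra.
have [/andP[h1 h2] h3] := acos_def cA.
set s := acos _ in h1 h2 h3.
have cs : chord2 s = A by rewrite /chord2 h3; field.
have s0pi : 0 <= s <= pi by rewrite h1.
have h03 : 0 <= pi / 3 <= pi by apply/andP; split; lra.
have h00 : 0 <= (0 : R) <= pi by rewrite lexx ltW.
exists s => //; apply/andP; split.
  by rewrite -(chord2_mono h00 s0pi) cs chord2_0.
by rewrite -(chord2_mono s0pi h03) cs chord2_pi3.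
Qed.

Let chord2_cvg0 : chord2 y @[y --> (0 : R)^'+] --> (0 : R).
Proof.
rewrite -[X in _ --> X]chord2_0; apply: cvg_at_right_filter.
suff [d /der_continuous//] : exists d, der chord2 0 d.
by eexists; rewrite /chord2; deriv.
Qed.

Let chord2_continuous s : {for s, continuous chord2}.
Proof.
suff [d /der_continuous//] : exists d, der chord2 s d.
by eexists; rewrite /chord2; deriv.
Qed.

Let cot_half_continuous s : 0 < s < 2 * pi -> {for s, continuous (@cot_half R)}.
Proof.
move=> /sin_half_neq0 s0.
suff [d /der_continuous//] : exists d, der (@cot_half R) s d.
by eexists; rewrite /cot_half; deriv; rewrite mulf_neq0.
Qed.

(** [Li2(z)] has derivative [- ln (1 - z) / z], and [chord2] has logarithmic derivative
    [2 cot_half]; the factor 2 is absorbed by the half in front of the dilogarithm. *)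
Lemma der_dilog_chord2 A s : 0 < s < 2 * pi -> 0 < A -> chord2 s < A ->
  der (fun y => dilog (chord2 y / A) / 2) s (cot_half s * - ln (1 - chord2 s / A)).
Proof.
move=> s2 A0 sA; have c0 := chord2_gt0 s2.
have z01 : 0 < chord2 s / A < 1 by rewrite divr_gt0//= ltr_pdivrMr// mul1r.
have dc := der_chord2_fun s2.
have dz : der (fun y => chord2 y / A) s (2 * cot_half s * chord2 s / A).
  by apply: der_eq; [apply: derM; [exact: dc|exact: der_cst]|rewrite /=; ring].
apply: der_eq.
  apply: derM; last exact: der_cst.
  exact: (@der_comp _ _ (fun y => chord2 y / A) _ _ _ (der_dilog z01) dz).
by rewrite /=; field; rewrite !lt0r_neq0.
Qed.

Lemma der_dilog_chord2V A s : 0 < s < 2 * pi -> 0 < A -> A < chord2 s ->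
  der (fun y => - dilog (A / chord2 y) / 2) s (cot_half s * - ln (1 - A / chord2 s)).
Proof.
move=> s2 A0 sA; have c0 := chord2_gt0 s2.
have z01 : 0 < A / chord2 s < 1 by rewrite divr_gt0//= ltr_pdivrMr// mul1r.
have dc := der_chord2_fun s2.
have dz : der (fun y => A / chord2 y) s (- (2 * cot_half s * A / chord2 s)).
  apply: der_eq.
    by apply: derM; [exact: der_cst|apply: derV; [exact: lt0r_neq0|exact: dc]].
  by rewrite /=; field; rewrite !lt0r_neq0.
apply: der_eq.
  apply: derM; last exact: der_cst.
  apply: derN.
  exact: (@der_comp _ _ (fun y => A / chord2 y) _ _ _ (der_dilog z01) dz).
by rewrite /=; field; rewrite !lt0r_neq0.
Qed.

(** On nonnegative numbers the inverse is the real power with exponent -1, including at 0. *)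
Lemma measurable_fun_inv_ge0 (d : measure_display) (D : measurableType d)
  (f : D -> R) : measurable_fun [set: D] f -> (forall t, 0 <= f t) ->
  measurable_fun [set: D] (fun t => (f t)^-1).
Proof.
move=> mf f0.
have -> : (fun t => (f t)^-1) = (fun r => r `^ (-1)) \o f.
  by apply/funext => t /=; rewrite powR_inv1.
exact: measurableT_comp (@measurable_powR R (-1)) mf.
Qed.

Lemma measurable_chord2 : measurable_fun [set: R] chord2.
Proof. by apply: continuous_measurable_fun => s; exact: chord2_continuous. Qed.

Lemma measurable_norm_cot_half : measurable_fun [set: R] (fun s => `|@cot_half R s|).
Proof.
have -> : (fun s => `|@cot_half R s|) =
    (fun s => `|cos (s / 2)| * `|2 * sin (s / 2)|^-1).
  by apply/funext => s; rewrite /cot_half normrM normfV.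
have mc : continuous (fun s : R => cos (s / 2)).
  by move=> s; eapply der_continuous; deriv.
have ms : continuous (fun s : R => 2 * sin (s / 2)).
  by move=> s; eapply der_continuous; deriv.
apply: measurable_funM.
  apply: measurableT_comp => //; exact: continuous_measurable_fun.
apply: (@measurable_fun_inv_ge0 _ _ (fun s => `|2 * sin (s / 2)|)) => //.
apply: measurableT_comp => //; exact: continuous_measurable_fun.
Qed.

Lemma ge0_integral_itv_split (f : R -> R) a c b : a < c < b ->
  measurable_fun [set: R] f -> (forall s, 0 <= f s) ->
  (\int[mu]_(s in `]a, b[) (f s)%:E =
   \int[mu]_(s in `]a, c[) (f s)%:E + \int[mu]_(s in `]c, b[) (f s)%:E)%E.
Proof.
move=> /andP[ac cb] mf f0.
have mF (D : set R) : measurable_fun D (EFin \o f).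
  by apply/measurable_EFinP; exact: measurable_funTS.
rewrite -(@integral_itv_bndoo R c b (EFin \o f) true true) //.
have E : `]a, b[%classic = `]a, c[%classic `|` `[c, b[%classic :> set R.
  by rewrite -itv_bndbnd_setU// bnd_simp ltW.
rewrite E ge0_integral_setU//.
- exact: mF.
- by move=> s _; rewrite lee_fin.
- by apply/disj_setPS => s [/=]; rewrite !in_itv/= => /andP[_ sc] /andP[cs _]; have := lt_le_trans sc cs; rewrite ltxx.
Qed.

Lemma integral_itv_eq0 (f : R -> R) a b : (forall s, a < s < b -> f s = 0) ->
  (\int[mu]_(s in `]a, b[) (f s)%:E = 0)%E.
Proof.
move=> f0; apply: integral0_eq => s; rewrite /= in_itv/= => sab.
by rewrite f0.
Qed.

Section FixedA.
Variable A : R.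
Hypothesis A0 : 0 < A.

Let mker1 : measurable_fun [set: R] (ker1 A).
Proof.
apply: measurable_funM; first exact: measurable_norm_cot_half.
apply: measurableT_comp => //; apply: (measurableT_comp (@measurable_ln R)).
apply: measurable_funB => //; apply: measurable_funM => //; exact: measurable_chord2.
Qed.

Let mker2 : measurable_fun [set: R] (ker2 A).
Proof.
apply: measurable_funM; first exact: measurable_norm_cot_half.
apply: measurableT_comp => //; apply: (measurableT_comp (@measurable_ln R)).
apply: measurable_funB => //; apply: measurable_funM => //.
apply: measurable_fun_inv_ge0 => [|s]; first exact: measurable_chord2.
exact: chord2_ge0.
Qed.

(** Used with [b = pi / 3] when [A > 1] and with [chord2 b = A] when [A < 1]. The absolute value in
    the kernel, which keeps it nonnegative for every [s], disappears on this range. *)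
Lemma integral_ker1_part b : 0 < b <= pi / 3 -> chord2 b <= A ->
  (\int[mu]_(s in `]0%R, b[) (ker1 A s)%:E = (dilog (chord2 b / A) / 2)%:E)%E.
Proof.
move=> /andP[b0 b3] bA; have p0 := pi0.
have sb s : 0 < s < b -> [/\ 0 < s < 2 * pi, 0 < cot_half s & chord2 s < A].
  move=> /andP[s0 sb]; split; first by apply/andP; split; lra.
    by apply: cot_half_gt0; apply/andP; split; lra.
  by apply: lt_le_trans bA; rewrite chord2_mono//; apply/andP; split; lra.
have kE s : 0 < s < b -> ker1 A s = cot_half s * - ln (1 - chord2 s / A).
  by move=> /sb[_ c0 _]; rewrite /ker1 gtr0_norm.
rewrite -[X in X%:E]subr0.
transitivity (\int[mu]_(s in `]0%R, b[) (cot_half s * - ln (1 - chord2 s / A))%:E)%E.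
  apply: eq_integral => s /set_mem; rewrite /= in_itv/= => s0b.
  by rewrite kE.
apply: (@ge0_FTC _ _ (fun y => dilog (chord2 y / A) / 2)) => //.
- by move=> s s0b; rewrite -kE// ker1_ge0// ltW.
- move=> s s0b; have [s2 _ sA] := sb _ s0b.
  apply: cvgM; first exact: cot_half_continuous.
  apply: cvgN; apply: (continuous_cvg _ (@continuous_ln R _ _)).
    by rewrite subr_gt0 ltr_pdivrMr// mul1r.
  apply: cvgB; first exact: cst_continuous.
  by apply: cvgM; [exact: chord2_continuous|exact: cst_continuous].
- by move=> s s0b; have [s2 _ sA] := sb _ s0b; exact: der_dilog_chord2.
- have d0 : dilog 0 = 0 :> R.
    apply/eqP; rewrite -normr_le0.
    have := @polylog_norm_le R 2 0 0 1 0.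
    by rewrite normr0 mulr0; apply => //; rewrite ler01.
  have e : 0 = dilog 0 / 2 :> R by rewrite d0 mul0r.
  rewrite [X in _ --> X]e; apply: cvgM; last exact: cvg_cst.
  apply: cvg_dilog.
    rewrite -[X in _ --> X](mul0r A^-1); apply: cvgM; last exact: cvg_cst.
    exact: chord2_cvg0.
  apply: filterS (near_right_itv b0) => s s0b; have [s2 _ sA] := sb _ s0b.
  by rewrite divr_ge0 ?chord2_ge0 ?(ltW A0)//= ler_pdivrMr// mul1r ltW.
- apply: cvgM; last exact: cvg_cst.
  apply: cvg_dilog.
    apply: cvgM; last exact: cvg_cst.
    by apply: cvg_at_left_filter; exact: chord2_continuous.
  apply: filterS (near_left_itv b0) => s s0b; have [s2 _ sA] := sb _ s0b.
  by rewrite divr_ge0 ?chord2_ge0 ?(ltW A0)//= ler_pdivrMr// mul1r ltW.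
Qed.

Lemma integral_ker2_part a : 0 < a < pi / 3 -> chord2 a = A ->
  (\int[mu]_(s in `]a, (pi / 3)%R[) (ker2 A s)%:E = ((dilog 1 - dilog A) / 2)%:E)%E.
Proof.
move=> /andP[a0 a3] aA; have p0 := pi0.
have sb s : a < s < pi / 3 -> [/\ 0 < s < 2 * pi, 0 < cot_half s & A < chord2 s].
  move=> /andP[s0 sb]; split; first by apply/andP; split; lra.
    by apply: cot_half_gt0; apply/andP; split; lra.
  by rewrite -aA chord2_mono//; apply/andP; split; lra.
have kE s : a < s < pi / 3 -> ker2 A s = cot_half s * - ln (1 - A / chord2 s).
  by move=> /sb[_ c0 _]; rewrite /ker2 gtr0_norm.
have -> : (dilog 1 - dilog A) / 2 =
    - dilog (A / chord2 (pi / 3)) / 2 - (- dilog (A / chord2 a) / 2).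
  by rewrite chord2_pi3 divr1 aA divff ?lt0r_neq0//; field.
transitivity (\int[mu]_(s in `]a, (pi / 3)%R[) (cot_half s * - ln (1 - A / chord2 s))%:E)%E.
  apply: eq_integral => s /set_mem; rewrite /= in_itv/= => s0b.
  by rewrite kE.
have lim (F : set_system R) (FF : ProperFilter F) c : 0 < chord2 c ->
    s @[s --> F] --> c -> (\forall s \near F, a < s < pi / 3) ->
    - dilog (A / chord2 s) / 2 @[s --> F] --> - dilog (A / chord2 c) / 2.
  move=> c0 Fc Fi; apply: cvgM; last exact: cvg_cst.
  apply: cvgN; apply: cvg_dilog.
    apply: cvgM; first exact: cvg_cst.
    apply: cvgV; first exact: lt0r_neq0.
    exact: (continuous_cvg _ (@chord2_continuous _) Fc).
  apply: filterS Fi => s sab; have [s2 _ sA] := sb _ sab.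
  by rewrite divr_ge0 ?chord2_ge0 ?(ltW A0)//= ler_pdivrMr ?(chord2_gt0 s2)// mul1r ltW.
apply: (@ge0_FTC _ _ (fun y => - dilog (A / chord2 y) / 2)) => //.
- by move=> s s0b; rewrite -kE// ker2_ge0// ltW.
- move=> s s0b; have [s2 _ sA] := sb _ s0b; have c0 := chord2_gt0 s2.
  apply: cvgM; first exact: cot_half_continuous.
  apply: cvgN; apply: (continuous_cvg _ (@continuous_ln R _ _)).
    by rewrite subr_gt0 ltr_pdivrMr// mul1r.
  apply: cvgB; first exact: cst_continuous.
  apply: cvgM; first exact: cst_continuous.
  by apply: cvgV; [exact: lt0r_neq0|exact: chord2_continuous].
- by move=> s s0b; have [s2 _ sA] := sb _ s0b; exact: der_dilog_chord2V.
- apply: lim; first by rewrite aA.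
    exact: cvg_at_right_filter cvg_id.
  exact: near_right_itv.
- apply: lim; first by rewrite chord2_pi3.
    exact: cvg_at_left_filter cvg_id.
  exact: near_left_itv.
Qed.

Lemma integral_ker1_gt1 : 1 < A ->
  (\int[mu]_(s in `]0%R, (pi / 3)%R[) (ker1 A s)%:E = (dilog A^-1 / 2)%:E)%E.
Proof.
move=> A1; rewrite integral_ker1_part ?chord2_pi3 ?div1r//; last exact: ltW.
by rewrite divr_gt0//= lexx.
Qed.

(** The kernel is cut off where [chord2 c = A], that is, where the argument of the dilogarithm
    reaches 1; hence a value independent of [A]. *)
Lemma integral_ker1_lt1 : A < 1 ->
  (\int[mu]_(s in `]0%R, (pi / 3)%R[) (ker1 A s)%:E = (dilog 1 / 2)%:E)%E.
Proof.
move=> A1; have p0 := pi0.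
have [|c c3 cA] := @chord2_onto A; first by rewrite A0.
have /andP[c0 c3'] := c3.
rewrite (ge0_integral_itv_split c3)//; last by move=> s; rewrite ker1_ge0// ltW.
rewrite integral_ker1_part ?cA ?divff ?lt0r_neq0//; last by rewrite c0 ltW.
rewrite integral_itv_eq0 ?adde0// => s /andP[cs s3].
rewrite /ker1 [ln _]ln0 ?oppr0 ?mulr0// subr_le0 ler_pdivlMr// mul1r -cA ltW//.
by rewrite chord2_mono//; apply/andP; split; lra.
Qed.

Lemma integral_ker2_gt1 : 1 < A ->
  (\int[mu]_(s in `]0%R, (pi / 3)%R[) (ker2 A s)%:E = 0)%E.
Proof.
move=> A1; have p0 := pi0; apply: integral_itv_eq0 => s /andP[s0 s3].
have c0 : 0 < chord2 s by apply: chord2_gt0; apply/andP; split; lra.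
rewrite /ker2 [ln _]ln0 ?oppr0 ?mulr0// subr_le0 ler_pdivlMr// mul1r ltW//.
apply: lt_trans A1; rewrite -chord2_pi3 chord2_mono//; apply/andP; split; lra.
Qed.

(** Here [A / chord2 s] falls from 1 at the cut-off to [A] at [pi / 3]. Subtracted from the integral
    of [ker1], this leaves exactly [dilog A / 2]. *)
Lemma integral_ker2_lt1 : A < 1 ->
  (\int[mu]_(s in `]0%R, (pi / 3)%R[) (ker2 A s)%:E = ((dilog 1 - dilog A) / 2)%:E)%E.
Proof.
move=> A1; have p0 := pi0.
have [|c c3 cA] := @chord2_onto A; first by rewrite A0.
have /andP[c0 c3'] := c3.
rewrite (ge0_integral_itv_split c3)//; last by move=> s; rewrite ker2_ge0// ltW.
rewrite [X in (_ + X)%E](integral_ker2_part c3 cA).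
rewrite integral_itv_eq0 ?add0e// => s /andP[s0 sc].
have c0' : 0 < chord2 s by apply: chord2_gt0; apply/andP; split; lra.
rewrite /ker2 [ln _]ln0 ?oppr0 ?mulr0// subr_le0 ler_pdivlMr// mul1r -cA ltW//.
by rewrite chord2_mono//; apply/andP; split; lra.
Qed.

End FixedA.

End Kernels.

(** * Means over [x] of the logarithmic kernels *)

Section CircleIntegrals.
Context {R : realType}.
Implicit Types (A a b s v x y tau : R).

Local Notation pi := (@pi R).
Local Notation mu := (@lebesgue_measure R).

Let pi0 : 0 < pi. Proof. exact: pi_gt0. Qed.

(* |1 + e^(2 pi i x)|^2 *)
Definition side2 x : R := 2 + 2 * cos (2 * pi * x).

Lemma side2_ge0 x : 0 <= side2 x.
Proof. by rewrite /side2; have := cos_geN1 (2 * pi * x); lra. Qed.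

Lemma cos_pair_mul tau v :
  (1 - cos (tau + v)) * (1 - cos (tau - v)) = (cos tau - cos v) ^+ 2.
Proof.
rewrite cosD cosB.
have h1 := cos2Dsin2 tau; have h2 := cos2Dsin2 v.
have -> : (1 - (cos tau * cos v - sin tau * sin v)) *
    (1 - (cos tau * cos v + sin tau * sin v)) =
  (1 - cos tau * cos v) ^+ 2 - sin tau ^+ 2 * sin v ^+ 2 by ring.
by rewrite !sin2cos2; ring.
Qed.

Lemma cos_pair_lt1 tau v : cos tau != cos v ->
  cos (tau + v) < 1 /\ cos (tau - v) < 1.
Proof.
move=> tv.
have : 0 < (1 - cos (tau + v)) * (1 - cos (tau - v)).
  by rewrite cos_pair_mul lt_neqAle sqr_ge0 andbT eq_sym sqrf_eq0 subr_eq0.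
have h1 := cos_le1 (tau + v); have h2 := cos_le1 (tau - v).
by move=> h; split; nra.
Qed.

(** With [tau = pi - s] and [v = 2 pi x], the right-hand side is [ln |side2 x - chord2 s|]; the
    split makes it integrable in closed form by Clausen functions. *)
Lemma lsin_pair tau v : cos tau != cos v ->
  lsin (tau + v) + lsin (tau - v) = ln `|2 * cos tau - 2 * cos v|.
Proof.
move=> tv; have [h1 h2] := cos_pair_lt1 tv.
have d0 : 0 < `|2 * cos tau - 2 * cos v|.
  by rewrite normr_gt0 -mulrBr mulf_neq0// subr_eq0.
rewrite /lsin -mulrDl -lnM ?posrE; [|lra|lra].
have -> : (2 - 2 * cos (tau + v)) * (2 - 2 * cos (tau - v)) =
    `|2 * cos tau - 2 * cos v| ^+ 2.
  rewrite real_normK ?num_real//.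
  have := cos_pair_mul tau v; set c1 := cos (_ + _); set c2 := cos (_ - _) => E.
  have -> : (2 - 2 * c1) * (2 - 2 * c2) = 4 * ((1 - c1) * (1 - c2)) by ring.
  by rewrite E; ring.
by rewrite lnXn// -[ln _ *+ 2]mulr_natr mulfK.
Qed.

Lemma cos_pi_sub v : cos (pi - v) = - cos v.
Proof. by rewrite cosB cospi sinpi mul0r addr0 mulN1r. Qed.

Lemma cos_2pi_sub v : cos (2 * pi - v) = cos v.
Proof. by rewrite cosB mulr_natl cos2pi sin2pi mul1r mul0r addr0. Qed.

Lemma clausen_2pi_sub v : clausen (2 * pi - v) = - clausen v.
Proof. by rewrite addrC clausenD2pi clausenN. Qed.

Definition circle_ln1 s x : R := - ln (1 - chord2 s / side2 x).
Definition circle_ln2 s x : R := - ln (1 - side2 x / chord2 s).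

Lemma measurable_side2 : measurable_fun [set: R] side2.
Proof.
apply: continuous_measurable_fun => x.
by eapply der_continuous; rewrite /side2; deriv.
Qed.

Lemma measurable_circle_ln1 s : measurable_fun [set: R] (circle_ln1 s).
Proof.
apply: measurableT_comp => //; apply: (measurableT_comp (@measurable_ln R)).
apply: measurable_funB => //; apply: measurable_funM => //.
apply: measurable_fun_inv_ge0 => [|x]; first exact: measurable_side2.
exact: side2_ge0.
Qed.

Lemma measurable_circle_ln2 s : measurable_fun [set: R] (circle_ln2 s).
Proof.
apply: measurableT_comp => //; apply: (measurableT_comp (@measurable_ln R)).
apply: measurable_funB => //; apply: measurable_funM => //; exact: measurable_side2.
Qed.

Lemma circle_ln1_ge0 s x : 0 <= circle_ln1 s x.
Proof. by rewrite oppr_ln1B_ge0// divr_ge0 ?chord2_ge0 ?side2_ge0. Qed.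

Lemma circle_ln2_ge0 s x : 0 <= circle_ln2 s x.
Proof. by rewrite oppr_ln1B_ge0// divr_ge0 ?chord2_ge0 ?side2_ge0. Qed.

Let two_pi_x x : der (fun y => 2 * pi * y) x (2 * pi).
Proof. by apply: der_eq; [deriv|ring]. Qed.

Lemma integral_unit_split (f : R -> R) c : 0 < c < 1 / 2 ->
  measurable_fun [set: R] f -> (forall x, 0 <= f x) ->
  (\int[mu]_(x in `[0%R, 1%R]) (f x)%:E =
   \int[mu]_(x in `]0%R, c[) (f x)%:E + \int[mu]_(x in `]c, (1 - c)%R[) (f x)%:E
   + \int[mu]_(x in `](1 - c)%R, 1%R[) (f x)%:E)%E.
Proof.
move=> /andP[c0 c1] mf f0.
rewrite integral_itv_bndoo; last first.
  by apply/measurable_EFinP; exact: measurable_funTS.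
rewrite (@ge0_integral_itv_split _ f 0 (1 - c) 1)//; last by apply/andP; split; lra.
by rewrite (@ge0_integral_itv_split _ f 0 c (1 - c))//; apply/andP; split; lra.
Qed.

Section FixedS.
Variable s : R.
Hypothesis s3 : 0 < s < pi / 3.

Let tau := pi - s.
(** The point of []0, 1 / 2[] where [side2 x = chord2 s]: [circle_ln1] lives on the two outer
    intervals cut by [c] and [1 - c], [circle_ln2] on the middle one. *)
Let c := tau / (2 * pi).

Let c_bounds : 0 < c < 1 / 2.
Proof.
case/andP: s3 => s0 s3'; have p0 := pi0; rewrite /c /tau; apply/andP; split.
  by rewrite divr_gt0; lra.
by rewrite ltr_pdivrMr; lra.
Qed.

Let tauE : 2 * pi * c = tau.
Proof. by rewrite /c mulrC divfK// mulf_neq0// lt0r_neq0. Qed.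

Let cos_tau : cos tau = - cos s. Proof. exact: cos_pi_sub. Qed.

Let cos_out x : 0 < x < c -> cos tau < cos (2 * pi * x).
Proof.
case/andP: s3 => s0 s3'; have p0 := pi0.
move=> /andP[x0 xc]; have : 2 * pi * x < tau by rewrite -tauE ltr_pM2l// mulr_gt0.
have x0' : 0 < 2 * pi * x by rewrite !mulr_gt0.
by move=> xt; rewrite ltr_cos ?in_itv//=; rewrite /tau in xt *; apply/andP; split; lra.
Qed.

Let cos_out' x : 1 - c < x < 1 -> cos tau < cos (2 * pi * x).
Proof.
move=> /andP[x0 xc]; have -> : cos (2 * pi * x) = cos (2 * pi * (1 - x)).
  by rewrite -cos_2pi_sub; congr cos; ring.
by apply: cos_out; apply/andP; split; lra.
Qed.

Let cos_in x : c < x < 1 - c -> cos (2 * pi * x) < cos tau.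
Proof.
case/andP: s3 => s0 s3'; have p0 := pi0.
suff H y : c < y <= 1 / 2 -> cos (2 * pi * y) < cos tau.
  move=> /andP[cx xc]; have [x2|x2] := leP x (1 / 2); first by apply: H; rewrite cx.
  have -> : cos (2 * pi * x) = cos (2 * pi * (1 - x)).
    by rewrite -cos_2pi_sub; congr cos; ring.
  by apply: H; apply/andP; split; lra.
move=> /andP[cy y2].
have h1 : tau < 2 * pi * y by rewrite -tauE ltr_pM2l// mulr_gt0.
have h2 : 2 * pi * y <= pi.
  have := ler_wpM2l (ltW p0) y2; lra.
by rewrite ltr_cos ?in_itv//=; rewrite /tau in h1 *; apply/andP; split; lra.
Qed.

Let sideB x : side2 x - chord2 s = 2 * cos (2 * pi * x) - 2 * cos tau.
Proof. by rewrite /side2 /chord2 cos_tau; ring. Qed.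

(** Primitive of [ln (side2 x) - ln (side2 x - chord2 s)]: the first two Clausen terms come from
    [lsin_pair], the third from [ln (side2 x) = 2 lsin (pi - 2 pi x)]. It is continuous everywhere,
    so the singularity at [c] does no harm. *)
Let prim1 x := (clausen (tau + 2 * pi * x) - clausen (tau - 2 * pi * x)
  + 2 * clausen (pi - 2 * pi * x)) / (2 * pi).

Let der_prim1 x : cos tau < cos (2 * pi * x) -> der prim1 x (circle_ln1 s x).
Proof.
move=> cx; have p0 := pi0.
have cne : cos tau != cos (2 * pi * x) by rewrite lt_eqF.
have [h1 h2] := cos_pair_lt1 cne.
have h3 : cos (pi - 2 * pi * x) < 1.
  by rewrite cos_pi_sub; have := cos_geN1 tau; lra.
have d := two_pi_x x.
rewrite /prim1; apply: der_eq.
  apply: derM; last exact: der_cst.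
  apply: derD; first apply: derB.
  - by apply: der_clausen_comp; [exact: h1|apply: derD; [exact: der_cst|exact: d]].
  - by apply: der_clausen_comp; [exact: h2|apply: derB; [exact: der_cst|exact: d]].
  - apply: derM; first exact: der_cst.
    by apply: der_clausen_comp; [exact: h3|apply: derB; [exact: der_cst|exact: d]].
have A0 : 0 < side2 x by rewrite /side2; have := cos_geN1 tau; lra.
have B0 : 0 < side2 x - chord2 s by rewrite sideB; lra.
have -> : circle_ln1 s x = ln (side2 x) - ln (side2 x - chord2 s).
  rewrite /circle_ln1 -[RHS]opprB -ln_div ?posrE//; congr (- ln _).
  by field; rewrite lt0r_neq0.
have := lsin_pair cne; rewrite ler0_norm; last by lra.
rewrite opprB -sideB => <-.
have -> : ln (side2 x) = 2 * lsin (pi - 2 * pi * x).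
  by rewrite /lsin cos_pi_sub mulrN opprK -/(side2 x); field.
move: (lsin _) (lsin _) (lsin _) => l1 l2 l3.
by rewrite /=; move: p0; generalize pi => P P0; field; rewrite lt0r_neq0.
Qed.

Let continuous_clausen_affine a b x :
  {for x, continuous (fun y => clausen (a + b * y))}.
Proof.
apply: (continuous_cvg _ (@continuous_clausen R _)).
by apply: cvgD; [exact: cst_continuous|apply: cvgM; [exact: cst_continuous|exact: cvg_id]].
Qed.

Let prim1_continuous x : {for x, continuous prim1}.
Proof.
have e y : prim1 y = (clausen (tau + 2 * pi * y) - clausen (tau + - (2 * pi) * y)
  + 2 * clausen (pi + - (2 * pi) * y)) / (2 * pi).
  by rewrite /prim1 !mulNr.
rewrite (funext e).
apply: cvgM; last exact: cst_continuous.
apply: cvgD; first apply: cvgB; try exact: continuous_clausen_affine.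
by apply: cvgM; [exact: cst_continuous|exact: continuous_clausen_affine].
Qed.

Let circle_ln1_continuous x : cos tau < cos (2 * pi * x) ->
  {for x, continuous (circle_ln1 s)}.
Proof.
move=> cx.
have A0 : 0 < side2 x by rewrite /side2; have := cos_geN1 tau; lra.
have B0 : 0 < side2 x - chord2 s by rewrite sideB; lra.
suff [d /der_continuous//] : exists d, der (circle_ln1 s) x d.
rewrite /circle_ln1 /side2; eexists; deriv; last by rewrite lt0r_neq0.
by rewrite subr_gt0 -/(side2 x) ltr_pdivrMr// mul1r -subr_gt0.
Qed.

Let clausen_2tau : clausen (2 * tau) = 2 * clausen tau - 2 * clausen s.
Proof.
case/andP: s3 => s0 s3'; have p0 := pi0.
rewrite clausen_double; last by rewrite /tau; apply/andP; split; lra.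
by have -> : pi - tau = s by rewrite /tau; ring.
Qed.

Lemma integral_circle_ln1 :
  (\int[mu]_(x in `[0%R, 1%R]) (circle_ln1 s x)%:E =
   (2 / pi * clausen (pi - s))%:E)%E.
Proof.
case/andP: s3 => s0 s3'; have p0 := pi0; have /andP[c0 c2] := c_bounds.
rewrite (integral_unit_split c_bounds (measurable_circle_ln1 s) (circle_ln1_ge0 s)).
rewrite (@ge0_FTC _ (circle_ln1 s) prim1 0 c (prim1 0) (prim1 c))//; first last.
- by apply: cvg_at_left_filter; exact: prim1_continuous.
- by apply: cvg_at_right_filter; exact: prim1_continuous.
- by move=> x /cos_out; exact: der_prim1.
- by move=> x /cos_out; exact: circle_ln1_continuous.
- by move=> x _; exact: circle_ln1_ge0.
rewrite integral_itv_eq0; last first.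
  move=> x /cos_in cx; rewrite /circle_ln1.
  (* Where [side2 x = 0] the quotient is 0 by convention and the logarithm is [ln 1]; elsewhere its
     argument is nonpositive and [ln] returns 0. *)
  have := side2_ge0 x; rewrite le_eqVlt => /predU1P[<-|A0].
    by rewrite invr0 mulr0 subr0 ln1 oppr0.
  rewrite [ln _]ln0 ?oppr0// subr_le0.
  by rewrite ler_pdivlMr// mul1r -subr_le0 sideB; lra.
rewrite adde0.
rewrite (@ge0_FTC _ (circle_ln1 s) prim1 (1 - c) 1 (prim1 (1 - c)) (prim1 1))//; first last.
- by apply: cvg_at_left_filter; exact: prim1_continuous.
- by apply: cvg_at_right_filter; exact: prim1_continuous.
- by move=> x /cos_out'; exact: der_prim1.
- by move=> x /cos_out'; exact: circle_ln1_continuous.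
- by move=> x _; exact: circle_ln1_ge0.
- lra.
rewrite -EFinD; congr (_%:E).
have e0 : prim1 0 = 0.
  by rewrite /prim1 mulr0 addr0 !subr0 subrr add0r clausen_pi mulr0 mul0r.
have e1 : prim1 1 = 0.
  rewrite /prim1 mulr1 clausenD2pi.
  have -> : tau - 2 * pi = - (2 * pi - tau) by ring.
  rewrite clausenN clausen_2pi_sub opprK subrr add0r.
  have -> : pi - 2 * pi = - pi by ring.
  by rewrite clausenN clausen_pi oppr0 mulr0 mul0r.
(* The duplication formula at [tau] produces [- 2 Cl2(s)], which cancels the third term of
   [prim1]. *)
have e2 : prim1 c = clausen tau / pi.
  rewrite /prim1 tauE subrr clausen0 subr0 -mulr2n -[tau *+ 2]mulr_natl clausen_2tau.
  have -> : pi - tau = s by rewrite /tau; ring.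
  rewrite subrK -mulf_div divff// mul1r//.
have e3 : prim1 (1 - c) = - (clausen tau / pi).
  rewrite /prim1 mulrBr mulr1 tauE.
  have -> : tau + (2 * pi - tau) = 0 + 2 * pi by ring.
  have -> : tau - (2 * pi - tau) = - (2 * pi - 2 * tau) by ring.
  have -> : pi - (2 * pi - tau) = - (pi - tau) by ring.
  have -> : pi - tau = s by rewrite /tau; ring.
  rewrite clausenD2pi clausen0 !clausenN clausen_2pi_sub clausen_2tau.
  have -> : 0 - - - (2 * clausen tau - 2 * clausen s) + 2 * - clausen s =
    - (2 * clausen tau) by ring.
  by rewrite mulNr -mulf_div divff// mul1r.
rewrite e0 e1 e2 e3 -/tau; ring.
Qed.

(** Same splitting as for [prim1]; the linear term integrates the constant
    [ln (chord2 s) = 2 lsin s]. *)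
Let prim2 x := (clausen (tau + 2 * pi * x) - clausen (tau - 2 * pi * x)) / (2 * pi)
  + 2 * lsin s * x.

Let der_prim2 x : cos (2 * pi * x) < cos tau -> der prim2 x (circle_ln2 s x).
Proof.
move=> cx; have p0 := pi0.
have cne : cos tau != cos (2 * pi * x) by rewrite gt_eqF.
have [h1 h2] := cos_pair_lt1 cne.
have d := two_pi_x x.
rewrite /prim2; apply: der_eq.
  apply: derD; last by deriv.
  apply: derM; last exact: der_cst.
  apply: derB.
  - by apply: der_clausen_comp; [exact: h1|apply: derD; [exact: der_cst|exact: d]].
  - by apply: der_clausen_comp; [exact: h2|apply: derB; [exact: der_cst|exact: d]].
have B0 : 0 < chord2 s - side2 x.
  by rewrite -opprB sideB; lra.
have A0 : 0 < chord2 s by have := side2_ge0 x; lra.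
have -> : circle_ln2 s x = ln (chord2 s) - ln (chord2 s - side2 x).
  rewrite /circle_ln2 -[RHS]opprB -ln_div ?posrE//; congr (- ln _).
  by field; rewrite lt0r_neq0.
have := lsin_pair cne; rewrite ger0_norm; last by lra.
have -> : 2 * cos tau - 2 * cos (2 * pi * x) = chord2 s - side2 x.
  by rewrite -[RHS]opprB sideB opprB.
move=> <-.
have -> : ln (chord2 s) = 2 * lsin s by rewrite /lsin -/(chord2 s); field.
move: (lsin _) (lsin _) (lsin _) => l1 l2 l3.
by rewrite /=; move: p0; generalize pi => P P0; field; rewrite lt0r_neq0.
Qed.

Let prim2_continuous x : {for x, continuous prim2}.
Proof.
have e y : prim2 y = (clausen (tau + 2 * pi * y) - clausen (tau + - (2 * pi) * y))
   / (2 * pi) + 2 * lsin s * y.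
  by rewrite /prim2 !mulNr.
rewrite (funext e).
apply: cvgD.
  apply: cvgM; last exact: cst_continuous.
  apply: cvgB; exact: continuous_clausen_affine.
by apply: cvgM; [exact: cst_continuous|exact: cvg_id].
Qed.

Let circle_ln2_continuous x : cos (2 * pi * x) < cos tau ->
  {for x, continuous (circle_ln2 s)}.
Proof.
move=> cx.
have B0 : 0 < chord2 s - side2 x by rewrite -opprB sideB; lra.
have A0 : 0 < chord2 s by have := side2_ge0 x; lra.
suff [d /der_continuous//] : exists d, der (circle_ln2 s) x d.
rewrite /circle_ln2 /side2; eexists; deriv.
by rewrite subr_gt0 -/(side2 x) ltr_pdivrMr// mul1r -subr_gt0.
Qed.

Lemma integral_circle_ln2 :
  (\int[mu]_(x in `[0%R, 1%R]) (circle_ln2 s x)%:E =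
   (2 / pi * (dilog_chord s - clausen (pi - s)))%:E)%E.
Proof.
case/andP: (s3) => s0 s3'; have p0 := pi0; have /andP[c0 c2] := c_bounds.
have A0 : 0 < chord2 s by apply: chord2_gt0; apply/andP; split; lra.
rewrite (integral_unit_split c_bounds (measurable_circle_ln2 s) (circle_ln2_ge0 s)).
rewrite integral_itv_eq0; last first.
  move=> x /cos_out cx; rewrite /circle_ln2 [ln _]ln0 ?oppr0// subr_le0.
  by rewrite ler_pdivlMr// mul1r -subr_ge0 sideB; lra.
rewrite [X in (_ + X)%E]integral_itv_eq0; last first.
  move=> x /cos_out' cx; rewrite /circle_ln2 [ln _]ln0 ?oppr0// subr_le0.
  by rewrite ler_pdivlMr// mul1r -subr_ge0 sideB; lra.
rewrite add0e adde0.
rewrite (@ge0_FTC _ (circle_ln2 s) prim2 c (1 - c) (prim2 c) (prim2 (1 - c)))//; first last.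
- by apply: cvg_at_left_filter; exact: prim2_continuous.
- by apply: cvg_at_right_filter; exact: prim2_continuous.
- by move=> x /cos_in; exact: der_prim2.
- by move=> x /cos_in; exact: circle_ln2_continuous.
- by move=> x _; exact: circle_ln2_ge0.
- lra.
congr (_%:E).
have e2 : prim2 c = (2 * clausen tau - 2 * clausen s) / (2 * pi) + 2 * lsin s * c.
  by rewrite /prim2 tauE subrr clausen0 subr0 -mulr2n -[tau *+ 2]mulr_natl clausen_2tau.
have e3 : prim2 (1 - c) =
    - ((2 * clausen tau - 2 * clausen s) / (2 * pi)) + 2 * lsin s * (1 - c).
  rewrite /prim2 [2 * pi * (1 - c)]mulrBr mulr1 tauE; congr (_ + _).
  have -> : tau + (2 * pi - tau) = 0 + 2 * pi by ring.
  have -> : tau - (2 * pi - tau) = - (2 * pi - 2 * tau) by ring.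
  rewrite clausenD2pi clausen0 !clausenN clausen_2pi_sub clausen_2tau.
  by rewrite opprK sub0r mulNr.
(* The linear term contributes through [1 - 2 c = s / pi], so [s lsin s + Cl2(s)] appears. That is
   [dilog_chord s], which has a trilogarithm as its integral against the cotangent. *)
rewrite e2 e3 dilog_chordE// /c /tau.
move: (clausen _) (clausen _) (lsin _) => C1 C2 l.
by move: p0; generalize pi => P P0; field; rewrite lt0r_neq0.
Qed.

End FixedS.

End CircleIntegrals.

(** * Mean of the squared logarithm, and the integrals against the cotangent *)

Section OuterIntegrals.
Context {R : realType}.
Implicit Types (A a b s v x y : R).

Local Notation pi := (@pi R).
Local Notation mu := (@lebesgue_measure R).

Let pi0 : 0 < pi. Proof. exact: pi_gt0. Qed.

Definition log_sqr_max A : R := (ln (Num.max 1 A) / 2) ^+ 2.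

Lemma log_sqr_max_ge0 A : 0 <= log_sqr_max A. Proof. exact: sqr_ge0. Qed.

Lemma measurable_log_sqr_max_side2 :
  measurable_fun [set: R] (fun x => log_sqr_max (side2 x)).
Proof.
apply: measurable_funX; apply: measurable_funM => //.
apply: (measurableT_comp (@measurable_ln R)).
by apply: measurable_maxr => //; exact: measurable_side2.
Qed.

Lemma side2_lsin x : ln (side2 x) / 2 = lsin (pi - 2 * pi * x).
Proof. by rewrite /lsin cos_pi_sub mulrN opprK. Qed.

Let cos_2pi3 : cos (2 * pi / 3) = - (1 / 2).
Proof.
rewrite (_ : 2 * pi / 3 = pi - pi / 3); last by field.
by rewrite cos_pi_sub cos_pi3.
Qed.

Lemma side2_reflect x : side2 (1 - x) = side2 x.
Proof.
rewrite /side2 (_ : 2 * pi * (1 - x) = 2 * pi - 2 * pi * x); last by ring.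
by rewrite cos_2pi_sub.
Qed.

Lemma side2_gt1 x : 0 <= x < 1 / 3 -> 1 < side2 x.
Proof.
have p0 := pi0; move=> /andP[x0 x3].
have h1 : 0 <= 2 * pi * x by rewrite !mulr_ge0// ltW.
have h2 : 2 * pi * x < 2 * pi * (1 / 3) by rewrite ltr_pM2l// mulr_gt0.
have : cos (2 * pi / 3) < cos (2 * pi * x).
  by rewrite ltr_cos ?in_itv/=; [lra|apply/andP; split; lra|apply/andP; split; lra].
by rewrite cos_2pi3 /side2; lra.
Qed.

Lemma side2_lt1 x : 1 / 3 < x <= 1 / 2 -> side2 x < 1.
Proof.
have p0 := pi0; move=> /andP[x0 x3].
have h1 : 2 * pi * x <= 2 * pi * (1 / 2) by rewrite ler_pM2l// mulr_gt0.
have h2 : 2 * pi * (1 / 3) < 2 * pi * x by rewrite ltr_pM2l// mulr_gt0.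
have : cos (2 * pi * x) < cos (2 * pi / 3).
  by rewrite ltr_cos ?in_itv/=; [lra|apply/andP; split; lra|apply/andP; split; lra].
by rewrite cos_2pi3 /side2; lra.
Qed.

Lemma side2_gt0 x : 0 <= x < 1 / 2 -> 0 < side2 x.
Proof.
have p0 := pi0; move=> /andP[x0 x3].
have h1 : 0 <= 2 * pi * x by rewrite !mulr_ge0// ltW.
have h2 : 2 * pi * x < 2 * pi * (1 / 2) by rewrite ltr_pM2l// mulr_gt0.
have : cos pi < cos (2 * pi * x).
  by rewrite ltr_cos ?in_itv/=; [lra|apply/andP; split; lra|apply/andP; split; lra].
by rewrite cospi /side2; lra.
Qed.

Let log_sqr_maxE x : 1 < side2 x -> log_sqr_max (side2 x) = lsin (pi - 2 * pi * x) ^+ 2.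
Proof. by move=> A1; rewrite /log_sqr_max max_r ?ltW// side2_lsin. Qed.

(** [side2] exceeds 1 exactly on the outer thirds, where half its logarithm is a log-sine of
    [pi - 2 pi x]. Each outer third sweeps the angles between [pi / 3] and [pi]. *)
Lemma integral_log_sqr_max :
  (\int[mu]_(x in `[0%R, 1%R]) (log_sqr_max (side2 x))%:E =
   ((logsine3 pi - logsine3 (pi / 3)) / pi)%:E)%E.
Proof.
have p0 := pi0.
have c_bounds : 0 < (1 / 3 : R) < 1 / 2 by apply/andP; split; lra.
rewrite (integral_unit_split c_bounds measurable_log_sqr_max_side2) => [|x]; last first.
  exact: log_sqr_max_ge0.
rewrite [X in (_ + X + _)%E]integral_itv_eq0; last first.
  move=> x /andP[x0 x1]; rewrite /log_sqr_max max_l ?ln1 ?mul0r ?expr0n//.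
  have [x2|x2] := leP x (1 / 2); first by rewrite ltW// side2_lt1// x0.
  by rewrite -side2_reflect ltW// side2_lt1//; apply/andP; split; lra.
rewrite adde0.
have cG a : 0 < a < 2 * pi -> {for a, continuous (@logsine3 R)}.
  exact: logsine3_continuous.
have lin (F : set_system R) (FF : Filter F) (a b c : R) : y @[y --> F] --> c ->
    a + b * y @[y --> F] --> a + b * c.
  by move=> yc; apply: cvgD; [exact: cvg_cst|apply: cvgM => //; exact: cvg_cst].
have -> : (\int[mu]_(x in `]0%R, (1 / 3)%R[) (log_sqr_max (side2 x))%:E =
    (- logsine3 (pi / 3) / (2 * pi) - (- logsine3 pi / (2 * pi)))%:E)%E.
  transitivity (\int[mu]_(x in `]0%R, (1 / 3)%R[) (lsin (pi - 2 * pi * x) ^+ 2)%:E)%E.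
    apply: eq_integral => x /set_mem; rewrite /= in_itv/= => /andP[x0 x3].
    by rewrite log_sqr_maxE// side2_gt1// ltW.
  have ok x : 0 < x < 1 / 3 -> 0 < pi - 2 * pi * x < 2 * pi.
    move=> /andP[x0 x3].
    have h1 : 0 < 2 * pi * x by rewrite !mulr_gt0.
    have h2 : 2 * pi * x < 2 * pi * (1 / 3) by rewrite ltr_pM2l// mulr_gt0.
    by apply/andP; split; lra.
  have d x : der (fun y => pi - 2 * pi * y) x (- (2 * pi)).
    by apply: der_eq; [deriv|ring].
  apply: (@ge0_FTC _ _ (fun x => - logsine3 (pi - 2 * pi * x) / (2 * pi))) => //.
  - by move=> x _; exact: sqr_ge0.
  - move=> x /ok/cos_lt1 cx.
    have := @der_comp _ _ (fun y => pi - 2 * pi * y) x _ _ (der_lsin cx) (d x).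
    by move=> dl; eapply der_continuous; apply: derX; exact: dl.
  - move=> x /ok xok; apply: der_eq.
      apply: derM; last exact: der_cst.
      apply: derN.
      exact: (@der_comp _ _ (fun y => pi - 2 * pi * y) x _ _ (der_logsine3 xok) (d x)).
    rewrite /=; move: (lsin _) (logsine3 _) => l g.
    by move: p0; generalize pi => P P0; field; rewrite lt0r_neq0.
  - apply: cvgM; last exact: cvg_cst.
    apply: cvgN; have pi2 : 0 < pi < 2 * pi by apply/andP; split; lra.
    apply: (continuous_cvg _ (cG _ pi2)).
    rewrite -[X in _ --> X]subr0 -[X in _ --> _ - X](mulr0 (2 * pi)).
    apply: cvgB; first exact: cvg_cst.
    by apply: cvgM; [exact: cvg_cst|exact: cvg_at_right_filter cvg_id].
  - apply: cvgM; last exact: cvg_cst.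
    apply: cvgN; have pi2 : 0 < pi / 3 < 2 * pi by apply/andP; split; lra.
    apply: (continuous_cvg _ (cG _ pi2)).
    have e : pi / 3 = pi - 2 * pi * (1 / 3) by field.
    rewrite [X in _ --> X]e.
    apply: cvgB; first exact: cvg_cst.
    by apply: cvgM; [exact: cvg_cst|exact: cvg_at_left_filter cvg_id].
have -> : (\int[mu]_(x in `](1 - 1 / 3)%R, 1%R[) (log_sqr_max (side2 x))%:E =
    (logsine3 pi / (2 * pi) - logsine3 (pi / 3) / (2 * pi))%:E)%E.
  transitivity (\int[mu]_(x in `](1 - 1 / 3)%R, 1%R[) (lsin (2 * pi * x - pi) ^+ 2)%:E)%E.
    apply: eq_integral => x /set_mem; rewrite /= in_itv/= => /andP[x0 x3].
    have x1 : 1 < side2 x by rewrite -side2_reflect side2_gt1//; apply/andP; split; lra.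
    by rewrite log_sqr_maxE// /lsin -(cosN (2 * pi * x - pi)) opprB.
  have ok x : 1 - 1 / 3 < x < 1 -> 0 < 2 * pi * x - pi < 2 * pi.
    move=> /andP[x0 x3].
    have h1 : 2 * pi * (1 - 1 / 3) < 2 * pi * x by rewrite ltr_pM2l// mulr_gt0.
    have h2 : 2 * pi * x < 2 * pi * 1 by rewrite ltr_pM2l// mulr_gt0.
    by apply/andP; split; lra.
  have d x : der (fun y => 2 * pi * y - pi) x (2 * pi).
    by apply: der_eq; [deriv|ring].
  apply: (@ge0_FTC _ _ (fun x => logsine3 (2 * pi * x - pi) / (2 * pi))) => //.
  - by move=> x _; exact: sqr_ge0.
  - move=> x /ok/cos_lt1 cx.
    have := @der_comp _ _ (fun y => 2 * pi * y - pi) x _ _ (der_lsin cx) (d x).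
    by move=> dl; eapply der_continuous; apply: derX; exact: dl.
  - move=> x /ok xok; apply: der_eq.
      apply: derM; last exact: der_cst.
      exact: (@der_comp _ _ (fun y => 2 * pi * y - pi) x _ _ (der_logsine3 xok) (d x)).
    rewrite /=; move: (lsin _) (logsine3 _) => l g.
    by move: p0; generalize pi => P P0; field; rewrite lt0r_neq0.
  - apply: cvgM; last exact: cvg_cst.
    have pi2 : 0 < pi / 3 < 2 * pi by apply/andP; split; lra.
    apply: (continuous_cvg _ (cG _ pi2)).
    have e : pi / 3 = 2 * pi * (1 - 1 / 3) - pi by field.
    rewrite [X in _ --> X]e.
    apply: cvgB; last exact: cvg_cst.
    by apply: cvgM; [exact: cvg_cst|exact: cvg_at_right_filter cvg_id].
  - apply: cvgM; last exact: cvg_cst.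
    have pi2 : 0 < pi < 2 * pi by apply/andP; split; lra.
    apply: (continuous_cvg _ (cG _ pi2)).
    have e : pi = 2 * pi * 1 - pi by ring.
    rewrite [X in _ --> X]e.
    apply: cvgB; last exact: cvg_cst.
    by apply: cvgM; [exact: cvg_cst|exact: cvg_at_left_filter cvg_id].
rewrite -EFinD; congr (_%:E).
move: (logsine3 _) (logsine3 _) => g1 g2.
by move: p0; generalize pi => P P0; field; rewrite lt0r_neq0.
Qed.

(** By parts, the integral of [cot_half s * Cl2(pi - s)] leaves that of [lsin s * lsin (pi - s)]. As
    [lsin (2 s)] is the sum of the two factors, polarization turns the product into squares, each
    integrated by [logsine3]. *)
Definition clausen_primitive s : R :=
  lsin s * clausen (pi - s) -
    (logsine3 (2 * s) / 2 - logsine3 s + logsine3 (pi - s)) / 2.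

Lemma der_clausen_primitive s : 0 < s < pi / 3 ->
  der clausen_primitive s (cot_half s * clausen (pi - s)).
Proof.
move=> /andP[s0 s3]; have p0 := pi0.
have b1 : 0 < s < 2 * pi by apply/andP; split; lra.
have b2 : 0 < 2 * s < 2 * pi by apply/andP; split; lra.
have b3 : 0 < pi - s < 2 * pi by apply/andP; split; lra.
have dl := der_lsin_itv b1.
have d1 := der_logsine3 b1.
have r2 : der (fun y => 2 * y) s 2 by apply: der_eq; [deriv|ring].
have r3 : der (fun y => pi - y) s (- 1) by apply: der_eq; [deriv|ring].
have d2 := @der_comp _ _ (fun y => 2 * y) s _ _ (der_logsine3 b2) r2.
have d3 := @der_comp _ _ (fun y => pi - y) s _ _ (der_logsine3 b3) r3.
have dc := @der_comp _ _ (fun y => pi - y) s _ _ (der_clausen_itv b3) r3.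
rewrite /clausen_primitive; apply: der_eq.
  apply: derB; first by apply: derM; [exact: dl|exact: dc].
  apply: derM; last exact: der_cst.
  apply: derD; last exact: d3.
  apply: derB; last exact: d1.
  by apply: derM; [exact: d2|exact: der_cst].
rewrite /= (@lsin_double R s); last by apply/andP; split; lra.
by field.
Qed.

(** Linear vanishing at 0, required to kill the boundary term [lsin s * Cl2(pi - s)]; the derivative
    [lsin (pi - z)] is regular there. *)
Lemma clausen_pi_sub_le s : 0 < s < pi / 3 -> `|clausen (pi - s)| <= 2 * s.
Proof.
move=> /andP[s0 s3]; have p0 := pi0.
have c1 z : 0 <= z <= s -> 1 / 2 <= cos z.
  move=> /andP[z0 zs]; rewrite -cos_pi3 leNgt ltr_cos ?in_itv/=; [lra| |];
    apply/andP; split; lra.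
have dF z : 0 <= z <= s -> der (fun y => clausen (pi - y)) z (lsin (pi - z)).
  move=> /c1 cz; have h : cos (pi - z) < 1 by rewrite cos_pi_sub; lra.
  apply: der_eq; first by apply: der_clausen_comp; [exact: h|deriv].
  by ring.
have dH z : 0 <= z <= s -> der (fun y : R => 2 * y) z 2.
  by move=> _; apply: der_eq; [deriv|ring].
have fh z : 0 <= z <= s -> `|lsin (pi - z)| <= 2.
  move=> /c1 cz; rewrite /lsin cos_pi_sub; have := cos_le1 z => cz1.
  rewrite ger0_norm; last by rewrite divr_ge0// ln_ge0//; lra.
  have : ln (2 - 2 * - cos z) < 2 - 2 * - cos z by apply: ln_sublinear; lra.
  lra.
have := derive_norm_le (ltW s0) dF dH fh.
by rewrite subr0 clausen_pi subr0 mulr0 subr0.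
Qed.

Lemma clausen_primitive_cvg0 :
  clausen_primitive s @[s --> (0 : R)^'+] --> - (logsine3 pi / 2).
Proof.
have p0 := pi0.
have e : - (logsine3 pi / 2) = 0 - (0 / 2 - 0 + logsine3 pi) / 2 by ring.
rewrite /clausen_primitive [X in _ --> X]e.
have p3 : 0 < pi / 3 by rewrite divr_gt0.
apply: cvgB.
  have [|h _] := @lsin_mul_cvg0 R (fun s => clausen (pi - s)) 4.
    apply: filterS2 near_chord (near_right_itv p3) => s [s0 sc _ _].
    by move=> /clausen_pi_sub_le; lra.
  by apply: cvg_trans h; apply: near_eq_cvg; near=> s; rewrite mulrC.
apply: cvgM; last exact: cvg_cst.
apply: cvgD; first apply: cvgB.
- by apply: cvgM; [exact: logsine3_scale_cvg0|exact: cvg_cst].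
- exact: logsine3_cvg0.
- have pi2 : 0 < pi < 2 * pi by apply/andP; split; lra.
  apply: (continuous_cvg _ (logsine3_continuous pi2)).
  rewrite -[X in _ --> X]subr0; apply: cvgB; first exact: cvg_cst.
  exact: cvg_at_right_filter cvg_id.
Unshelve. all: by end_near. Qed.

(** The integral of [cot_half s * Cl2(pi - s)] over []0, pi / 3[]. *)
Definition clausen_moment : R :=
  logsine3 pi / 2 - 3 / 4 * logsine3 (2 * pi / 3) + logsine3 (pi / 3) / 2.

Lemma clausen_primitive_pi3 :
  clausen_primitive s @[s --> (pi / 3)^'-] --> clausen_moment - logsine3 pi / 2.
Proof.
have p0 := pi0.
have p3 : 0 < pi / 3 < pi / 2 by apply/andP; split; lra.
have e : clausen_moment - logsine3 pi / 2 = clausen_primitive (pi / 3).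
  rewrite /clausen_primitive lsin_pi3 mul0r sub0r.
  have -> : 2 * (pi / 3) = 2 * pi / 3 by field.
  have -> : pi - pi / 3 = 2 * pi / 3 by field.
  by rewrite /clausen_moment; field.
rewrite [X in _ --> X]e; apply: cvg_at_left_filter.
have ci : y @[y --> pi / 3] --> pi / 3 by exact: cvg_id.
have c2 : 2 * y @[y --> pi / 3] --> 2 * (pi / 3) by apply: cvgM => //; exact: cvg_cst.
have c3 : pi - y @[y --> pi / 3] --> pi - pi / 3 by apply: cvgB => //; exact: cvg_cst.
apply: cvgB.
  apply: cvgM; first by apply: continuous_lsin; rewrite cos_pi3; lra.
  exact: (continuous_cvg _ (@continuous_clausen R _) c3).
apply: cvgM; last exact: cvg_cst.
apply: cvgD; first apply: cvgB.
- apply: cvgM; last exact: cvg_cst.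
  have h : 0 < 2 * (pi / 3) < 2 * pi by apply/andP; split; lra.
  exact: (continuous_cvg _ (logsine3_continuous h) c2).
- by apply: logsine3_continuous; apply/andP; split; lra.
- have h : 0 < pi - pi / 3 < 2 * pi by apply/andP; split; lra.
  exact: (continuous_cvg _ (logsine3_continuous h) c3).
Qed.

(** The sign is read off from the mean of a nonnegative function that has this value, not from the
    Clausen series. *)
Lemma clausen_pi_sub_ge0 s : 0 < s < pi / 3 -> 0 <= 2 / pi * clausen (pi - s).
Proof.
move=> s3; rewrite -lee_fin -integral_circle_ln1//.
by apply: integral_ge0 => x _; rewrite lee_fin; exact: circle_ln1_ge0.
Qed.

Lemma dilog_chord_sub_ge0 s : 0 < s < pi / 3 ->
  0 <= 2 / pi * (dilog_chord s - clausen (pi - s)).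
Proof.
move=> s3; rewrite -lee_fin -integral_circle_ln2//.
by apply: integral_ge0 => x _; rewrite lee_fin; exact: circle_ln2_ge0.
Qed.

Let bounds s : 0 < s < pi / 3 -> 0 < s < 2 * pi /\ 0 < cot_half s.
Proof.
have p0 := pi0; move=> /andP[s0 s3]; split; first by apply/andP; split; lra.
by apply: cot_half_gt0; apply/andP; split; lra.
Qed.

Let cot_half_continuous s : 0 < s < pi / 3 -> {for s, continuous (@cot_half R)}.
Proof.
move=> /bounds[/sin_half_neq0 s0 _].
suff [d /der_continuous//] : exists d, der (@cot_half R) s d.
by eexists; rewrite /cot_half; deriv; rewrite mulf_neq0.
Qed.

Let clausen_pi_sub_continuous s : {for s, continuous (fun y => clausen (pi - y))}.
Proof.
apply: (continuous_cvg _ (@continuous_clausen R _)).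
by apply: cvgB; [exact: cst_continuous|exact: cvg_id].
Qed.

Lemma integral_cot_clausen :
  (\int[mu]_(s in `]0%R, (pi / 3)%R[) (`|cot_half s| * (2 / pi * clausen (pi - s)))%:E =
   (2 / pi * clausen_moment)%:E)%E.
Proof.
have p0 := pi0; have p3 : 0 < pi / 3 by rewrite divr_gt0.
transitivity (\int[mu]_(s in `]0%R, (pi / 3)%R[)
    (cot_half s * (2 / pi * clausen (pi - s)))%:E)%E.
  apply: eq_integral => s /set_mem; rewrite /= in_itv/= => /bounds[_ c0].
  by rewrite gtr0_norm.
have -> : 2 / pi * clausen_moment =
    2 / pi * (clausen_moment - logsine3 pi / 2) - 2 / pi * (- (logsine3 pi / 2)) by ring.
apply: (@ge0_FTC _ _ (fun s => 2 / pi * clausen_primitive s)) => //.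
- by move=> s s3; have [_ c0] := bounds s3; rewrite mulr_ge0 ?clausen_pi_sub_ge0// ltW.
- move=> s s3; apply: cvgM; first exact: cot_half_continuous.
  by apply: cvgM; [exact: cst_continuous|exact: clausen_pi_sub_continuous].
- move=> s s3; apply: der_eq.
    by apply: derM; [exact: der_cst|exact: der_clausen_primitive].
  by rewrite /=; ring.
- by apply: cvgM; [exact: cvg_cst|exact: clausen_primitive_cvg0].
- by apply: cvgM; [exact: cvg_cst|exact: clausen_primitive_pi3].
Qed.

(** By [der_trilog_chord], [trilog_chord s + s^3 / 24] is a primitive of [cot_half * dilog_chord];
    its limit at [pi / 3] is [7 pi^3 / 216], half of [G(pi / 3)]. *)
Lemma integral_cot_dilog_chord :
  (\int[mu]_(s in `]0%R, (pi / 3)%R[)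
     (`|cot_half s| * (2 / pi * (dilog_chord s - clausen (pi - s))))%:E =
   (2 / pi * (logsine3 (pi / 3) / 2 - clausen_moment))%:E)%E.
Proof.
have p0 := pi0; have p3 : 0 < pi / 3 by rewrite divr_gt0.
transitivity (\int[mu]_(s in `]0%R, (pi / 3)%R[)
    (cot_half s * (2 / pi * (dilog_chord s - clausen (pi - s))))%:E)%E.
  apply: eq_integral => s /set_mem; rewrite /= in_itv/= => /bounds[_ c0].
  by rewrite gtr0_norm.
have -> : 2 / pi * (logsine3 (pi / 3) / 2 - clausen_moment) =
    2 / pi * (5 * pi ^+ 3 / 162 + (pi / 3) ^+ 3 / 24 - (clausen_moment - logsine3 pi / 2))
    - 2 / pi * (0 + 0 ^+ 3 / 24 - (- (logsine3 pi / 2))).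
  rewrite logsine3_pi3; move: clausen_moment (logsine3 _) => V g.
  by move: p0; generalize pi => P P0; field; rewrite lt0r_neq0.
have cube (F : set_system R) (FF : Filter F) (c : R) : y @[y --> F] --> c ->
    y ^+ 3 / 24 @[y --> F] --> c ^+ 3 / 24.
  move=> yc; apply: cvgM; last exact: cvg_cst.
  exact: (continuous_cvg _ (@exprn_continuous R 3 c) yc).
apply: (@ge0_FTC _ _
  (fun s => 2 / pi * (trilog_chord s + s ^+ 3 / 24 - clausen_primitive s))) => //.
- by move=> s s3; have [_ c0] := bounds s3; rewrite mulr_ge0 ?dilog_chord_sub_ge0// ltW.
- move=> s s3; apply: cvgM; first exact: cot_half_continuous.
  apply: cvgM; first exact: cst_continuous.
  apply: cvgB; last exact: clausen_pi_sub_continuous.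
  exact: der_continuous (der_dilog_chord s3).
- move=> s s3; apply: der_eq.
    apply: derM; first exact: der_cst.
    apply: derB; last exact: der_clausen_primitive.
    by apply: derD; [exact: der_trilog_chord|deriv].
  rewrite /=; move: p0; move: (cot_half _) (dilog_chord _) (clausen _) (trilog_chord _) => l q k t.
  by move: (clausen_primitive _) => cp; generalize pi => P P0; field; rewrite lt0r_neq0.
- apply: cvgM; first exact: cvg_cst.
  apply: cvgB; last exact: clausen_primitive_cvg0.
  apply: cvgD; first exact: polylog_chord_cvg0.
  by apply: cube; exact: cvg_at_right_filter cvg_id.
- apply: cvgM; first exact: cvg_cst.
  apply: cvgB; last exact: clausen_primitive_pi3.
  apply: cvgD; last by apply: cube; exact: cvg_at_left_filter cvg_id.
  by rewrite -polylog3_pi3; exact: polylog_chord_pi3.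
Qed.

End OuterIntegrals.

(** * Tonelli on rectangles and the assembly of the measure *)

Section MahlerMeasure.
Context {R : realType}.
Implicit Types (A B : set R) (s x y : R).

Local Notation pi := (@pi R).
Local Notation mu := (@lebesgue_measure R).

Let pi0 : 0 < pi. Proof. exact: pi_gt0. Qed.

Section Tonelli.
Variables (f : R * R -> R) (A B : set R).
Hypotheses (mA : measurable A) (mB : measurable B).
Hypotheses (mf : measurable_fun [set: R * R] f) (f0 : forall z, 0 <= f z).

(** Extension by zero, so that Tonelli on the whole plane yields iterated integrals over the
    rectangle. *)
Let F : R * R -> \bar R := (EFin \o f) \_ (A `*` B).

Let mF : measurable_fun [set: R * R] F.
Proof.
apply/(measurable_restrictT _ (measurableX mA mB)).
by apply/measurable_EFinP; exact: measurable_funTS.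
Qed.

Let F0 z : (0 <= F z)%E.
Proof. by apply: erestrict_ge0 => t _; rewrite lee_fin. Qed.

Let FxE x : fubini_F mu F x =
  ((fun x => \int[mu]_(y in B) (f (x, y))%:E)%E \_ A) x.
Proof.
rewrite /fubini_F patchE; case: ifPn => xA.
  rewrite [RHS]integral_mkcond; apply: eq_integral => y _.
  by rewrite /F !patchE in_setX xA.
by apply: integral0_eq => y _; rewrite /F patchE in_setX (negbTE xA).
Qed.

Let FyE y : fubini_G mu F y =
  ((fun y => \int[mu]_(x in A) (f (x, y))%:E)%E \_ B) y.
Proof.
rewrite /fubini_G patchE; case: ifPn => yB.
  rewrite [RHS]integral_mkcond; apply: eq_integral => x _.
  by rewrite /F !patchE in_setX yB andbT.
by apply: integral0_eq => x _; rewrite /F patchE in_setX (negbTE yB) andbF.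
Qed.

Lemma tonelli_setX :
  (\int[mu \x mu]_(z in A `*` B) (f z)%:E =
   \int[mu]_(x in A) \int[mu]_(y in B) (f (x, y))%:E)%E.
Proof.
rewrite integral_mkcond -/F fubini_tonelli1//.
by rewrite [RHS]integral_mkcond; apply: eq_integral => x _; exact: FxE.
Qed.

Lemma tonelli_swap :
  (\int[mu]_(x in A) \int[mu]_(y in B) (f (x, y))%:E =
   \int[mu]_(y in B) \int[mu]_(x in A) (f (x, y))%:E)%E.
Proof.
rewrite -tonelli_setX integral_mkcond -/F fubini_tonelli2//.
by rewrite [RHS]integral_mkcond; apply: eq_integral => y _; exact: FyE.
Qed.

Lemma measurable_inner_integral :
  measurable_fun A (fun x => \int[mu]_(y in B) (f (x, y))%:E)%E.
Proof.
apply/(measurable_restrictT _ mA).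
by rewrite -(funext FxE); exact: measurable_fun_fubini_tonelli_F.
Qed.

End Tonelli.

Let I01 : set R := `[0, 1]%classic.
Let J : set R := `]0, pi / 3[%classic.

Let mI01 : measurable I01. Proof. exact: measurable_itv. Qed.
Let mJ : measurable J. Proof. exact: measurable_itv. Qed.

Definition norm2_sum x y : R :=
  (1 + cos (2 * pi * x) + cos (2 * pi * y)) ^+ 2 +
  (sin (2 * pi * x) + sin (2 * pi * y)) ^+ 2.

Lemma ln_cabs x y :
  ln (cabs (1 + expi2pi x + expi2pi y)) = ln (norm2_sum x y) / 2.
Proof.
have -> : cabs (1 + expi2pi x + expi2pi y) = Num.sqrt (norm2_sum x y).
  by rewrite /cabs /norm2_sum /expi2pi /= add0r.
have := addr_ge0 (sqr_ge0 (1 + cos (2 * pi * x) + cos (2 * pi * y)))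
  (sqr_ge0 (sin (2 * pi * x) + sin (2 * pi * y))).
rewrite -/(norm2_sum x y) le_eqVlt => /predU1P[<-|n0].
  by rewrite sqrtr0 ln0// mul0r.
rewrite -[in RHS](sqr_sqrtr (ltW n0)) lnXn ?sqrtr_gt0//.
by rewrite -[ln _ *+ 2]mulr_natr mulfK.
Qed.

(** Since [1 + e(x) = 2 cos (pi x) e^(i pi x)], dividing by [e(y)] leaves the modulus of
    [1 - r e^(i b)] with a radius [r] that may be negative. *)
Lemma norm2_sumE x y : norm2_sum x y =
  cdist2 (- (2 * cos (pi * x))) (2 * pi * y + - (pi * x)).
Proof.
rewrite /norm2_sum /cdist2; have -> : 2 * pi * x = pi * x + pi * x by ring.
rewrite cosD sinD [cos (_ + - _)]cosB.
set c := cos (pi * x); set s := sin (pi * x).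
set C := cos (2 * pi * y); set S := sin (2 * pi * y).
have h1 : s ^+ 2 = 1 - c ^+ 2 by exact: sin2cos2.
have h2 : S ^+ 2 = 1 - C ^+ 2 by exact: sin2cos2.
have -> : (1 + (c * c - s * s) + C) ^+ 2 + (s * c + c * s + S) ^+ 2 =
  (1 + c ^+ 2 - s ^+ 2 + C) ^+ 2 + 4 * s ^+ 2 * c ^+ 2 + 4 * s * c * S + S ^+ 2 by ring.
by rewrite h2 h1; ring.
Qed.

Lemma side2E x : side2 x = (2 * cos (pi * x)) ^+ 2.
Proof.
rewrite /side2; have -> : 2 * pi * x = pi * x + pi * x by ring.
by rewrite cosD -!expr2 sin2cos2; ring.
Qed.

(* The sign of [cos (pi x)] is absorbed in a half turn of the angle. *)
Lemma norm2_sum_polar x : exists psi, forall y,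
  norm2_sum x y = cdist2 `|2 * cos (pi * x)| (2 * pi * y + psi).
Proof.
have [c0|c0] := leP 0 (2 * cos (pi * x)).
  exists (- (pi * x) + pi) => y.
  by rewrite norm2_sumE ger0_norm// addrA /cdist2 cosDpi; ring.
by exists (- (pi * x)) => y; rewrite norm2_sumE ltr0_norm.
Qed.

Definition inner_mean x : \bar R :=
  (\int[mu]_(y in I01) ((ln (norm2_sum x y) / 2) ^+ 2)%:E)%E.

Lemma inner_mean_lt1 x : side2 x < 1 -> inner_mean x = (dilog (side2 x) / 2)%:E.
Proof.
move=> x1; have [psi E] := norm2_sum_polar x.
set r := `|2 * cos (pi * x)| in E.
have r2 : r ^+ 2 = side2 x by rewrite real_normK ?num_real// side2E.
have r01 : 0 <= r < 1.
  rewrite normr_ge0/= ltNge; apply/negP => /(exprn_ege1 2).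
  by rewrite r2 leNgt x1.
have := integral_log_sqr psi 0 r01.
rewrite expr0n add0r r2 => <-; apply: eq_integral => y _.
by rewrite add0r -E.
Qed.

(** [|1 - r e^(i b)| = r |1 - r^(-1) e^(i b)|] brings the radius below 1, and [kappa = ln r] records
    the factor taken out. *)
Lemma inner_mean_gt1 x : 1 < side2 x ->
  inner_mean x = (log_sqr_max (side2 x) + dilog (side2 x)^-1 / 2)%:E.
Proof.
move=> x1; have [psi E] := norm2_sum_polar x.
set r := `|2 * cos (pi * x)| in E.
have r2 : r ^+ 2 = side2 x by rewrite real_normK ?num_real// side2E.
have r1 : 1 < r.
  by rewrite ltNge; apply/negP => h; have := exprn_ile1 2 (normr_ge0 _) h;
    rewrite r2 leNgt x1.
have r0 : 0 < r by exact: lt_trans r1.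
have r01 : 0 <= r^-1 < 1 by rewrite invr_ge0 ltW//= invf_lt1.
have := integral_log_sqr psi (ln (side2 x) / 2) r01.
rewrite exprVn r2 /log_sqr_max max_r; last exact: ltW.
move=> <-; apply: eq_integral => y _; congr ((_ ^+ 2)%:E).
rewrite E -r2 -mulrDl -lnM ?posrE ?exprn_gt0//; last first.
  apply: lt_le_trans (cdist2_ge_sqr _ _); last by case/andP: r01.
  by rewrite exprn_gt0// subr_gt0; case/andP: r01.
congr (ln _ / 2); rewrite /cdist2; field.
by rewrite lt0r_neq0.
Qed.

Let ker1_xs (z : R * R) : R := ker1 (side2 z.1) z.2.
Let ker2_xs (z : R * R) : R := ker2 (side2 z.1) z.2.

Let mside : measurable_fun [set: R * R] (fun z => side2 z.1).
Proof. exact: measurableT_comp measurable_side2 measurable_fst. Qed.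

Let mchord : measurable_fun [set: R * R] (fun z => chord2 z.2).
Proof. exact: measurableT_comp measurable_chord2 measurable_snd. Qed.

Let mcot : measurable_fun [set: R * R] (fun z => `|cot_half z.2|).
Proof. exact: measurableT_comp measurable_norm_cot_half measurable_snd. Qed.

Let mker1 : measurable_fun [set: R * R] ker1_xs.
Proof.
apply: measurable_funM => //; apply: measurableT_comp => //.
apply: (measurableT_comp (@measurable_ln R)); apply: measurable_funB => //.
apply: measurable_funM => //; apply: measurable_fun_inv_ge0 => // z.
exact: side2_ge0.
Qed.

Let mker2 : measurable_fun [set: R * R] ker2_xs.
Proof.
apply: measurable_funM => //; apply: measurableT_comp => //.
apply: (measurableT_comp (@measurable_ln R)); apply: measurable_funB => //.
apply: measurable_funM => //; apply: measurable_fun_inv_ge0 => // z.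
exact: chord2_ge0.
Qed.

Let ker1_xs_ge0 z : 0 <= ker1_xs z. Proof. exact: ker1_ge0 (side2_ge0 _). Qed.
Let ker2_xs_ge0 z : 0 <= ker2_xs z. Proof. exact: ker2_ge0 (side2_ge0 _). Qed.

Lemma integral_ker1_swap :
  (\int[mu]_(x in I01) \int[mu]_(s in J) (ker1 (side2 x) s)%:E =
   (2 / pi * clausen_moment)%:E)%E.
Proof.
rewrite (tonelli_swap mI01 mJ mker1 ker1_xs_ge0) -integral_cot_clausen.
apply: eq_integral => s /set_mem; rewrite /J /= in_itv/= => s3.
rewrite EFinM -(integral_circle_ln1 s3) -ge0_integralZl_EFin//.
- by move=> x _; rewrite lee_fin; exact: circle_ln1_ge0.
- by apply/measurable_EFinP; apply: measurable_funTS; exact: measurable_circle_ln1.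
Qed.

Lemma integral_ker2_swap :
  (\int[mu]_(x in I01) \int[mu]_(s in J) (ker2 (side2 x) s)%:E =
   (2 / pi * (logsine3 (pi / 3) / 2 - clausen_moment))%:E)%E.
Proof.
rewrite (tonelli_swap mI01 mJ mker2 ker2_xs_ge0) -integral_cot_dilog_chord.
apply: eq_integral => s /set_mem; rewrite /J /= in_itv/= => s3.
rewrite EFinM -(integral_circle_ln2 s3) -ge0_integralZl_EFin//.
- by move=> x _; rewrite lee_fin; exact: circle_ln2_ge0.
- by apply/measurable_EFinP; apply: measurable_funTS; exact: measurable_circle_ln2.
Qed.

(** One formula for both regimes, with nonnegative terms on each side, so it can be integrated over
    [x] before anything is known to be finite. *)
Lemma inner_mean_ker x : 0 < side2 x -> side2 x != 1 ->
  (inner_mean x + \int[mu]_(s in J) (ker2 (side2 x) s)%:E =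
   (log_sqr_max (side2 x))%:E + \int[mu]_(s in J) (ker1 (side2 x) s)%:E)%E.
Proof.
move=> A0; rewrite neq_lt => /orP[A1|A1].
  rewrite inner_mean_lt1// /J integral_ker2_lt1// integral_ker1_lt1//.
  rewrite /log_sqr_max max_l ?ltW// ln1 mul0r expr0n /= add0e -EFinD.
  by congr (_%:E); field.
rewrite inner_mean_gt1// /J integral_ker2_gt1// integral_ker1_gt1//.
by rewrite adde0 EFinD.
Qed.

Let norm2_sum_fun (z : R * R) : R := (ln (norm2_sum z.1 z.2) / 2) ^+ 2.

Let mnorm2 : measurable_fun [set: R * R] norm2_sum_fun.
Proof.
have mtrig (h : R -> R) (p : R * R -> R) : continuous h ->
    measurable_fun [set: R * R] p -> measurable_fun [set: R * R] (fun z => h (2 * pi * p z)).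
  move=> ch mp; apply: (measurableT_comp (continuous_measurable_fun ch)).
  exact: measurable_funM.
apply: measurable_funX; apply: measurable_funM => //.
apply: (measurableT_comp (@measurable_ln R)); apply: measurable_funD.
  apply: measurable_funX; apply: measurable_funD; first apply: measurable_funD => //.
    by apply: mtrig => //; exact: continuous_cos.
  by apply: mtrig => //; exact: continuous_cos.
apply: measurable_funX; apply: measurable_funD.
  by apply: mtrig => //; exact: continuous_sin.
by apply: mtrig => //; exact: continuous_sin.
Qed.

Lemma higher_mahler2_inner :
  higher_mahler2 2 (fun x y : R[i] => 1 + x + y) =
  (\int[mu]_(x in I01) inner_mean x)%E.
Proof.
rewrite -(@tonelli_setX norm2_sum_fun I01 I01)//; last by move=> z; exact: sqr_ge0.
by apply: eq_integral => z _; rewrite /norm2_sum_fun ln_cabs.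
Qed.

Lemma side2_regular x : x \in I01 -> x != 1 / 3 -> x != 1 / 2 -> x != 2 / 3 ->
  0 < side2 x /\ side2 x != 1.
Proof.
have H y : 0 <= y <= 1 / 2 -> y != 1 / 3 -> y != 1 / 2 -> 0 < side2 y /\ side2 y != 1.
  move=> /andP[y0 y2] y3 y2'; split.
    by rewrite side2_gt0// y0 lt_neqAle y2'.
  move: y3; rewrite neq_lt => /orP[y3|y3].
    by rewrite gt_eqF// side2_gt1// y0.
  by rewrite lt_eqF// side2_lt1// y3.
move=> /set_mem; rewrite /I01 /= in_itv/= => /andP[x0 x1] h3 h2 h23.
have [x2|x2] := leP x (1 / 2); first by apply: H => //; rewrite x0.
rewrite -side2_reflect; apply: H; first by apply/andP; split; lra.
  by apply: contra_neq h23 => e; lra.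
by apply: contra_neq h2 => e; lra.
Qed.

Lemma higher_mahler2_logsine3 :
  higher_mahler2 2 (fun x y : R[i] => 1 + x + y) =
  (3 / pi * (logsine3 pi - logsine3 (2 * pi / 3)))%:E.
Proof.
have p0 := pi0.
rewrite higher_mahler2_inner.
pose R1 x := (\int[mu]_(s in J) (ker1 (side2 x) s)%:E)%E.
pose R2 x := (\int[mu]_(s in J) (ker2 (side2 x) s)%:E)%E.
have mR1 : measurable_fun I01 R1 by exact: (measurable_inner_integral mI01 mJ mker1 ker1_xs_ge0).
have mR2 : measurable_fun I01 R2 by exact: (measurable_inner_integral mI01 mJ mker2 ker2_xs_ge0).
have mW : measurable_fun I01 inner_mean.
  apply: (measurable_inner_integral mI01 mI01 mnorm2) => z; exact: sqr_ge0.
have mL : measurable_fun I01 (fun x => (log_sqr_max (side2 x))%:E).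
  by apply/measurable_EFinP; apply: measurable_funTS; exact: measurable_log_sqr_max_side2.
have R1_ge0 x : (0 <= R1 x)%E.
  by apply: integral_ge0 => s _; rewrite lee_fin ker1_ge0// side2_ge0.
have R2_ge0 x : (0 <= R2 x)%E.
  by apply: integral_ge0 => s _; rewrite lee_fin ker2_ge0// side2_ge0.
have W_ge0 x : (0 <= inner_mean x)%E.
  by apply: integral_ge0 => s _; rewrite lee_fin sqr_ge0.
have E : (\int[mu]_(x in I01) (inner_mean x + R2 x) =
    \int[mu]_(x in I01) ((log_sqr_max (side2 x))%:E + R1 x))%E.
  apply: ae_eq_integral => //.
  - exact: emeasurable_funD.
  - exact: emeasurable_funD.
  exists ([set 1 / 3] `|` [set 1 / 2] `|` [set 2 / 3]); split.
  - by apply: measurableU => //; exact: measurableU.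
  - have z y : mu [set y] = 0%E by exact: lebesgue_measure_set1.
    have m3 : measurable [set 1 / 3 : R] by [].
    have m2 : measurable [set 1 / 2 : R] by [].
    have m23 : measurable [set 2 / 3 : R] by [].
    rewrite (@measureU0 _ _ _ mu _ _ (measurableU _ _ m3 m2) m23 (z _)).
    by rewrite (@measureU0 _ _ _ mu _ _ m3 m2 (z _)); exact: z.
  - move=> x /= /not_implyP[xI]; apply: contra_notP => /not_orP[/not_orP[h3 h2] h23].
    have [A0 A1] := @side2_regular x (mem_set xI) (introN eqP h3) (introN eqP h2) (introN eqP h23).
    exact: inner_mean_ker.
move: E; rewrite (ge0_integralD mu mI01 (fun x _ => W_ge0 x) mW (fun x _ => R2_ge0 x) mR2).
rewrite (ge0_integralD mu mI01 _ mL (fun x _ => R1_ge0 x) mR1); last first.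
  by move=> x _; rewrite lee_fin log_sqr_max_ge0.
rewrite /R1 /R2 integral_ker1_swap integral_ker2_swap integral_log_sqr_max -EFinD.
set M := (\int[mu]_(x in I01) inner_mean x)%E.
have M0 : (0 <= M)%E by exact: integral_ge0.
(* The other three integrals are finite, so an infinite [M] contradicts the equation. *)
case: M M0 => [m| |]//= _; rewrite -EFinD => -[] E; congr (_%:E).
have {}E : m = (logsine3 pi - logsine3 (pi / 3)) / pi + 2 / pi * clausen_moment
    - 2 / pi * (logsine3 (pi / 3) / 2 - clausen_moment) by rewrite -E; ring.
rewrite {}E /clausen_moment.
(* The two kernels contribute [4 / pi] times [clausen_moment] in all; its multiple of [G(pi / 3)]
   cancels the two others. *)
move: (logsine3 _) (logsine3 _) (logsine3 _) => g1 g2 g3.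
by move: p0; generalize pi => P P0; field; rewrite lt0r_neq0.
Qed.

End MahlerMeasure.

Local Close Scope classical_set_scope.
Unset Implicit Arguments.

Theorem theorem4p4 (R : realType) :
  higher_mahler2 2 (fun x y : R[i] => 1 + x + y) =
    (24 / (5 * pi) * Ti3 (1 / Num.sqrt 3) + 2 * ln 3 / pi * Cl2 (pi / 3)
     - ln 3 ^+ 2 / 10 - 19 * pi ^+ 2 / 180)%:E
  /\
  higher_mahler2 2 (fun x y : R[i] => 1 + x + y) =
    (pi ^+ 2 / 4 + 3 / pi * Ls3 (2 * pi / 3))%:E.
Proof.
have p0 : 0 < pi :> R by exact: pi_gt0.
rewrite higher_mahler2_logsine3; split; congr (_%:E).
  by rewrite closed_forms_eq.
(* The term [pi^2 / 4] is [(3 / pi) (pi^3 / 12)]. *)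
rewrite logsine3_pi /logsine3; move: (Ls3 _) => l.
by move: p0; generalize (@pi R) => P P0; field; rewrite lt0r_neq0.
Qed.
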